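(* Let $\mathcal M$ be a minimal space-like surface in $\mathbb R^4_1$ without degenerate points. Then $\mathcal M$ admits locally (i.e. in a neighborhood of each of its points) canonical coordinates of the first type, and it admits locally canonical coordinates of the second type.
   Context: $\mathbb R^4_1$ is $\mathbb R^4$ with the indefinite product $a\cdot b=a_1b_1+a_2b_2+a_3b_3-a_4b_4$; for a vector $a$ we write $a^2=a\cdot a$. A surface $\mathcal M$, given by an immersion $\mathrm x$ of a two-dimensional manifold into $\mathbb R^4_1$, is space-like if the induced metric on each tangent space $T_p(\mathcal M)$ is positive definite; the normal space $N_p(\mathcal M)$ is the orthogonal complement of $T_p(\mathcal M)$, of signature $(1,1)$. The second fundamental form is $\sigma(X,Y)=(\nabla_XY)^\bot$, where $\nabla$ is the flat connection of $\mathbb R^4_1$ and $\bot$ is the orthogonal projection to the normal space. The surface is minimal if $H=\frac12\operatorname{trace}\sigma=0$ at every point. A point $p\in\mathcal M$ is degenerate if the set $\{\sigma(X,Y): X,Y\in T_p(\mathcal M)\}$ is contained in one of the two light-like one-dimensional subspaces of $N_p(\mathcal M)$. Local coordinates $(u,v)$ are isothermal if $E=G$ and $F=0$, where $E=\mathrm x_u^2$, $F=\mathrm x_u\cdot \mathrm x_v$, $G=\mathrm x_v^2$. For isothermal coordinates put $X_1=\mathrm x_u/\sqrt E$, $X_2=\mathrm x_v/\sqrt E$. Isothermal coordinates $(u,v)$ on a minimal space-like surface are called canonical of the first type if $\sigma(X_1,X_1)\perp\sigma(X_1,X_2)$ and $E^2\big(\sigma(X_1,X_1)^2-\sigma(X_1,X_2)^2\big)=1$,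 and canonical of the second type if $\sigma(X_1,X_1)\perp\sigma(X_1,X_2)$ and $E^2\big(\sigma(X_1,X_1)^2-\sigma(X_1,X_2)^2\big)=-1$. (Equivalently, with $t=u+\mathrm i v$ and $\Phi(t)=\mathrm x_u-\mathrm i\,\mathrm x_v$, and the product extended bilinearly to $\mathbb C^4$: $\Phi'\cdot\Phi'=1$, respectively $\Phi'\cdot\Phi'=-1$.) *)

(* Defs.v *)
From HB Require Import structures.
From mathcomp Require Import all_boot all_order all_algebra.
From mathcomp Require Import all_classical all_reals all_analysis.
From mathcomp Require Import ring.
Set Implicit Arguments.
Unset Strict Implicit.
Unset Printing Implicit Defensive.
Import Order.TTheory GRing.Theory Num.Theory.
Import numFieldNormedType.Exports.
Local Open Scope classical_set_scope.
Local Open Scope ring_scope.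

Section Smooth.
Variables (R : realType) (V : normedModType R).
Implicit Types (U : set (R * R)) (f : R * R -> V).

Definition e1 : R * R := (1, 0).
Definition e2 : R * R := (0, 1).

Fixpoint Ck (k : nat) U f : Prop :=
  (forall q, U q -> {for q, continuous f}) /\
  if k is k'.+1 then
    [/\ forall q, U q -> derivable f q e1 /\ derivable f q e2,
        Ck k' U ('D_e1 f) & Ck k' U ('D_e2 f)]
  else True.

(* C^infinity; only meaningful for an open set U. *)
Definition smooth_on U f := forall k, Ck k U f.

End Smooth.

Arguments e1 {R}.
Arguments e2 {R}.

Section Manifold.
Variables (R : realType) (M : topologicalType).

(* A homeomorphism from an open set of M onto an open set of R^2. Both maps
   are total functions; only their values on dom and cod matter. *)
Record chart := Chart {
  dom : set M;
  cod : set (R * R);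
  to : M -> R * R;
  from : R * R -> M;
  dom_open : open dom;
  cod_open : open cod;
  to_cod : forall p, dom p -> cod (to p);
  from_dom : forall q, cod q -> dom (from q);
  toK : forall p, dom p -> from (to p) = p;
  fromK : forall q, cod q -> to (from q) = q;
  to_continuous : forall p, dom p -> {for p, continuous to};
  from_continuous : forall q, cod q -> {for q, continuous from}
}.

Definition compatible (c c' : chart) : Prop :=
  smooth_on (to c @` (dom c `&` dom c')) (to c' \o from c) /\
  smooth_on (to c' @` (dom c `&` dom c')) (to c \o from c').

Definition smooth_atlas (A : set chart) : Prop :=
  (forall p, exists2 c, A c & dom c p) /\
  (forall c c', A c -> A c' -> compatible c c').

Definition smooth_manifold2 (A : set chart) : Prop :=
  [/\ hausdorff_space M, @second_countable M & smooth_atlas A].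

(* The charts of the maximal atlas containing A. *)
Definition local_coordinates (A : set chart) (c : chart) : Prop :=
  forall c', A c' -> compatible c c'.

End Manifold.

Definition mink {R : realType} (a b : 'rV[R]_4) : R :=
  a 0 0 * b 0 0 + a 0 1 * b 0 1 + a 0 2 * b 0 2 - a 0 3 * b 0 3.

Section Mink.
Variable R : realType.
Implicit Types a b c : 'rV[R]_4.

Lemma minkC a b : mink a b = mink b a.
Proof. by rewrite /mink; congr (_ + _ + _ - _); rewrite mulrC. Qed.

Lemma minkDl a b c : mink (a + b) c = mink a c + mink b c.
Proof. by rewrite /mink !mxE; ring. Qed.

Lemma minkZl (k : R) a b : mink (k *: a) b = k * mink a b.
Proof. by rewrite /mink !mxE -!mulrA mulrBr !mulrDr. Qed.

Lemma minkNl a b : mink (- a) b = - mink a b.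
Proof. by rewrite -scaleN1r minkZl mulN1r. Qed.

Lemma minkDr a b c : mink a (b + c) = mink a b + mink a c.
Proof. by rewrite minkC minkDl !(minkC a). Qed.

Lemma minkZr (k : R) a b : mink a (k *: b) = k * mink a b.
Proof. by rewrite minkC minkZl minkC. Qed.

Lemma mink_projK a b c (k l : R) :
  let E := mink a a in let F := mink a b in let G := mink b b in
  let D := E * G - F ^+ 2 in D != 0 ->
  mink (c - (((G * mink c a - F * mink c b) / D) *: a +
             ((E * mink c b - F * mink c a) / D) *: b)) (k *: a + l *: b) = 0.
Proof.
move=> E F G D; rewrite minkDl minkNl minkDl !minkZl !minkDr !minkZr (minkC b a).
rewrite -/E -/F -/G /D {D}.
by move: E F G (mink c a) (mink c b) => E F G s t h; field.
Qed.

End Mink.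

(* Geometry of a surface patch f defined near q, f being the expression of the
   immersion in local coordinates (u, v). *)
Section Patch.
Variables (R : realType) (f : R * R -> 'rV[R]_4).
Implicit Types (q xi : R * R) (w n : 'rV[R]_4) (X Y : R * R -> R * R).

Definition xu q := 'D_e1 f q.
Definition xv q := 'D_e2 f q.

Definition tangent q : set 'rV[R]_4 :=
  [set w | exists a b : R, w = a *: xu q + b *: xv q].

Definition normal q : set 'rV[R]_4 :=
  [set n | forall w, tangent q w -> mink n w = 0].

Definition EE q := mink (xu q) (xu q).
Definition FF q := mink (xu q) (xv q).
Definition GG q := mink (xv q) (xv q).
Definition gram q := EE q * GG q - FF q ^+ 2.

(* Orthogonal projections, by Cramer's rule for the first fundamental form;
   see tproj_tangent and nproj_normal below. *)
Definition tproj q w : 'rV[R]_4 :=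
  ((GG q * mink w (xu q) - FF q * mink w (xv q)) / gram q) *: xu q +
  ((EE q * mink w (xv q) - FF q * mink w (xu q)) / gram q) *: xv q.

Definition nproj q w : 'rV[R]_4 := w - tproj q w.

(* A tangent vector field is given by its components X : R^2 -> R^2 in the
   coordinates, the field in R^4_1 being q |-> X_1 xu + X_2 xv. *)
Definition field X q : 'rV[R]_4 := (X q).1 *: xu q + (X q).2 *: xv q.

Definition nabla X Y q : 'rV[R]_4 := 'D_(X q) (field Y) q.

Definition sff X Y q : 'rV[R]_4 := nproj q (nabla X Y q).

(* H = (1/2) g^ij sigma(d_i, d_j) *)
Definition mean_curvature q : 'rV[R]_4 :=
  2^-1 *: ((gram q)^-1 *:
    (GG q *: sff (cst e1) (cst e1) q - (2 * FF q) *: sff (cst e1) (cst e2) q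
     + EE q *: sff (cst e2) (cst e2) q)).

Definition light_like w : Prop := w != 0 /\ mink w w = 0.

(* U is the domain of the patch. The values of sigma on T_p x T_p are obtained
   by extending tangent vectors to smooth tangent fields. *)
Definition degenerate_at (U : set (R * R)) q : Prop :=
  exists n, [/\ normal q n, light_like n &
    forall X Y, smooth_on U X -> smooth_on U Y ->
      exists a : R, sff X Y q = a *: n].

Definition isothermal (U : set (R * R)) : Prop :=
  forall q, U q -> EE q = GG q /\ FF q = 0.

Definition X1 q : R * R := ((Num.sqrt (EE q))^-1, 0).
Definition X2 q : R * R := (0, (Num.sqrt (EE q))^-1).

Definition canonical_eps (eps : R) (U : set (R * R)) : Prop :=
  isothermal U /\
  forall q, U q ->
    mink (sff X1 X1 q) (sff X1 X2 q) = 0 /\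
    EE q ^+ 2 * (mink (sff X1 X1 q) (sff X1 X1 q)
                 - mink (sff X1 X2 q) (sff X1 X2 q)) = eps.

Definition canonical_first := canonical_eps 1.
Definition canonical_second := canonical_eps (-1).

Lemma tproj_tangent q w : tangent q (tproj q w).
Proof. by do 2 eexists. Qed.

Lemma nproj_normal q w : gram q != 0 -> normal q (nproj q w).
Proof.
by move=> h _ [a [b ->]]; apply: (@mink_projK R (xu q) (xv q) w a b h).
Qed.

End Patch.

(* The geometric notions below do not depend on the chart around p. *)
Section Surface.
Variables (R : realType) (M : topologicalType).
Variables (A : set (chart R M)) (x : M -> 'rV[R]_4).

Definition immersion : Prop :=
  forall c, A c ->
    smooth_on (cod c) (x \o from c) /\
    forall q, cod c q -> forall a b : R,
      a *: xu (x \o from c) q + b *: xv (x \o from c) q = 0 -> a = 0 /\ b = 0.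

Definition space_like : Prop :=
  forall c p, A c -> dom c p ->
    forall w, tangent (x \o from c) (to c p) w -> w != 0 -> 0 < mink w w.

Definition minimal : Prop :=
  forall c p, A c -> dom c p -> mean_curvature (x \o from c) (to c p) = 0.

Definition degenerate_point (p : M) : Prop :=
  exists c, [/\ A c, dom c p & degenerate_at (x \o from c) (cod c) (to c p)].

End Surface.

(* Main.v *)
Require Import Defs.
From HB Require Import structures.
From mathcomp Require Import all_boot all_order all_algebra.
From mathcomp Require Import all_classical all_reals all_analysis.
From mathcomp Require Import ring lra.
Import Order.TTheory GRing.Theory Num.Theory.
Import numFieldNormedType.Exports.
Set Implicit Arguments.
Unset Strict Implicit.
Unset Printing Implicit Defensive.
Local Open Scope classical_set_scope.
Local Open Scope ring_scope.

(** The proof has two changes of coordinates, each given by integrating a pair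
    of closed 1-forms.

    Isothermal coordinates.  Let f be the surface in some chart.  Minimality
    says that each coordinate function h of f is harmonic for the induced
    metric, that is, that the form *dh is closed ([star_closed]).  Choose h
    with dh <> 0 at the given point.  On a small square *dh = dk, and (h, k)
    are isothermal coordinates, because * is rotation by a right angle.  In
    them f becomes a map g with g_uu + g_vv = 0 ([exists_isothermal_chart]).

    Canonical coordinates.  Put Phi = g_u - i g_v.  It is holomorphic in
    t = u + i v, hence so is Phi'.Phi', whose real and imaginary parts are
    [hopfR] and [hopfI].  As Phi'.Phi' = s.s for the normal part
    s = sigma(g_u, g_u) - i sigma(g_u, g_v) of Phi', and the normal plane has
    signature (1, 1), its vanishing at a point would put both normal vectors
    on one light-like line, and the point would be degenerate
    ([null_normal]).  So eps Phi'.Phi' has a holomorphic fourth root w near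
    the point, for eps = 1 and for eps = -1.  A change of coordinates to T
    multiplies Phi'.Phi' by (dt/dT)^4, so the coordinate T with dT = w dt
    makes it equal to eps ([canonical_alg]); the two equations in the
    definition of canonical coordinates are the real and the imaginary part
    of this ([canonical_of_hopf]).

    The analysis behind this is two-dimensional and elementary: the mean value
    theorem along the sides of a square gives the differentiability of C^1
    functions, the symmetry of mixed partial derivatives and the inverse
    function theorem; primitives of continuous functions of one variable give
    the Poincare lemma.  The inverse function theorem is used for the new
    charts and, applied to z |-> z^4, for the fourth root. *)

(** * Mean value theorems on segments and squares *)

Section Line.
Variable R : realType.
Implicit Types (f : R * R -> R) (q : R * R).

(** Stated for a and b in either order, as increments below come with both
    signs. *)
Lemma MVT_between (f df : R -> R) (a b : R) :
  (forall x, Num.min a b <= x <= Num.max a b -> is_derive x 1 f (df x)) ->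
  exists2 c, Num.min a b <= c <= Num.max a b & f b - f a = df c * (b - a).
Proof.
wlog ab : a b / a <= b => [W|] df_.
  have /orP[ab|ba] := le_total a b; first exact: W ab df_.
  have [|c c_ E] := W b a ba; first by rewrite minC maxC.
  by exists c; [rewrite minC maxC | rewrite -opprB E -mulrN opprB].
move: df_; rewrite (min_idPl ab) (max_idPr ab) => df_.
have [x xab|  |c cab E] := @MVT_segment R f df a b ab.
- by apply: df_; move: xab; rewrite in_itv /= => /andP[/ltW -> /ltW ->].
- apply: derivable_within_continuous => x; rewrite in_itv /= => /df_ dfx.
  exact: ex_derive.
- by exists c => //; move: cab; rewrite in_itv.
Qed.

Lemma between_dist (c a b x r : R) : `|c - a| < r -> `|c - b| < r ->
  Num.min a b <= x <= Num.max a b -> `|c - x| < r.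
Proof.
rewrite !ltr_norml => /andP[a1 a2] /andP[b1 b2].
by have [ab|ba] := leP a b => /andP[x1 x2]; apply/andP; split; lra.
Qed.

Lemma between_le (a b x : R) : Num.min a b <= x <= Num.max a b ->
  `|x - a| <= `|b - a|.
Proof.
have [ab|/ltW ba] := leP a b => /andP[x1 x2].
  by rewrite !ger0_norm ?subr_ge0 // lerD2r.
by rewrite !ler0_norm ?subr_le0 // lerN2 lerD2r.
Qed.

Lemma between_trans (a b x y : R) : Num.min a b <= x <= Num.max a b ->
  Num.min a x <= y <= Num.max a x -> Num.min a b <= y <= Num.max a b.
Proof.
by have [ab|ba] := leP a b => /andP[x1 x2]; have [ax|xa] := leP a x;
  move=> /andP[y1 y2]; apply/andP; split; lra.
Qed.

Lemma is_derive_e1 (V : normedModType R) (f : R * R -> V) q d :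
  is_derive q e1 f d <-> is_derive q.1 1 (fun s => f (s, q.2)) d.
Proof.
have E : (fun h : R => h^-1 *: ((f \o shift q) (h *: (e1 : R * R)) - f q)) =
  (fun h : R => h^-1 *: (((fun s => f (s, q.2)) \o shift q.1) (h *: (1 : R)) - f (q.1, q.2))).
  apply/funext => h /=; congr (_ *: (f _ - f _)); last by case: q.
  by case: q => u v; rewrite /e1 /shift /=; congr pair; rewrite /= scaler0 add0r.
by split=> -[d1 d2]; split; move: d1 d2; rewrite /derivable /derive /= E.
Qed.

Lemma is_derive_e2 (V : normedModType R) (f : R * R -> V) q d :
  is_derive q e2 f d <-> is_derive q.2 1 (fun s => f (q.1, s)) d.
Proof.
have E : (fun h : R => h^-1 *: ((f \o shift q) (h *: (e2 : R * R)) - f q)) =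
  (fun h : R => h^-1 *: (((fun s => f (q.1, s)) \o shift q.2) (h *: (1 : R)) - f (q.1, q.2))).
  apply/funext => h /=; congr (_ *: (f _ - f _)); last by case: q.
  by case: q => u v; rewrite /e2 /shift /=; congr pair; rewrite /= scaler0 add0r.
by split=> -[d1 d2]; split; move: d1 d2; rewrite /derivable /derive /= E.
Qed.

(** The path from p to q that is first horizontal, then vertical, stays inside
    the ball, which is a square for the norm of the product. *)
Lemma MVT_box f q0 (r : R) p q :
  (forall z, ball q0 r z -> derivable f z e1 /\ derivable f z e2) ->
  ball q0 r p -> ball q0 r q ->
  exists xi eta, [/\ ball q0 r xi, ball q0 r eta &
    f q - f p = 'D_e1 f xi * (q.1 - p.1) + 'D_e2 f eta * (q.2 - p.2)].
Proof.
move=> df [/= p1 p2] [/= q1 q2].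
have [s s_ Es] : exists2 s, Num.min p.1 q.1 <= s <= Num.max p.1 q.1 &
   f (q.1, p.2) - f (p.1, p.2) = 'D_e1 f (s, p.2) * (q.1 - p.1).
  apply: (@MVT_between (fun s => f (s, p.2))) => s s_.
  apply/(@is_derive_e1 _ f (s, p.2)); apply: derivableP.
  by apply: (df _ _).1; split => //=; exact: between_dist s_.
have [t t_ Et] : exists2 t, Num.min p.2 q.2 <= t <= Num.max p.2 q.2 &
   f (q.1, q.2) - f (q.1, p.2) = 'D_e2 f (q.1, t) * (q.2 - p.2).
  apply: (@MVT_between (fun t => f (q.1, t))) => t t_.
  apply/(@is_derive_e2 _ f (q.1, t)); apply: derivableP.
  by apply: (df _ _).2; split => //=; exact: between_dist t_.
exists (s, p.2), (q.1, t); split.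
- by split => //=; exact: between_dist s_.
- by split => //=; exact: between_dist t_.
- by rewrite -Es -Et; case: p q {p1 p2 q1 q2 s_ Es t_ Et} => [? ?] [? ?] /=; ring.
Qed.

Lemma fst_e1 : (e1 : R * R).1 = 1. Proof. by []. Qed.
Lemma snd_e1 : (e1 : R * R).2 = 0. Proof. by []. Qed.
Lemma fst_e2 : (e2 : R * R).1 = 0. Proof. by []. Qed.
Lemma snd_e2 : (e2 : R * R).2 = 1. Proof. by []. Qed.

Lemma basis_decomposition (v : R * R) : v = v.1 *: e1 + v.2 *: e2.
Proof.
rewrite [LHS]surjective_pairing /e1 /e2; congr pair;
by rewrite /= /GRing.scale /= ?mulr1 ?mulr0 ?addr0 ?add0r.
Qed.

End Line.

#[local] Opaque e1 e2.

(** * Differentiability of functions with continuous partial derivatives *)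

Section ContinuouslyDifferentiable.
Variable R : realType.
Implicit Types (U : set (R * R)) (q : R * R).

Lemma near_close (f : R * R -> R) q e : {for q, continuous f} -> 0 < e ->
  \forall z \near q, `|f q - f z| < e.
Proof. by move=> /cvgrPdist_lt H /H. Qed.

(** By [MVT_box] the error of the linear approximation is the increment times
    the oscillation of the two partial derivatives. *)
Lemma differentiable_of_partials (f : R * R -> R) U q : open U -> U q ->
  (forall z, U z -> derivable f z e1 /\ derivable f z e2) ->
  {for q, continuous ('D_e1 f)} -> {for q, continuous ('D_e2 f)} ->
  differentiable f q.
Proof.
move=> oU Uq df c1 c2.
pose L (h : R * R) : R := h.1 * 'D_e1 f q + h.2 * 'D_e2 f q.
have Llin : linear L.
  by move=> a [u1 u2] [v1 v2]; rewrite /L /= /GRing.scale /=; ring.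
pose Lm := GRing.isLinear.Build _ _ _ _ _ Llin.
pose LL : {linear (R * R)%type -> R} := HB.pack L Lm.
have Lc : continuous LL.
  move=> h; rewrite /= /L.
  by apply: cvgD; apply: cvgM; [exact: cvg_fst | exact: cvg_cst
    | exact: cvg_snd | exact: cvg_cst].
have Lo : f \o shift q = cst (f q) + LL +o_ (0 : R * R) id.
  apply/eqaddoP => _ /posnumP[e].
  have [r r0 [rU r1 r2]] : exists2 r : R, 0 < r & [/\ ball q r `<=` U,
     forall z, ball q r z -> `|'D_e1 f q - 'D_e1 f z| < e%:num / 2 &
     forall z, ball q r z -> `|'D_e2 f q - 'D_e2 f z| < e%:num / 2].
    have e_gt0 : 0 < e%:num / 2 by [].
    have nU : nbhs q U by exact: open_nbhs_nbhs.
    have n1 := near_close c1 e_gt0; have n2 := near_close c2 e_gt0.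
    have nI (X Y : set (R * R)) : nbhs q X -> nbhs q Y -> nbhs q (X `&` Y).
      by exact: filterI.
    have /nbhs_ballP[r /= r0 rP] : nbhs q _ := nI _ _ nU (nI _ _ n1 n2).
    by exists r => //; split => z /rP[Uz [h1 h2]].
  near=> h.
  have hr : ball q r (h + q).
    near: h; apply/nbhs_ballP; exists r => //= h [].
    rewrite /ball /= !sub0r !normrN => h1 h2.
    by split; rewrite /ball /= opprD addrCA subrr addr0 normrN.
  have [xi [eta [bxi beta E]]] := MVT_box (fun z bz => df z (rU _ bz)) (ballxx q r0) hr.
  rewrite /= !fctE /= opprD addrA E /L /= !addrK.
  set a := 'D_e1 f q; set b := 'D_e2 f q.
  rewrite (_ : _ - _ = h.1 * ('D_e1 f xi - a) + h.2 * ('D_e2 f eta - b)); last by ring.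
  have h1 : `|h.1| <= `|h| by rewrite prod_normE le_max lexx.
  have h2 : `|h.2| <= `|h| by rewrite prod_normE le_max lexx orbT.
  apply: (le_trans (ler_normD _ _)); rewrite !normrM.
  rewrite [e%:num]splitr mulrDl; apply: lerD; rewrite mulrC; apply: ler_pM => //.
    by rewrite distrC ltW// r1.
  by rewrite distrC ltW// r2.
apply/diff_locallyP; rewrite (diff_unique Lc Lo); split => //.
Unshelve. all: by end_near. Qed.

End ContinuouslyDifferentiable.

(** * Calculus of C^k functions of two variables *)

Section SmoothGeneral.
Variables (R : realType) (V : normedModType R).
Implicit Types (U : set (R * R)) (f g : R * R -> V).

Lemma Ck0P U f : Ck 0 U f <-> forall q, U q -> {for q, continuous f}.
Proof. by split=> [[]|]. Qed.

Lemma CkSP k U f : Ck k.+1 U f <->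
  [/\ forall q, U q -> {for q, continuous f},
      forall q, U q -> derivable f q e1 /\ derivable f q e2,
      Ck k U ('D_e1 f) & Ck k U ('D_e2 f)].
Proof. by split=> [[a [b c d]]|[a b c d]]; split; [..|split]. Qed.

#[local] Opaque Ck.

Lemma Ck_sub k U U' f : U' `<=` U -> Ck k U f -> Ck k U' f.
Proof.
move=> UU; elim: k f => [|k IH] f.
  by move=> /Ck0P fc; apply/Ck0P => q /UU /fc.
move=> /CkSP[fc fd f1 f2]; apply/CkSP; split.
- by move=> q /UU /fc.
- by move=> q /UU /fd.
- exact: IH.
- exact: IH.
Qed.

Lemma Ck_pred k U f : Ck k.+1 U f -> Ck k U f.
Proof.
elim: k f => [|k IH] f; first by move=> /CkSP[fc _ _ _]; apply/Ck0P.
move=> /CkSP[fc fd f1 f2]; apply/CkSP; split.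
- exact: fc.
- exact: fd.
- exact: IH.
- exact: IH.
Qed.

Lemma near_open U f g q : open U -> {in U, f =1 g} -> U q -> \near q, f q = g q.
Proof.
move=> oU fg Uq; have : nbhs q U by exact: open_nbhs_nbhs.
by apply: filterS => z Uz; apply: fg; rewrite inE.
Qed.

Lemma continuous_eq_open U f g q : open U -> {in U, f =1 g} -> U q ->
  {for q, continuous f} -> {for q, continuous g}.
Proof.
move=> oU fg Uq fc; have h : f @ q --> f q := fc.
rewrite (fg q (mem_set Uq)) in h.
by apply: cvg_trans h; apply: near_eq_cvg; apply: near_open Uq.
Qed.

Lemma Ck_eq k U f g : open U -> {in U, f =1 g} -> Ck k U f -> Ck k U g.
Proof.
move=> oU; elim: k f g => [|k IH] f g fg; have nfg := near_open oU fg.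
  move=> /Ck0P fc; apply/Ck0P => q Uq.
  exact: continuous_eq_open oU fg Uq (fc q Uq).
move=> /CkSP[fc fd f1 f2]; apply/CkSP; split.
- by move=> q Uq; exact: continuous_eq_open oU fg Uq (fc q Uq).
- move=> q Uq; have [d1 d2] := fd q Uq.
  by split; [apply: near_eq_derivable d1 | apply: near_eq_derivable d2]; exact: nfg.
- by apply: IH f1 => q; rewrite inE => Uq; apply: near_eq_derive; exact: nfg.
- by apply: IH f2 => q; rewrite inE => Uq; apply: near_eq_derive; exact: nfg.
Qed.

Lemma smooth_sub U U' f : U' `<=` U -> smooth_on U f -> smooth_on U' f.
Proof. by move=> UU sf k; exact: Ck_sub (sf k). Qed.

Lemma smooth_eq U f g : open U -> {in U, f =1 g} -> smooth_on U f -> smooth_on U g.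
Proof. by move=> oU fg sf k; exact: Ck_eq fg (sf k). Qed.

Lemma smooth_continuous U f q : smooth_on U f -> U q -> {for q, continuous f}.
Proof. by move=> sf; have /Ck0P := sf 0%N; exact. Qed.

Lemma smooth_derivable U f q : smooth_on U f -> U q ->
  derivable f q e1 /\ derivable f q e2.
Proof. by move=> sf; have /CkSP[_ fd _ _] := sf 1%N; exact: fd. Qed.

Lemma smooth_D1 U f : smooth_on U f -> smooth_on U ('D_e1 f).
Proof. by move=> sf k; have /CkSP[] := sf k.+1. Qed.

Lemma smooth_D2 U f : smooth_on U f -> smooth_on U ('D_e2 f).
Proof. by move=> sf k; have /CkSP[] := sf k.+1. Qed.

Lemma CkD k U f g : open U -> Ck k U f -> Ck k U g ->
  Ck k U (fun q => f q + g q).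
Proof.
move=> oU; elim: k f g => [|k IH] f g.
  move=> /Ck0P fc /Ck0P gc; apply/Ck0P => q Uq.
  by apply: cvgD; [exact: fc|exact: gc].
move=> /CkSP[fc fd f1 f2] /CkSP[gc gd g1 g2]; apply/CkSP; split.
- by move=> q Uq; apply: cvgD; [exact: fc|exact: gc].
- move=> q Uq; have [a1 a2] := fd q Uq; have [b1 b2] := gd q Uq.
  by split; [exact: (derivableD a1 b1)|exact: (derivableD a2 b2)].
- apply: (Ck_eq oU _ (IH _ _ f1 g1)) => q; rewrite inE => Uq.
  have [a1 a2] := fd q Uq; have [b1 b2] := gd q Uq.
  by rewrite (deriveD a1 b1).
- apply: (Ck_eq oU _ (IH _ _ f2 g2)) => q; rewrite inE => Uq.
  have [a1 a2] := fd q Uq; have [b1 b2] := gd q Uq.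
  by rewrite (deriveD a2 b2).
Qed.

Lemma Ck_cst k U (c : V) : Ck k U (fun _ => c).
Proof.
elim: k c => [|k IH] c; first by apply/Ck0P => q _; exact: cvg_cst.
have D0 v : 'D_v (fun _ : R * R => c) = (fun _ => 0).
  by apply/funext => q; exact: derive_cst.
apply/CkSP; rewrite !D0; split.
- by move=> q _; exact: cvg_cst.
- by move=> q _; split; exact: derivable_cst.
- exact: IH.
- exact: IH.
Qed.

Lemma smoothD U f g : open U -> smooth_on U f -> smooth_on U g ->
  smooth_on U (fun q => f q + g q).
Proof. by move=> oU sf sg k; exact: CkD. Qed.

End SmoothGeneral.

#[local] Opaque Ck.

Section SmoothScalar.
Variable R : realType.
Implicit Types (U : set (R * R)) (f g : R * R -> R).

Lemma CkM k U f g : open U -> Ck k U f -> Ck k U g ->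
  Ck k U (fun q => f q * g q).
Proof.
move=> oU; elim: k f g => [|k IH] f g Hf Hg.
  move: Hf Hg => /Ck0P fc /Ck0P gc; apply/Ck0P => q Uq.
  by apply: cvgM; [exact: fc|exact: gc].
have f0 := Ck_pred Hf; have g0 := Ck_pred Hg.
move: Hf Hg => /CkSP[fc fd f1 f2] /CkSP[gc gd g1 g2]; apply/CkSP; split.
- by move=> q Uq; apply: cvgM; [exact: fc|exact: gc].
- move=> q Uq; have [a1 a2] := fd q Uq; have [b1 b2] := gd q Uq.
  by split; [exact: (derivableM a1 b1)|exact: (derivableM a2 b2)].
- apply: (Ck_eq oU _ (CkD oU (IH _ _ f0 g1) (IH _ _ g0 f1))) => q; rewrite inE => Uq.
  have [a1 a2] := fd q Uq; have [b1 b2] := gd q Uq.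
  by rewrite (deriveM a1 b1).
- apply: (Ck_eq oU _ (CkD oU (IH _ _ f0 g2) (IH _ _ g0 f2))) => q; rewrite inE => Uq.
  have [a1 a2] := fd q Uq; have [b1 b2] := gd q Uq.
  by rewrite (deriveM a2 b2).
Qed.

(** The derivative - f^-2 f' is again a product of f^-1 with C^k functions, so
    induction on k closes. *)
Lemma CkV k U f : open U -> (forall q, U q -> f q != 0) -> Ck k U f ->
  Ck k U (fun q => (f q)^-1).
Proof.
move=> oU f0; elim: k => [|k IH] Hf.
  by move: Hf => /Ck0P fc; apply/Ck0P => q Uq; apply: cvgV; [exact: f0|exact: fc].
have Vk := IH (Ck_pred Hf); have VV := CkM oU Vk Vk.
move: Hf => /CkSP[fc fd f1 f2]; apply/CkSP; split.
- by move=> q Uq; apply: cvgV; [exact: f0|exact: fc].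
- move=> q Uq; have [a1 a2] := fd q Uq; have fq := f0 q Uq.
  by split; [exact: (derivableV fq a1)|exact: (derivableV fq a2)].
- apply: (Ck_eq oU _ (CkM oU (CkM oU (Ck_cst k U (-1 : R)) VV) f1)) => q; rewrite inE => Uq.
  have [a1 a2] := fd q Uq; rewrite (deriveV (f0 q Uq) a1).
  by rewrite /= /GRing.scale /= expr2 invfM mulN1r.
- apply: (Ck_eq oU _ (CkM oU (CkM oU (Ck_cst k U (-1 : R)) VV) f2)) => q; rewrite inE => Uq.
  have [a1 a2] := fd q Uq; rewrite (deriveV (f0 q Uq) a2).
  by rewrite /= /GRing.scale /= expr2 invfM mulN1r.
Qed.

Lemma is_derive_sqrt_e1 f q d : 0 < f q -> is_derive q e1 f d ->
  is_derive q e1 (fun z => Num.sqrt (f z)) ((2 * Num.sqrt (f q))^-1 * d).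
Proof.
move=> f0 /is_derive_e1 df; apply/is_derive_e1 => /=.
have f0' : 0 < f (q.1, q.2) by case: q f0 {df}.
have := is_derive1_comp (is_derive1_sqrt f0') df.
by case: q f0 {df f0'}.
Qed.

Lemma is_derive_sqrt_e2 f q d : 0 < f q -> is_derive q e2 f d ->
  is_derive q e2 (fun z => Num.sqrt (f z)) ((2 * Num.sqrt (f q))^-1 * d).
Proof.
move=> f0 /is_derive_e2 df; apply/is_derive_e2 => /=.
have f0' : 0 < f (q.1, q.2) by case: q f0 {df}.
have := is_derive1_comp (is_derive1_sqrt f0') df.
by case: q f0 {df f0'}.
Qed.

(** As for inverses: the derivative f' / (2 sqrt f) involves the function
    itself and lower order terms only. *)
Lemma Ck_sqrt k U f : open U -> (forall q, U q -> 0 < f q) -> Ck k U f ->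
  Ck k U (fun q => Num.sqrt (f q)).
Proof.
move=> oU f0; elim: k => [|k IH] Hf.
  move: Hf => /Ck0P fc; apply/Ck0P => q Uq.
  by apply: continuous_comp; [exact: fc|exact: sqrt_continuous].
have Vk := IH (Ck_pred Hf).
have VV : Ck k U (fun q => (2 * Num.sqrt (f q))^-1).
  apply: CkV => //; last by apply: CkM => //; exact: Ck_cst.
  by move=> q Uq; rewrite mulf_neq0 ?pnatr_eq0// gt_eqF// sqrtr_gt0 f0.
move: Hf => /CkSP[fc fd f1 f2].
have s1 q : U q -> is_derive q e1 (fun z => Num.sqrt (f z)) ((2 * Num.sqrt (f q))^-1 * 'D_e1 f q).
  by move=> Uq; apply: is_derive_sqrt_e1; [exact: f0|apply: derivableP; case: (fd q Uq)].
have s2 q : U q -> is_derive q e2 (fun z => Num.sqrt (f z)) ((2 * Num.sqrt (f q))^-1 * 'D_e2 f q).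
  by move=> Uq; apply: is_derive_sqrt_e2; [exact: f0|apply: derivableP; case: (fd q Uq)].
apply/CkSP; split.
- by move=> q Uq; apply: continuous_comp; [exact: fc|exact: sqrt_continuous].
- by move=> q Uq; split; [have := s1 q Uq|have := s2 q Uq] => ?; exact: ex_derive.
- apply: (Ck_eq oU _ (CkM oU VV f1)) => q; rewrite inE => Uq.
  by have := s1 q Uq => ?; rewrite derive_val.
- apply: (Ck_eq oU _ (CkM oU VV f2)) => q; rewrite inE => Uq.
  by have := s2 q Uq => ?; rewrite derive_val.
Qed.

Lemma smoothM U f g : open U -> smooth_on U f -> smooth_on U g ->
  smooth_on U (fun q => f q * g q).
Proof. by move=> oU sf sg k; exact: CkM. Qed.

Lemma smooth_cst U (c : R) : smooth_on U (fun _ => c).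
Proof. by move=> k; exact: Ck_cst. Qed.

Lemma smoothN U f : open U -> smooth_on U f -> smooth_on U (fun q => - f q).
Proof.
move=> oU sf; apply: (smooth_eq oU _ (smoothM oU (smooth_cst U (-1)) sf)) => q _.
by rewrite mulN1r.
Qed.

Lemma smoothB U f g : open U -> smooth_on U f -> smooth_on U g ->
  smooth_on U (fun q => f q - g q).
Proof. by move=> oU sf sg; apply: smoothD => //; exact: smoothN. Qed.

Lemma smoothV U f : open U -> (forall q, U q -> f q != 0) -> smooth_on U f ->
  smooth_on U (fun q => (f q)^-1).
Proof. by move=> oU f0 sf k; exact: CkV. Qed.

Lemma smooth_sqrt U f : open U -> (forall q, U q -> 0 < f q) -> smooth_on U f ->
  smooth_on U (fun q => Num.sqrt (f q)).
Proof. by move=> oU f0 sf k; exact: Ck_sqrt. Qed.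

Lemma is_derive_fst_e1 (q : R * R) : is_derive q e1 fst (1 : R).
Proof. by apply/is_derive_e1; exact: is_derive_id. Qed.
Lemma is_derive_fst_e2 (q : R * R) : is_derive q e2 fst (0 : R).
Proof. by apply/is_derive_e2; exact: is_derive_cst. Qed.
Lemma is_derive_snd_e1 (q : R * R) : is_derive q e1 snd (0 : R).
Proof. by apply/is_derive_e1; exact: is_derive_cst. Qed.
Lemma is_derive_snd_e2 (q : R * R) : is_derive q e2 snd (1 : R).
Proof. by apply/is_derive_e2; exact: is_derive_id. Qed.

Lemma smooth_fst U : smooth_on U (fst : R * R -> R).
Proof.
case=> [|k]; first by apply/Ck0P => q _; exact: cvg_fst.
have E1 : 'D_e1 (fst : R * R -> R) = (fun=> 1).
  by apply/funext => q; apply: derive_val; exact: is_derive_fst_e1.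
have E2 : 'D_e2 (fst : R * R -> R) = (fun=> 0).
  by apply/funext => q; apply: derive_val; exact: is_derive_fst_e2.
apply/CkSP; rewrite E1 E2; split; [| |exact: Ck_cst|exact: Ck_cst] => q _.
  exact: cvg_fst.
by split; [have := is_derive_fst_e1 q|have := is_derive_fst_e2 q] => -[].
Qed.

Lemma smooth_snd U : smooth_on U (snd : R * R -> R).
Proof.
case=> [|k]; first by apply/Ck0P => q _; exact: cvg_snd.
have E1 : 'D_e1 (snd : R * R -> R) = (fun=> 0).
  by apply/funext => q; apply: derive_val; exact: is_derive_snd_e1.
have E2 : 'D_e2 (snd : R * R -> R) = (fun=> 1).
  by apply/funext => q; apply: derive_val; exact: is_derive_snd_e2.
apply/CkSP; rewrite E1 E2; split; [| |exact: Ck_cst|exact: Ck_cst] => q _.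
  exact: cvg_snd.
by split; [have := is_derive_snd_e1 q|have := is_derive_snd_e2 q] => -[].
Qed.

End SmoothScalar.

(** * Components and the chain rule *)

Section IsDerive.
Variables (R : realType) (U V : normedModType R).

Lemma is_deriveP (f : U -> V) q v d :
  is_derive q v f d <->
  h^-1 *: (f (h *: v + q) - f q) @[h --> (0 : R)^'] --> d.
Proof.
split=> [[d1 d2]|h]; first by rewrite -d2; exact: d1.
split; first by apply/cvg_ex; exists d.
exact: (cvg_lim _ h).
Qed.

End IsDerive.

#[local] Opaque derive derivable.

Section IsDeriveLine.
Variables (R : realType) (U V : normedModType R).

(** Reduces directional derivatives to functions of one variable, for which
    derivable and differentiable mean the same. *)
Lemma is_derive_line (f : U -> V) q v d :
  is_derive q v f d <-> is_derive (0 : R) (1 : R) (fun h : R => f (h *: v + q)) d.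
Proof.
rewrite is_deriveP (is_deriveP (fun h : R => f (h *: v + q))).
rewrite (_ : (fun h : R => h^-1 *: (f (h *: v + q) - f q)) =
  (fun h : R => h^-1 *: (f ((h *: (1 : R) + 0) *: v + q) - f (0 *: v + q)))); first by split.
apply/funext => h; rewrite scale0r add0r; congr (_ *: (f (_ + _) - f _)); congr (_ *: _).
by rewrite /GRing.scale /= mulr1 addr0.
Qed.

End IsDeriveLine.

Section Components.
Variables (R : realType).
Implicit Types (U : set (R * R)) (q : R * R).

Lemma is_derive_pair (f : R * R -> R * R) q v d :
  is_derive q v f d <-> is_derive q v (fun z => (f z).1) d.1 /\
                        is_derive q v (fun z => (f z).2) d.2.
Proof.
split=> [/is_deriveP h|[/is_deriveP h1 /is_deriveP h2]].
  split; apply/is_deriveP.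
    by apply: (cvg_comp _ fst h); exact: cvg_fst.
  by apply: (cvg_comp _ snd h); exact: cvg_snd.
by apply/is_deriveP; exact: (cvg_pair h1 h2).
Qed.

Lemma continuous_pairP (f : R * R -> R * R) q :
  {for q, continuous f} <-> {for q, continuous (fun z => (f z).1)} /\
                            {for q, continuous (fun z => (f z).2)}.
Proof.
split=> [fc|[c1 c2]].
  split; first by apply: (@continuous_comp _ _ _ f fst); [exact: fc|exact: cvg_fst].
  by apply: (@continuous_comp _ _ _ f snd); [exact: fc|exact: cvg_snd].
have E : f = (fun z => ((f z).1, (f z).2)) by apply/funext => z; rewrite -surjective_pairing.
by rewrite E; exact: (cvg_pair c1 c2).
Qed.

Lemma Ck_pairP k U (f : R * R -> R * R) : open U ->
  Ck k U f <-> Ck k U (fun q => (f q).1) /\ Ck k U (fun q => (f q).2).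
Proof.
move=> oU; elim: k f => [|k IH] f.
  split=> [/Ck0P fc|[/Ck0P fc1 /Ck0P fc2]].
    by split; apply/Ck0P => q /fc /continuous_pairP[].
  apply/Ck0P => q Uq; apply/continuous_pairP.
  by split; [exact: fc1|exact: fc2].
split=> [/CkSP[fc fd f1 f2]|].
  have k1 q (Uq : U q) := (is_derive_pair f q e1 _).1 (derivableP (fd q Uq).1).
  have k2 q (Uq : U q) := (is_derive_pair f q e2 _).1 (derivableP (fd q Uq).2).
  have [f11 f12] := (IH _).1 f1; have [f21 f22] := (IH _).1 f2.
  split; apply/CkSP; split.
  - by move=> q /fc /continuous_pairP[].
  - by move=> q Uq; have [a _] := k1 q Uq; have [b _] := k2 q Uq; split; exact: ex_derive.
  - by apply: (Ck_eq oU _ f11) => q; rewrite inE => /k1[a _]; rewrite derive_val.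
  - by apply: (Ck_eq oU _ f21) => q; rewrite inE => /k2[a _]; rewrite derive_val.
  - by move=> q /fc /continuous_pairP[].
  - by move=> q Uq; have [_ a] := k1 q Uq; have [_ b] := k2 q Uq; split; exact: ex_derive.
  - by apply: (Ck_eq oU _ f12) => q; rewrite inE => /k1[_ a]; rewrite derive_val.
  - by apply: (Ck_eq oU _ f22) => q; rewrite inE => /k2[_ a]; rewrite derive_val.
move=> [/CkSP[fc1 fd1 f11 f12] /CkSP[fc2 fd2 f21 f22]].
have D1 q : U q -> is_derive q e1 f ('D_e1 (fun q => (f q).1) q, 'D_e1 (fun q => (f q).2) q).
  move=> Uq; have [a _] := fd1 q Uq; have [b _] := fd2 q Uq.
  by apply/is_derive_pair; split; [exact: derivableP a|exact: derivableP b].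
have D2 q : U q -> is_derive q e2 f ('D_e2 (fun q => (f q).1) q, 'D_e2 (fun q => (f q).2) q).
  move=> Uq; have [_ a] := fd1 q Uq; have [_ b] := fd2 q Uq.
  by apply/is_derive_pair; split; [exact: derivableP a|exact: derivableP b].
apply/CkSP; split.
- by move=> q Uq; apply/continuous_pairP; split; [exact: fc1|exact: fc2].
- by move=> q Uq; have a := D1 q Uq; have b := D2 q Uq; split; exact: ex_derive.
- apply/IH; split.
    by apply: (Ck_eq oU _ f11) => q; rewrite inE => /D1 a; rewrite derive_val.
  by apply: (Ck_eq oU _ f21) => q; rewrite inE => /D1 a; rewrite derive_val.
- apply/IH; split.
    by apply: (Ck_eq oU _ f12) => q; rewrite inE => /D2 a; rewrite derive_val.
  by apply: (Ck_eq oU _ f22) => q; rewrite inE => /D2 a; rewrite derive_val.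
Qed.

Lemma smooth_pairP U (f : R * R -> R * R) : open U ->
  smooth_on U f <-> smooth_on U (fun q => (f q).1) /\ smooth_on U (fun q => (f q).2).
Proof.
move=> oU; split=> [sf|[s1 s2] k]; last by apply/Ck_pairP.
by split=> k; have /(Ck_pairP _ _ oU)[] := sf k.
Qed.

Lemma is_derive_rV n (f : R * R -> 'rV[R]_n) q v d :
  is_derive q v f d <-> forall i, is_derive q v (fun z => f z 0 i) (d 0 i).
Proof.
split=> [[df <-] i|H].
  have dfi : derivable (fun z => f z 0 i) q v by exact: (derivable_mxP _ _ _).1.
  by apply: DeriveDef => //; rewrite derive_mx // mxE.
have df : derivable f q v.
  by apply/derivable_mxP => i j; rewrite ord1; have := H j => ?; exact: ex_derive.
apply: DeriveDef => //; rewrite derive_mx //; apply/rowP => i; rewrite mxE.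
by have := H i => ?; rewrite derive_val.
Qed.

Lemma coord_eq n (u v : 'rV[R]_n) i : u = v -> u 0 i = v 0 i.
Proof. by move=> ->. Qed.

Lemma comb_coord n (a b A B : R) (x y : 'rV[R]_n) i : A = x 0 i -> B = y 0 i ->
  a * A + b * B = (a *: x + b *: y) 0 i.
Proof. by move=> -> ->; rewrite !mxE. Qed.

Lemma derive_coord n (f : R * R -> 'rV[R]_n) q v i : derivable f q v ->
  'D_v (fun z => f z 0 i) q = 'D_v f q 0 i.
Proof. by move=> /derivableP/is_derive_rV/(_ i) df; exact: derive_val. Qed.

Lemma continuous_rV n (f : R * R -> 'rV[R]_n) q :
  {for q, continuous f} <-> forall i, {for q, continuous (fun z => f z 0 i)}.
Proof.
split=> [fc i|H].
  apply: (@continuous_comp _ _ _ f (fun M : 'rV[R]_n => M 0 i)); first exact: fc.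
  exact: coord_continuous.
apply/cvgrPdist_le => /= e e0; near=> z.
rewrite [leLHS]/Num.Def.normr/= mx_normrE (bigmax_le _ (ltW e0))//= => i _.
rewrite !mxE/=; move: i; near: z; apply: filter_forall => /= -[i j] /=.
by rewrite ord1; have /cvgrPdist_le/(_ _ e0) := H j.
Unshelve. all: by end_near. Qed.

Lemma Ck_rVP n k U (f : R * R -> 'rV[R]_n) : open U ->
  Ck k U f <-> forall i, Ck k U (fun q => f q 0 i).
Proof.
move=> oU; elim: k f => [|k IH] f.
  split=> [/Ck0P fc i|H].
    by apply/Ck0P => q Uq; apply: (continuous_rV _ _).1; exact: fc.
  by apply/Ck0P => q Uq; apply/continuous_rV => i; have /Ck0P := H i; exact.
split=> [/CkSP[fc fd f1 f2] i|H].
  have k1 q (Uq : U q) := (is_derive_rV f q e1 _).1 (derivableP (fd q Uq).1) i.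
  have k2 q (Uq : U q) := (is_derive_rV f q e2 _).1 (derivableP (fd q Uq).2) i.
  apply/CkSP; split.
  - by move=> q Uq; apply: (continuous_rV _ _).1; exact: fc.
  - by move=> q Uq; have a := k1 q Uq; have b := k2 q Uq; split; exact: ex_derive.
  - apply: (Ck_eq oU _ ((IH _).1 f1 i)) => q; rewrite inE => Uq.
    by have a := k1 q Uq; rewrite derive_val.
  - apply: (Ck_eq oU _ ((IH _).1 f2 i)) => q; rewrite inE => Uq.
    by have a := k2 q Uq; rewrite derive_val.
have k1 q : U q -> is_derive q e1 f (\row_i 'D_e1 (fun z => f z 0 i) q).
  move=> Uq; apply/is_derive_rV => i; rewrite mxE; apply: derivableP.
  by have /CkSP[_ fd _ _] := H i; exact: (fd q Uq).1.
have k2 q : U q -> is_derive q e2 f (\row_i 'D_e2 (fun z => f z 0 i) q).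
  move=> Uq; apply/is_derive_rV => i; rewrite mxE; apply: derivableP.
  by have /CkSP[_ fd _ _] := H i; exact: (fd q Uq).2.
apply/CkSP; split.
- by move=> q Uq; apply/continuous_rV => i; have /CkSP[fc _ _ _] := H i; exact: fc.
- by move=> q Uq; have a := k1 q Uq; have b := k2 q Uq; split; exact: ex_derive.
- apply/IH => i; have /CkSP[_ _ h _] := H i.
  apply: (Ck_eq oU _ h) => q; rewrite inE => Uq.
  by have a := k1 q Uq; rewrite derive_val mxE.
- apply/IH => i; have /CkSP[_ _ _ h] := H i.
  apply: (Ck_eq oU _ h) => q; rewrite inE => Uq.
  by have a := k2 q Uq; rewrite derive_val mxE.
Qed.

Lemma smooth_rVP n U (f : R * R -> 'rV[R]_n) : open U ->
  smooth_on U f <-> forall i, smooth_on U (fun q => f q 0 i).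
Proof.
by move=> oU; split=> [sf i k|sf k]; [have /(Ck_rVP _ _ oU) := sf k
  | apply/Ck_rVP => // i; exact: sf].
Qed.

End Components.

Section Chain.
Variables (R : realType).
Implicit Types (U W : set (R * R)) (q : R * R).

Lemma Ck1_differentiable U (f : R * R -> R) q : open U -> Ck 1 U f -> U q ->
  differentiable f q.
Proof.
move=> oU /CkSP[fc fd /Ck0P f1 /Ck0P f2] Uq.
by apply: (differentiable_of_partials oU Uq fd); [exact: f1|exact: f2].
Qed.

(** Along a line the inner pair is a curve, which is differentiable as soon as
    it has a derivative; the chain rule for differentials then applies. *)
Lemma is_derive_comp2 W (g : R * R -> R) (a b : R * R -> R) q v (da db : R) :
  open W -> Ck 1 W g -> W (a q, b q) ->
  is_derive q v a da -> is_derive q v b db ->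
  is_derive q v (fun z => g (a z, b z))
    (da * 'D_e1 g (a q, b q) + db * 'D_e2 g (a q, b q)).
Proof.
move=> oW Cg Wq /is_derive_line Da /is_derive_line Db; apply/is_derive_line.
have dg := Ck1_differentiable oW Cg Wq.
pose A h := a (h *: v + q); pose B h := b (h *: v + q).
have dA : differentiable A 0 by apply/derivable1_diffP; case: Da.
have dB : differentiable B 0 by apply/derivable1_diffP; case: Db.
have E0 : (A 0, B 0) = (a q, b q) by rewrite /A /B scale0r add0r.
have dF := differentiable_pair dA dB.
have dg' : differentiable g (A 0, B 0) by rewrite E0.
have dC := differentiable_comp dF dg'.
apply: DeriveDef; first exact/diff_derivable.
rewrite (deriveE _ dC) (diff_comp dF dg') /= diff_pair //= E0.
rewrite -(deriveE _ dA) -(deriveE _ dB).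
have -> : 'D_1 A 0 = da by case: Da.
have -> : 'D_1 B 0 = db by case: Db.
rewrite (basis_decomposition (da, db)) /=.
by rewrite linearD !linearZ -!(deriveE _ dg).
Qed.

Lemma Ck_comp k U W (g a b : R * R -> R) : open U -> open W ->
  (forall q, U q -> W (a q, b q)) ->
  Ck k U a -> Ck k U b -> Ck k W g -> Ck k U (fun q => g (a q, b q)).
Proof.
move=> oU oW UW; elim: k g => [|k IH] g Ha Hb Hg.
  move: Ha Hb Hg => /Ck0P ac /Ck0P bc /Ck0P gc; apply/Ck0P => q Uq.
  apply: (@continuous_comp _ _ _ (fun q => (a q, b q)) g); last exact/gc/UW.
  exact: (cvg_pair (ac q Uq) (bc q Uq)).
have C1g : Ck 1 W g by elim: (k) Hg => [|j IHj] h; [exact: h|exact: IHj (Ck_pred h)].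
have [a' b'] := (Ck_pred Ha, Ck_pred Hb).
move: Ha Hb Hg => /CkSP[ac ad a1 a2] /CkSP[bc bd b1 b2] /CkSP[gc gd g1 g2].
have k1 q : U q -> is_derive q e1 (fun z => g (a z, b z))
    ('D_e1 a q * 'D_e1 g (a q, b q) + 'D_e1 b q * 'D_e2 g (a q, b q)).
  move=> Uq; apply: (is_derive_comp2 oW C1g (UW _ Uq)); apply: derivableP.
    by case: (ad q Uq).
  by case: (bd q Uq).
have k2 q : U q -> is_derive q e2 (fun z => g (a z, b z))
    ('D_e2 a q * 'D_e1 g (a q, b q) + 'D_e2 b q * 'D_e2 g (a q, b q)).
  move=> Uq; apply: (is_derive_comp2 oW C1g (UW _ Uq)); apply: derivableP.
    by case: (ad q Uq).
  by case: (bd q Uq).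
have g1' := IH _ a' b' g1; have g2' := IH _ a' b' g2.
apply/CkSP; split.
- move=> q Uq.
  apply: (@continuous_comp _ _ _ (fun q => (a q, b q)) g); last exact/gc/UW.
  exact: (cvg_pair (ac q Uq) (bc q Uq)).
- by move=> q Uq; have x := k1 q Uq; have y := k2 q Uq; split; exact: ex_derive.
- apply: (Ck_eq oU _ (CkD oU (CkM oU a1 g1') (CkM oU b1 g2'))) => q; rewrite inE => Uq.
  by have x := k1 q Uq; rewrite derive_val.
- apply: (Ck_eq oU _ (CkD oU (CkM oU a2 g1') (CkM oU b2 g2'))) => q; rewrite inE => Uq.
  by have x := k2 q Uq; rewrite derive_val.
Qed.

Lemma smooth_comp U W (g : R * R -> R) (phi : R * R -> R * R) : open U -> open W ->
  (forall q, U q -> W (phi q)) ->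
  smooth_on U phi -> smooth_on W g -> smooth_on U (g \o phi).
Proof.
move=> oU oW UW /(smooth_pairP _ oU)[s1 s2] sg k.
have UW' q : U q -> W ((phi q).1, (phi q).2) by rewrite -surjective_pairing; exact: UW.
apply: (Ck_eq oU _ (Ck_comp oU oW UW' (s1 k) (s2 k) (sg k))) => q _.
by rewrite /= -surjective_pairing.
Qed.

Lemma smooth_comp_pair U W (g phi : R * R -> R * R) : open U -> open W ->
  (forall q, U q -> W (phi q)) ->
  smooth_on U phi -> smooth_on W g -> smooth_on U (g \o phi).
Proof.
move=> oU oW UW sp /(smooth_pairP _ oW)[s1 s2].
apply/smooth_pairP => //; split.
  exact: (smooth_comp oU oW UW sp s1).
exact: (smooth_comp oU oW UW sp s2).
Qed.

Lemma smooth_comp_rV n U W (g : R * R -> 'rV[R]_n) (phi : R * R -> R * R) : open U -> open W ->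
  (forall q, U q -> W (phi q)) ->
  smooth_on U phi -> smooth_on W g -> smooth_on U (g \o phi).
Proof.
move=> oU oW UW sp /(smooth_rVP _ oW) sg.
by apply/smooth_rVP => // i; exact: (smooth_comp oU oW UW sp (sg i)).
Qed.

Lemma is_derive_comp_rV n W (g : R * R -> 'rV[R]_n) (a b : R * R -> R) q v (da db : R) :
  open W -> smooth_on W g -> W (a q, b q) ->
  is_derive q v a da -> is_derive q v b db ->
  is_derive q v (fun z => g (a z, b z))
    (da *: 'D_e1 g (a q, b q) + db *: 'D_e2 g (a q, b q)).
Proof.
move=> oW sg Wq Da Db; apply/is_derive_rV => i.
have [d1 d2] := smooth_derivable sg Wq.
have H := is_derive_comp2 oW ((smooth_rVP g oW).1 sg i 1%N) Wq Da Db.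
exact: is_derive_eq H (comb_coord _ _ (derive_coord i d1) (derive_coord i d2)).
Qed.

End Chain.

(** * Symmetry of second derivatives *)

Section Schwarz.
Variables (R : realType).
Implicit Types (U W : set (R * R)) (q : R * R).

Lemma eq_of_close (a b : R) : (forall e, 0 < e -> `|a - b| <= e) -> a = b.
Proof.
move=> H; apply/eqP; rewrite -subr_eq0 -normr_le0; apply/ler_addgt0Pr => e e0.
by rewrite add0r; exact: H.
Qed.

Lemma close_of_meet (a b a' b' e : R) : b' = a' -> `|b - b'| < e / 2 ->
  `|a - a'| < e / 2 -> `|a - b| <= e.
Proof.
move=> -> h1 h2; have -> : a - b = (a - a') - (b - a') by ring.
by rewrite (splitr e); apply: (le_trans (ler_normB _ _)); apply: lerD; exact: ltW.
Qed.

Lemma is_derive_D1 U (f : R * R -> R) q : smooth_on U f -> U q ->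
  is_derive q e1 f ('D_e1 f q).
Proof. by move=> sf Uq; apply: derivableP; have [] := smooth_derivable sf Uq. Qed.

Lemma is_derive_D2 U (f : R * R -> R) q : smooth_on U f -> U q ->
  is_derive q e2 f ('D_e2 f q).
Proof. by move=> sf Uq; apply: derivableP; have [] := smooth_derivable sf Uq. Qed.

Lemma MVT_step (f df : R -> R) (u s : R) : 0 <= s ->
  (forall x, u <= x <= u + s -> is_derive x 1 f (df x)) ->
  exists2 c, u <= c <= u + s & f (u + s) - f u = df c * s.
Proof.
move=> s0 H; have us : u <= u + s by rewrite lerDl.
have [|c] := @MVT_between _ f df u (u + s).
  by rewrite (min_l us) (max_r us); exact: H.
rewrite (min_l us) (max_r us) => hc; rewrite addrAC subrr add0r => Ec.
by exists c.
Qed.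

(** Both values are the second difference of f over a square of side r / 2,
    divided by the area of the square. *)
Lemma mixed_partials_meet U (f : R * R -> R) q r : smooth_on U f ->
  0 < r -> ball q r `<=` U ->
  exists z z', [/\ ball q r z, ball q r z' & 'D_e2 ('D_e1 f) z = 'D_e1 ('D_e2 f) z'].
Proof.
move=> sf r0 rU; case: q rU => u v rU; pose s := r / 2.
have s0 : 0 < s by rewrite divr_gt0.
have us : u <= u + s by rewrite lerDl ltW.
have vs : v <= v + s by rewrite lerDl ltW.
have inb (c x : R) : c <= x <= c + s -> `|c - x| < r.
  have : s < r by rewrite /s; lra.
  by move=> sr /andP[a b]; rewrite ltr_norml; apply/andP; split; lra.
have inb0 (c : R) : `|c - c| < r by rewrite subrr normr0.
have bb x y : u <= x <= u + s -> v <= y <= v + s -> ball (u, v) r (x, y).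
  by move=> hx hy; split; apply: inb.
have vv : v <= v <= v + s by rewrite lexx.
have vv' : v <= v + s <= v + s by rewrite lexx vs.
have uu : u <= u <= u + s by rewrite lexx.
have uu' : u <= u + s <= u + s by rewrite lexx us.
have sf1 := smooth_D1 sf; have sf2 := smooth_D2 sf.
have s0' := ltW s0.
have [x hx Ex] : exists2 c, u <= c <= u + s &
    (f (u + s, v + s) - f (u + s, v)) - (f (u, v + s) - f (u, v)) =
    ('D_e1 f (c, v + s) - 'D_e1 f (c, v)) * s.
  apply: (@MVT_step (fun x => f (x, v + s) - f (x, v))) => // x hx.
  apply: is_deriveB.
    by have := is_derive_D1 sf (rU _ (bb _ _ hx vv')) => /is_derive_e1.
  by have := is_derive_D1 sf (rU _ (bb _ _ hx vv)) => /is_derive_e1.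
have [y hy Ey] : exists2 c, v <= c <= v + s &
    'D_e1 f (x, v + s) - 'D_e1 f (x, v) = 'D_e2 ('D_e1 f) (x, c) * s.
  apply: (@MVT_step (fun y => 'D_e1 f (x, y)) _ _ _ s0') => y hy.
  by have := is_derive_D2 sf1 (rU _ (bb _ _ hx hy)) => /is_derive_e2.
have [y' hy' Ey'] : exists2 c, v <= c <= v + s &
    (f (u + s, v + s) - f (u, v + s)) - (f (u + s, v) - f (u, v)) =
    ('D_e2 f (u + s, c) - 'D_e2 f (u, c)) * s.
  apply: (@MVT_step (fun y => f (u + s, y) - f (u, y)) _ _ _ s0') => y' hy'.
  apply: is_deriveB.
    by have := is_derive_D2 sf (rU _ (bb _ _ uu' hy')) => /is_derive_e2.
  by have := is_derive_D2 sf (rU _ (bb _ _ uu hy')) => /is_derive_e2.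
have [x' hx' Ex'] : exists2 c, u <= c <= u + s &
    'D_e2 f (u + s, y') - 'D_e2 f (u, y') = 'D_e1 ('D_e2 f) (c, y') * s.
  apply: (@MVT_step (fun x => 'D_e2 f (x, y')) _ _ _ s0') => x' hx'.
  by have := is_derive_D1 sf2 (rU _ (bb _ _ hx' hy')) => /is_derive_e1.
exists (x, y), (x', y'); split; [exact: bb|exact: bb|].
have s00 : s * s != 0 by rewrite mulf_neq0 // gt_eqF.
apply: (mulIf s00); move: Ex Ey Ex' Ey'.
move: ('D_e2 ('D_e1 f) (x, y)) ('D_e1 ('D_e2 f) (x', y')) => A B.
move: ('D_e1 f (x, v + s) - 'D_e1 f (x, v)) => C.
move: ('D_e2 f (u + s, y') - 'D_e2 f (u, y')) => D.
move=> Ex Ey Ex' Ey'; rewrite (mulrA A) (mulrA B) -Ey -Ex -Ex' -Ey'.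
by move: (f _) (f _) (f _) (f _) => *; ring.
Qed.

(** Schwarz's theorem: [mixed_partials_meet] on balls that shrink to q. *)
Lemma mixed_partials_eq U (f : R * R -> R) q : open U -> smooth_on U f -> U q ->
  'D_e1 ('D_e2 f) q = 'D_e2 ('D_e1 f) q.
Proof.
move=> oU sf Uq; apply: eq_of_close => e e0.
have c1 := smooth_continuous (smooth_D1 (smooth_D2 sf)) Uq.
have c2 := smooth_continuous (smooth_D2 (smooth_D1 sf)) Uq.
have e20 : 0 < e / 2 by rewrite divr_gt0.
have : \forall z \near q, [/\ U z, `|'D_e1 ('D_e2 f) q - 'D_e1 ('D_e2 f) z| < e / 2 &
   `|'D_e2 ('D_e1 f) q - 'D_e2 ('D_e1 f) z| < e / 2].
  have nU : nbhs q U by exact: open_nbhs_nbhs.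
  have n1 := near_close c1 e20; have n2 := near_close c2 e20.
  apply: filterS3 nU n1 n2 => z Uz h1 h2.
  split.
  exact: Uz.
  exact: h1.
  exact: h2.
move=> /nbhs_ballP[r /= r0 rP].
have rU : ball q r `<=` U by move=> z /rP[].
have [z [z' [/rP[_ _ bz] /rP[_ bz' _] E]]] := mixed_partials_meet sf r0 rU.
exact: close_of_meet E bz bz'.
Qed.

Lemma mixed_partials_eq_rV n U (f : R * R -> 'rV[R]_n) q : open U -> smooth_on U f -> U q ->
  'D_e1 ('D_e2 f) q = 'D_e2 ('D_e1 f) q.
Proof.
move=> oU sf Uq; apply/rowP => i.
have sfi : smooth_on U (fun z => f z 0 i) := (smooth_rVP f oU).1 sf i.
have [d1 _] := smooth_derivable (smooth_D2 sf) Uq.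
have [_ d2] := smooth_derivable (smooth_D1 sf) Uq.
have E1 : 'D_e1 ('D_e2 (fun z => f z 0 i)) q = 'D_e1 (fun z => 'D_e2 f z 0 i) q.
  apply: near_eq_derive; apply: (near_open oU _ Uq) => z; rewrite inE => Uz.
  by apply: derive_coord; have [] := smooth_derivable sf Uz.
have E2 : 'D_e2 ('D_e1 (fun z => f z 0 i)) q = 'D_e2 (fun z => 'D_e1 f z 0 i) q.
  apply: near_eq_derive; apply: (near_open oU _ Uq) => z; rewrite inE => Uz.
  by apply: derive_coord; have [] := smooth_derivable sf Uz.
have F1 := derive_coord i d1; have F2 := derive_coord i d2.
have M := mixed_partials_eq oU sfi Uq.
exact: etrans (esym (etrans E1 F1)) (etrans M (etrans E2 F2)).
Qed.

End Schwarz.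

(** * The inverse function theorem *)

Section Injectivity.
Variables (R : realType).

(** Applied to matrices whose rows are gradients taken at different points, as
    the mean value theorem produces them; Cramer's rule gives the bound. *)
Lemma det_stable (al be ga de : R) : al * de - be * ga != 0 ->
  exists e M : R, [/\ 0 < e, 0 < M & forall a b c d : R,
    `|al - a| < e -> `|be - b| < e -> `|ga - c| < e -> `|de - d| < e ->
    a * d - b * c != 0 /\ forall h1 h2 : R,
      `|h1| + `|h2| <= M * (`|a * h1 + b * h2| + `|c * h1 + d * h2|)].
Proof.
move=> Dn0; pose D : R := `|al * de - be * ga|; have D0 : 0 < D by rewrite normr_gt0.
pose N : R := 1 + `|al| + `|be| + `|ga| + `|de|.
have N0 : 0 < N by rewrite /N -!addrA ltr_wpDr // !addr_ge0.
(* Errors below e change the determinant by at most 4 N e <= D / 2. *)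
pose e : R := Num.min 1 (D / (8 * N)).
have e0 : 0 < e by rewrite lt_min ltr01 /= divr_gt0 // mulr_gt0.
have eN : 8 * N * e <= D.
  by rewrite mulrC -ler_pdivlMr ?mulr_gt0 // ge_min lexx orbT.
exists e, (4 * N / D); split => //; first by rewrite divr_gt0 // mulr_gt0.
move=> a b c d ha hb hc hd.
have bd (x y : R) : `|x - y| < e -> `|x| + 1 <= N -> `|y| <= N.
  move=> xy xN; apply: le_trans xN; rewrite -[y](subKr x).
  apply: (le_trans (ler_normB _ _)); rewrite lerD2l ltW //.
  by apply: (lt_le_trans xy); rewrite ge_min lexx.
have [/andP[na0 nb0] /andP[nc0 nd0]] : (0 <= `|al|) && (0 <= `|be|) /\ (0 <= `|ga|) && (0 <= `|de|).
  by rewrite !normr_ge0.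
have Na : `|a| <= N by apply: bd ha _; rewrite /N; lra.
have Nb : `|b| <= N by apply: bd hb _; rewrite /N; lra.
have Nc : `|c| <= N by apply: bd hc _; rewrite /N; lra.
have Nd : `|d| <= N by apply: bd hd _; rewrite /N; lra.
have Nal : `|al| <= N by rewrite /N; lra.
have Nbe : `|be| <= N by rewrite /N; lra.
have mulb (x y X Y : R) : `|x| <= X -> `|y| <= Y -> `|x * y| <= X * Y.
  by move=> *; rewrite normrM ler_pM.
have Dle : D <= 2 * `|a * d - b * c|.
  have E : al * de - be * ga = (a * d - b * c) +
     ((al - a) * d + al * (de - d) - ((be - b) * c + be * (ga - c))) by ring.
  have h1 := mulb _ _ _ _ (ltW ha) Nd; have h2 := mulb _ _ _ _ Nal (ltW hd).
  have h3 := mulb _ _ _ _ (ltW hb) Nc; have h4 := mulb _ _ _ _ Nbe (ltW hc).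
  have : D <= `|a * d - b * c| + (e * N + N * e + (e * N + N * e)).
    rewrite /D E; apply: (le_trans (ler_normD _ _)); rewrite lerD2l.
    apply: (le_trans (ler_normB _ _)); apply: lerD.
      exact: (le_trans (ler_normD _ _) (lerD h1 h2)).
    exact: (le_trans (ler_normD _ _) (lerD h3 h4)).
  by rewrite (mulrC N e); move: eN; lra.
have n0 : a * d - b * c != 0 by rewrite -normr_gt0; lra.
split => // h1 h2; set k1 := a * h1 + _; set k2 := c * h1 + _.
have E1 : (a * d - b * c) * h1 = d * k1 - b * k2 by rewrite /k1 /k2; ring.
have E2 : (a * d - b * c) * h2 = a * k2 - c * k1 by rewrite /k1 /k2; ring.
move: k1 k2 E1 E2 => k1 k2 E1 E2.
have L1 : `|a * d - b * c| * `|h1| <= N * (`|k1| + `|k2|).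
  rewrite -normrM E1 mulrDr; apply: (le_trans (ler_normB _ _)).
  by rewrite !normrM; apply: lerD; exact: ler_pM.
have L2 : `|a * d - b * c| * `|h2| <= N * (`|k1| + `|k2|).
  rewrite -normrM E2 mulrDr; apply: (le_trans (ler_normB _ _)).
  by rewrite !normrM addrC; apply: lerD; exact: ler_pM.
rewrite mulrAC ler_pdivlMr //.
have := ler_wpM2r (addr_ge0 (normr_ge0 h1) (normr_ge0 h2)) Dle.
by rewrite (mulrC _ D); lra.
Qed.

Variables (V : set (R * R)) (a b : R * R -> R).
Hypotheses (oV : open V) (sa : smooth_on V a) (sb : smooth_on V b).

Definition jac q := 'D_e1 a q * 'D_e2 b q - 'D_e2 a q * 'D_e1 b q.

(** By [MVT_box] the increments of a and b are a matrix close to the Jacobian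
    matrix at q0, applied to the increment of the point. *)
Lemma inverse_lipschitz q0 : V q0 -> jac q0 != 0 ->
  exists r M : R, [/\ 0 < r, 0 < M, ball q0 r `<=` V, forall z, ball q0 r z -> jac z != 0 &
   forall p q, ball q0 r p -> ball q0 r q ->
    `|p.1 - q.1| + `|p.2 - q.2| <= M * (`|a p - a q| + `|b p - b q|)].
Proof.
move=> Vq /det_stable[e [M [e0 M0 st]]].
have C (f : R * R -> R) : smooth_on V f -> \forall z \near q0, `|f q0 - f z| < e.
  by move=> sf; have cf := smooth_continuous sf Vq; have := near_close cf e0.
have nV : nbhs q0 V by exact: open_nbhs_nbhs.
have nI (X Y : set (R * R)) : nbhs q0 X -> nbhs q0 Y -> nbhs q0 (X `&` Y) by exact: filterI.
have H := nI _ _ nV (nI _ _ (nI _ _ (C _ (smooth_D1 sa)) (C _ (smooth_D2 sa)))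
                            (nI _ _ (C _ (smooth_D1 sb)) (C _ (smooth_D2 sb)))).
have /nbhs_ballP[r /= r0 rP] : nbhs q0 _ := H.
have rV : ball q0 r `<=` V by move=> z /rP[].
exists r, M; split => //.
  by move=> z /rP[_ [[h1 h2] [h3 h4]]]; have [] := st _ _ _ _ h1 h2 h3 h4.
move=> p q bp bq.
have da z : ball q0 r z -> derivable a z e1 /\ derivable a z e2.
  by move=> /rV; exact: smooth_derivable.
have db z : ball q0 r z -> derivable b z e1 /\ derivable b z e2.
  by move=> /rV; exact: smooth_derivable.
have [x1 [x2 [/rP[_ [[h1 _] _]] /rP[_ [[_ h2] _]] ->]]] := MVT_box da bq bp.
have [y1 [y2 [/rP[_ [_ [h3 _]]] /rP[_ [_ [_ h4]]] ->]]] := MVT_box db bq bp.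
by have [_] := st _ _ _ _ h1 h2 h3 h4; exact.
Qed.

End Injectivity.

Section Surjectivity.
Variables (R : realType).
Variables (V : set (R * R)) (a b : R * R -> R).
Hypotheses (oV : open V) (sa : smooth_on V a) (sb : smooth_on V b).
Local Notation jac := (jac a b).

Lemma interior_min_derive (f df : R -> R) (c s : R) : 0 < s ->
  (forall x, c - s < x < c + s -> is_derive x 1 f (df x)) ->
  forall x, c - s < x < c + s -> (forall y, c - s < y < c + s -> f x <= f y) -> df x = 0.
Proof.
move=> s0 fd x xs xmin.
have ab : c - s <= c + s by lra.
have dmin : is_derive x 1 f 0.
  apply: (derive1_at_min ab) => [t|| t]; rewrite ?in_itv //=; last exact: xmin.
  by move=> /fd ?; exact: ex_derive.
have h1 := derive_val (is_derive := dmin).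
have h2 := fd x xs.
by rewrite -(derive_val (is_derive := h2)) h1.
Qed.

Lemma is_derive_sqdist (f : R -> R) (y x d : R) : is_derive x 1 f d ->
  is_derive x 1 (fun t => (f t - y) ^+ 2) (2 * (f x - y) * d).
Proof.
move=> df; have h : is_derive x 1 (fun t => f t - y) d.
  by apply: (is_derive_eq (is_deriveB df (is_derive_cst y x 1))); rewrite subr0.
have := is_deriveX 2 h.
move=> h2; apply: (is_derive_eq h2).
by rewrite /GRing.scale /= expr1.
Qed.

Lemma norm_lt_of_sqr (w e : R) : 0 < e -> w ^+ 2 < e ^+ 2 -> `|w| < e.
Proof.
move=> e0 h; rewrite ltNge; apply/negP => ew.
have : e ^+ 2 <= `|w| ^+ 2 by rewrite ler_pXn2r // nnegrE // ltW.
by rewrite (real_normK (num_real w)) leNgt h.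
Qed.

(** The squared distance from (a, b) to y has a minimum on the closed square
    around p. On the boundary it is larger than at p, by the Lipschitz bound;
    at an interior minimum its gradient vanishes, and then so does the
    distance itself, since the Jacobian matrix is invertible. *)
Lemma local_surjectivity (p : R * R) (s M : R) : 0 < s -> 0 < M ->
  (forall z, `|p.1 - z.1| <= s -> `|p.2 - z.2| <= s -> V z /\ jac z != 0) ->
  (forall z, `|p.1 - z.1| <= s -> `|p.2 - z.2| <= s ->
    `|p.1 - z.1| + `|p.2 - z.2| <= M * (`|a p - a z| + `|b p - b z|)) ->
  forall y : R * R, `|a p - y.1| < s / (8 * M) -> `|b p - y.2| < s / (8 * M) ->
  exists2 z, `|p.1 - z.1| < s /\ `|p.2 - z.2| < s & a z = y.1 /\ b z = y.2.
Proof.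
move=> s0 M0 HV HM y y1 y2.
(* The bound del = s / (8 M) leaves room: at a minimum z both values are within
   3 del of those at p, hence z is within 6 M del < s of p. *)
pose A := `[p.1 - s, p.1 + s]%classic `*` `[p.2 - s, p.2 + s]%classic.
pose m z := (a z - y.1) ^+ 2 + (b z - y.2) ^+ 2.
have AP z : A z <-> `|p.1 - z.1| <= s /\ `|p.2 - z.2| <= s.
  rewrite /A /setX /= !in_itv /= !ler_norml !lerBlDl !lerBrDl.
  split=> [[/andP[h1 h2] /andP[h3 h4]]|[/andP[h1 h2] /andP[h3 h4]]].
    by split; apply/andP; split; lra.
  by split; apply/andP; split; lra.
have cA : compact A by apply: compact_setX; exact: segment_compact.
have A0 : A !=set0 by exists p; apply/AP; rewrite !subrr normr0 ltW.
have cm : {within A, continuous m}.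
  apply: continuous_in_subspaceT => z /[!inE] /AP[h1 h2].
  have [Vz _] := HV z h1 h2.
  have ca := smooth_continuous sa Vz; have cb := smooth_continuous sb Vz.
  have ca' : {for z, continuous (fun z => a z - y.1)} by apply: cvgB => //; exact: cvg_cst.
  have cb' : {for z, continuous (fun z => b z - y.2)} by apply: cvgB => //; exact: cvg_cst.
  rewrite /m; apply: cvgD; rewrite expr2; exact: cvgM.
have [z /[!inE] /AP[z1 z2] zmin] := compact_EVT_min A0 cA cm.
have {}zmin w : `|p.1 - w.1| <= s -> `|p.2 - w.2| <= s -> m z <= m w.
  by move=> h1 h2; apply: zmin; rewrite inE; apply/AP.
have [Vz Jz] := HV z z1 z2.
pose del := s / (8 * M).
have del0 : 0 < del by rewrite divr_gt0 // mulr_gt0.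
have small : m z < 2 * del ^+ 2.
  have := zmin p; rewrite !subrr normr0 => /(_ (ltW s0) (ltW s0)) /le_lt_trans; apply.
  rewrite /m mulr2n mulrDl mul1r.
  have sq (x e : R) : `|x| < e -> x ^+ 2 < e ^+ 2.
    by move=> xe; rewrite -real_normK ?num_real // ltr_pXn2r ?nnegrE ?normr_ge0 // (le_trans _ (ltW xe)).
  by apply: ltrD; apply: sq.
have az : `|a z - y.1| < 2 * del.
  apply: norm_lt_of_sqr; first by rewrite mulr_gt0.
  have := sqr_ge0 (a z - y.1); have := sqr_ge0 (b z - y.2); have := sqr_ge0 del.
  by move: small; rewrite /m; lra.
have bz : `|b z - y.2| < 2 * del.
  apply: norm_lt_of_sqr; first by rewrite mulr_gt0.
  have := sqr_ge0 (a z - y.1); have := sqr_ge0 (b z - y.2); have := sqr_ge0 del.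
  by move: small; rewrite /m; lra.
have inside : `|p.1 - z.1| + `|p.2 - z.2| < s.
  apply: (le_lt_trans (HM z z1 z2)).
  have e1' : s = M * (8 * del) by rewrite /del; field; rewrite gt_eqF.
  rewrite [ltRHS]e1' ltr_pM2l //.
  have t1 : `|a p - a z| < 3 * del.
    rewrite (_ : a p - a z = (a p - y.1) - (a z - y.1)); last by ring.
    by apply: (le_lt_trans (ler_normB _ _)); move: y1 az; rewrite -/del; lra.
  have t2 : `|b p - b z| < 3 * del.
    rewrite (_ : b p - b z = (b p - y.2) - (b z - y.2)); last by ring.
    by apply: (le_lt_trans (ler_normB _ _)); move: y2 bz; rewrite -/del; lra.
  by lra.
have i1 : `|p.1 - z.1| < s by have := normr_ge0 (p.2 - z.2); lra.
have i2 : `|p.2 - z.2| < s by have := normr_ge0 (p.1 - z.1); lra.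
exists z => //.
have btw (c x : R) : c - s < x < c + s -> `|c - x| < s.
  by move=> /andP[h1 h2]; rewrite ltr_norml; apply/andP; split; lra.
have btw' (c x : R) : `|c - x| < s -> c - s < x < c + s.
  by rewrite ltr_norml => /andP[h1 h2]; apply/andP; split; lra.
have d1 : 2 * (a z - y.1) * 'D_e1 a z + 2 * (b z - y.2) * 'D_e1 b z = 0.
  have D t : p.1 - s < t < p.1 + s -> is_derive t 1 (fun t => m (t, z.2))
      (2 * (a (t, z.2) - y.1) * 'D_e1 a (t, z.2) + 2 * (b (t, z.2) - y.2) * 'D_e1 b (t, z.2)).
    move=> /btw /ltW ht; have [Vt _] := HV (t, z.2) ht z2.
    apply: is_deriveD; apply: is_derive_sqdist.
      by have := is_derive_D1 sa Vt => /is_derive_e1.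
    by have := is_derive_D1 sb Vt => /is_derive_e1.
  have := interior_min_derive s0 D (btw' _ _ i1); rewrite -surjective_pairing; apply.
  by move=> t /btw /ltW ht; exact: zmin.
have d2 : 2 * (a z - y.1) * 'D_e2 a z + 2 * (b z - y.2) * 'D_e2 b z = 0.
  have D t : p.2 - s < t < p.2 + s -> is_derive t 1 (fun t => m (z.1, t))
      (2 * (a (z.1, t) - y.1) * 'D_e2 a (z.1, t) + 2 * (b (z.1, t) - y.2) * 'D_e2 b (z.1, t)).
    move=> /btw /ltW ht; have [Vt _] := HV (z.1, t) z1 ht.
    apply: is_deriveD; apply: is_derive_sqdist.
      by have := is_derive_D2 sa Vt => /is_derive_e2.
    by have := is_derive_D2 sb Vt => /is_derive_e2.
  have := interior_min_derive s0 D (btw' _ _ i2); rewrite -surjective_pairing; apply.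
  by move=> t /btw /ltW ht; exact: zmin.
move: Jz; rewrite /jac.
move: ('D_e1 a z) ('D_e2 a z) ('D_e1 b z) ('D_e2 b z) d1 d2 => A1 A2 B1 B2 d1 d2 J0.
split; apply/eqP; rewrite -subr_eq0; apply/eqP; apply: (mulIf J0); rewrite mul0r.
  rewrite (_ : _ * _ = 2^-1 * (B2 * (2 * (a z - y.1) * A1 + 2 * (b z - y.2) * B1)
     - B1 * (2 * (a z - y.1) * A2 + 2 * (b z - y.2) * B2))); last by field.
  by rewrite d1 d2 !mulr0 subrr mulr0.
rewrite (_ : _ * _ = 2^-1 * (A1 * (2 * (a z - y.1) * A2 + 2 * (b z - y.2) * B2)
     - A2 * (2 * (a z - y.1) * A1 + 2 * (b z - y.2) * B1))); last by field.
by rewrite d1 d2 !mulr0 subrr mulr0.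
Qed.

End Surjectivity.

Section InverseDerivative.
Variables (R : realType).

Lemma first_order_expansion (V : set (R * R)) (f : R * R -> R) z eta :
  open V -> smooth_on V f -> V z -> 0 < eta ->
  exists2 rho : R, 0 < rho & forall w, ball z rho w ->
   `|f w - f z - ('D_e1 f z * (w.1 - z.1) + 'D_e2 f z * (w.2 - z.2))| <=
     eta * (`|w.1 - z.1| + `|w.2 - z.2|).
Proof.
move=> oV sf Vz eta0.
have nV : nbhs z V by exact: open_nbhs_nbhs.
have n1 := near_close (smooth_continuous (smooth_D1 sf) Vz) eta0.
have n2 := near_close (smooth_continuous (smooth_D2 sf) Vz) eta0.
have nI (X Y : set (R * R)) : nbhs z X -> nbhs z Y -> nbhs z (X `&` Y) by exact: filterI.
have /nbhs_ballP[rho /= rho0 rP] : nbhs z _ := nI _ _ nV (nI _ _ n1 n2).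
exists rho => // w bw.
have df x : ball z rho x -> derivable f x e1 /\ derivable f x e2.
  by move=> /rP[Vx _]; exact: smooth_derivable sf Vx.
have [xi [et [/rP[_ [h1 _]] /rP[_ [_ h2]] ->]]] := MVT_box df (ballxx z rho0) bw.
move: h1 h2; move: ('D_e1 f z) ('D_e2 f z) ('D_e1 f xi) ('D_e2 f et) => A B A' B' h1 h2.
rewrite (_ : _ - _ = (A' - A) * (w.1 - z.1) + (B' - B) * (w.2 - z.2)); last by ring.
rewrite [X in _ <= X]mulrDr; apply: (le_trans (ler_normD _ _)); rewrite !normrM.
by apply: lerD; apply: ler_wpM2r => //; rewrite distrC ltW.
Qed.

(** Cramer's rule for a linear system that holds up to an error eta; here k is
    the increment of the inverse map along h v. *)
Lemma linear_solve_close (A1 A2 B1 B2 v1 v2 h k1 k2 M eta eps : R) :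
  A1 * B2 - A2 * B1 != 0 -> h != 0 -> 0 < M -> 0 < eta ->
  `|h * v1 - (A1 * k1 + A2 * k2)| <= eta * (`|k1| + `|k2|) ->
  `|h * v2 - (B1 * k1 + B2 * k2)| <= eta * (`|k1| + `|k2|) ->
  `|k1| + `|k2| <= M * (`|h| * (`|v1| + `|v2|)) ->
  eta * ((1 + `|A1| + `|A2| + `|B1| + `|B2|) * M * (1 + `|v1| + `|v2|)) <=
    eps * `|A1 * B2 - A2 * B1| ->
  `|(A1 * B2 - A2 * B1)^-1 * (B2 * v1 - A2 * v2) - h^-1 * k1| <= eps /\
  `|(A1 * B2 - A2 * B1)^-1 * (A1 * v2 - B1 * v1) - h^-1 * k2| <= eps.
Proof.
move=> J0 h0 M0 eta0; set ra := h * v1 - _; set rb := h * v2 - _ => La Lb Lk Le.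
set J := A1 * B2 - A2 * B1 in J0 Le *.
set N : R := 1 + `|A1| + `|A2| + `|B1| + `|B2| in Le.
have key (p q : R) : `|p| + `|q| <= N -> `|p * ra + q * rb| <= eps * (`|J| * `|h|).
  move=> pq; apply: (le_trans (ler_normD _ _)); rewrite !normrM mulrA.
  have T : `|p| * `|ra| + `|q| * `|rb| <= N * (eta * (M * (`|h| * (`|v1| + `|v2|)))).
    apply: (@le_trans _ _ ((`|p| + `|q|) * (eta * (`|k1| + `|k2|)))).
      by rewrite [leRHS]mulrDl; apply: lerD; apply: ler_wpM2l.
    apply: ler_pM; [by rewrite addr_ge0| |exact: pq|].
      by rewrite mulr_ge0 ?addr_ge0 // ltW.
    by apply: ler_wpM2l => //; exact: ltW.
  apply: (le_trans T); apply: le_trans (ler_wpM2r (normr_ge0 h) Le).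
  rewrite (_ : N * _ = eta * (N * M * (`|v1| + `|v2|)) * `|h|); last by ring.
  apply: ler_wpM2r => //; apply: ler_wpM2l; first exact: ltW.
  apply: ler_wpM2l; last by rewrite lerD2r lerDr.
  have N_ge0 : 0 <= N by rewrite /N !addr_ge0.
  by rewrite mulr_ge0 // ltW.
have nn : [/\ 0 <= `|A1|, 0 <= `|A2|, 0 <= `|B1| & 0 <= `|B2|] by split.
have Jh : 0 < `|J| * `|h| by rewrite mulr_gt0 // normr_gt0.
have fin x w : J * h * x = w -> `|w| <= eps * (`|J| * `|h|) -> `|x| <= eps.
  by move=> <-; rewrite !normrM mulrC ler_pM2r.
split.
  apply: (fin _ (B2 * ra + (- A2) * rb)).
    by rewrite /ra /rb /J; field; rewrite -/J J0 h0.
  by apply: key; rewrite normrN /N; case: nn => *; lra.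
apply: (fin _ ((- B1) * ra + A1 * rb)).
  by rewrite /ra /rb /J; field; rewrite -/J J0 h0.
by apply: key; rewrite normrN /N; case: nn => *; lra.
Qed.

Variables (V : set (R * R)) (a b : R * R -> R).
Hypotheses (oV : open V) (sa : smooth_on V a) (sb : smooth_on V b).
Local Notation jac := (jac a b).

(** Apply the first order expansion of a and b at psi y to the increment of
    psi, which the Lipschitz bound makes comparable to the increment of the
    argument, and solve for it. *)
Lemma inverse_is_derive (W : set (R * R)) (psi : R * R -> R * R) (M : R) (y v : R * R) :
  open W -> W y -> 0 < M -> V (psi y) -> jac (psi y) != 0 ->
  {for y, continuous psi} ->
  (forall w, W w -> a (psi w) = w.1 /\ b (psi w) = w.2) ->
  (forall w, W w -> `|(psi w).1 - (psi y).1| + `|(psi w).2 - (psi y).2| <=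
     M * (`|w.1 - y.1| + `|w.2 - y.2|)) ->
  is_derive y v (fun w => (psi w).1)
    ((jac (psi y))^-1 * ('D_e2 b (psi y) * v.1 - 'D_e2 a (psi y) * v.2)) /\
  is_derive y v (fun w => (psi w).2)
    ((jac (psi y))^-1 * ('D_e1 a (psi y) * v.2 - 'D_e1 b (psi y) * v.1)).
Proof.
move=> oW Wy M0 Vz J0 cpsi inv lip; set z := psi y in Vz J0 lip *.
pose N : R := 1 + `|'D_e1 a z| + `|'D_e2 a z| + `|'D_e1 b z| + `|'D_e2 b z|.
pose K : R := N * M * (1 + `|v.1| + `|v.2|).
have N0 : 0 < N by rewrite /N -!addrA ltr_wpDr // !addr_ge0.
have K0 : 0 < K by rewrite !mulr_gt0 // -!addrA ltr_wpDr // !addr_ge0.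
have key eps : 0 < eps -> \forall h \near (0 : R)^',
   `|(jac z)^-1 * ('D_e2 b z * v.1 - 'D_e2 a z * v.2) - h^-1 * ((psi (h *: v + y)).1 - z.1)| <= eps
  /\ `|(jac z)^-1 * ('D_e1 a z * v.2 - 'D_e1 b z * v.1) - h^-1 * ((psi (h *: v + y)).2 - z.2)| <= eps.
  move=> eps0; pose J : R := `|jac z|; have J1 : 0 < J by rewrite normr_gt0.
  (* Small enough for the last hypothesis of linear_solve_close. *)
  pose eta : R := eps * J / K.
  have eta0 : 0 < eta by rewrite divr_gt0 // mulr_gt0.
  have [r1 r10 H1] := first_order_expansion oV sa Vz eta0.
  have [r2 r20 H2] := first_order_expansion oV sb Vz eta0.
  have cl : h *: v + y @[h --> (0 : R)] --> y.
    have c1 : (fun h : R => h *: v) @ (0 : R) --> (0 : R) *: v.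
      by apply: cvgZr_tmp; exact: cvg_id.
    have c2 : (fun h : R => y) @ (0 : R) --> y by exact: cvg_cst.
    have c3 : (fun h : R => h *: v + y) @ (0 : R) --> 0 *: v + y by exact: cvgD c1 c2.
    by rewrite scale0r add0r in c3.
  have nW : \forall h \near (0 : R)^', W (h *: v + y).
    apply: nbhs_dnbhs; apply: cl; exact: open_nbhs_nbhs.
  have nB : \forall h \near (0 : R)^', ball z (Num.min r1 r2) (psi (h *: v + y)).
    apply: nbhs_dnbhs; apply: (cvg_comp _ _ cl cpsi); apply: nbhsx_ballx.
    by rewrite lt_min r10.
  have n0 : \forall h \near (0 : R)^', h != 0 by exact: nbhs_dnbhs_neq.
  apply: filterS3 nW nB n0 => h Wh Bh h0.
  set w := psi (h *: v + y) in Bh *.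
  have [aw bw] := inv _ Wh; have [az bz] := inv _ Wy.
  rewrite -/w in aw bw; rewrite -/z in az bz.
  have L := lip _ Wh; rewrite -/w in L.
  have E1 : (h *: v + y).1 - y.1 = h * v.1 by rewrite /= addrK.
  have E2 : (h *: v + y).2 - y.2 = h * v.2 by rewrite /= addrK.
  rewrite E1 E2 !normrM -mulrDr in L.
  have m1 : Num.min r1 r2 <= r1 by rewrite ge_min lexx.
  have m2 : Num.min r1 r2 <= r2 by rewrite ge_min lexx orbT.
  have B1 := H1 w (le_ball m1 Bh); have B2 := H2 w (le_ball m2 Bh).
  rewrite aw az E1 in B1; rewrite bw bz E2 in B2.
  apply: (linear_solve_close J0 h0 M0 eta0 B1 B2 L).
  by rewrite /eta -/N -/K -/J divfK // gt_eqF.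
split; apply/is_deriveP/cvgrPdist_le => eps eps0.
  by apply: filterS (key _ eps0) => h [].
by apply: filterS (key _ eps0) => h [].
Qed.
End InverseDerivative.

Section InverseFunctionTheorem.
Variables (R : realType).

(** The inverse is C^k for all k by induction, as its partial derivatives are
    entries of the inverse Jacobian matrix, composed with the inverse itself. *)
Theorem inverse_function (V : set (R * R)) (a b : R * R -> R) (q0 : R * R) :
  open V -> smooth_on V a -> smooth_on V b -> V q0 -> jac a b q0 != 0 ->
  exists (V' W : set (R * R)) (psi : R * R -> R * R),
    [/\ open V', V' `<=` V, V' q0 & open W] /\
    [/\ forall z, V' z -> W (a z, b z) /\ psi (a z, b z) = z,
        forall w, W w -> V' (psi w) /\ (a (psi w), b (psi w)) = w &
        smooth_on W psi].
Proof.
move=> oV sa sb Vq J0.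
have [r [M [r0 M0 rV rJ lip]]] := inverse_lipschitz oV sa sb Vq J0.
pose B : set (R * R) := ball q0 r; pose W := (fun z => (a z, b z)) @` B.
pose psi y := xget q0 [set z | B z /\ (a z, b z) = y].
have psiP w : W w -> B (psi w) /\ (a (psi w), b (psi w)) = w.
  move=> [z Bz E]; have ex : exists z, [set z | B z /\ (a z, b z) = w] z by exists z.
  exact: (xgetPex q0 ex).
have inj z z' : B z -> B z' -> (a z, b z) = (a z', b z') -> z = z'.
  move=> Bz Bz' [Ea Eb]; have := lip z z' Bz Bz'.
  rewrite Ea Eb !subrr normr0 addr0 mulr0 => le0.
  have n1 := normr_ge0 (z.1 - z'.1); have n2 := normr_ge0 (z.2 - z'.2).
  have /eqP : `|z.1 - z'.1| = 0 by lra.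
  rewrite normr_eq0 subr_eq0 => /eqP E1.
  have /eqP : `|z.2 - z'.2| = 0 by lra.
  rewrite normr_eq0 subr_eq0 => /eqP E2.
  by rewrite (surjective_pairing z) (surjective_pairing z') E1 E2.
have inv w : W w -> a (psi w) = w.1 /\ b (psi w) = w.2.
  by move=> /psiP[_ E]; split; [exact: (congr1 fst E)|exact: (congr1 snd E)].
have lipW w w' : W w -> W w' -> `|(psi w).1 - (psi w').1| + `|(psi w).2 - (psi w').2| <=
     M * (`|w.1 - w'.1| + `|w.2 - w'.2|).
  move=> Ww Ww'; have := lip _ _ (psiP _ Ww).1 (psiP _ Ww').1.
  by have [-> ->] := inv _ Ww; have [-> ->] := inv _ Ww'.
have oW : open W.
  rewrite openE => _ [p [/= p1 p2] <-].
  pose mx : R := Num.max `|q0.1 - p.1| `|q0.2 - p.2|.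
  (* Half the distance from p to the boundary of the ball. *)
  pose s : R := (r - mx) / 2.
  have mxr : mx < r by rewrite gt_max p1 p2.
  have s0 : 0 < s by rewrite divr_gt0 // subr_gt0.
  have m1 : `|q0.1 - p.1| <= mx by rewrite le_max lexx.
  have m2 : `|q0.2 - p.2| <= mx by rewrite le_max lexx orbT.
  have inB z : `|p.1 - z.1| <= s -> `|p.2 - z.2| <= s -> B z.
    rewrite /s => h1 h2; split.
      rewrite /ball /= (_ : q0.1 - z.1 = (q0.1 - p.1) + (p.1 - z.1)); last by ring.
      by apply: (le_lt_trans (ler_normD _ _)); lra.
    rewrite /ball /= (_ : q0.2 - z.2 = (q0.2 - p.2) + (p.2 - z.2)); last by ring.
    by apply: (le_lt_trans (ler_normD _ _)); lra.
  have Bp : B p by [].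
  apply/nbhs_ballP; exists (s / (8 * M)); first by rewrite /= divr_gt0 // mulr_gt0.
  move=> y [/= y1 y2].
  have [| |z [z1 z2] [az bz]] := local_surjectivity sa sb s0 M0 _ _ y1 y2.
  - by move=> z h1 h2; have Bz := inB z h1 h2; split; [exact: rV|exact: rJ].
  - by move=> z h1 h2; exact: lip Bp (inB z h1 h2).
  exists z; first by apply: inB; exact: ltW.
  by rewrite az bz -surjective_pairing.
have cpsi w : W w -> {for w, continuous psi}.
  move=> Ww; apply/cvg_ballP => e e0.
  have nW : nbhs w W by exact: open_nbhs_nbhs.
  have d0 : 0 < e / (2 * M) by rewrite divr_gt0 // mulr_gt0.
  have nb : nbhs w (ball w (e / (2 * M))) := nbhsx_ballx w _ d0.
  apply: filterS2 nW nb => w' Ww' [/= b1 b2].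
  have L := lipW _ _ Ww Ww'.
  have : M * (`|w.1 - w'.1| + `|w.2 - w'.2|) < e.
    have E : e = M * (e / (2 * M) + e / (2 * M)) by field; rewrite gt_eqF.
    by rewrite [ltRHS]E ltr_pM2l // ltrD.
  move=> L2; split; rewrite /ball /=.
    by have := normr_ge0 ((psi w).2 - (psi w').2); lra.
  by have := normr_ge0 ((psi w).1 - (psi w').1); lra.
have lip' y w : W y -> W w -> `|(psi w).1 - (psi y).1| + `|(psi w).2 - (psi y).2| <=
     M * (`|w.1 - y.1| + `|w.2 - y.2|) by move=> Wy Ww; exact: lipW.
have der w v : W w -> _ := fun Ww : W w => @inverse_is_derive R V a b oV sa sb W psi M w v oW Ww M0
   (rV _ (psiP _ Ww).1) (rJ _ (psiP _ Ww).1) (cpsi _ Ww) inv (fun w' Ww' => lip' _ _ Ww Ww').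
have oB : open B by exact: ball_open.
have sub (f : R * R -> R) : smooth_on V f -> smooth_on B f by exact: smooth_sub.
have sJ : smooth_on B (jac a b).
  by apply: smoothB => //; apply: smoothM => //; apply: sub;
    [exact: smooth_D1|exact: smooth_D2|exact: smooth_D2|exact: smooth_D1].
have sV : smooth_on B (fun z => (jac a b z)^-1) by apply: smoothV.
have s11 : smooth_on B (fun z => (jac a b z)^-1 * 'D_e2 b z).
  by apply: smoothM => //; apply: sub; exact: smooth_D2.
have s12 : smooth_on B (fun z => (jac a b z)^-1 * - 'D_e2 a z).
  by apply: smoothM => //; apply: smoothN => //; apply: sub; exact: smooth_D2.
have s21 : smooth_on B (fun z => (jac a b z)^-1 * - 'D_e1 b z).
  by apply: smoothM => //; apply: smoothN => //; apply: sub; exact: smooth_D1.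
have s22 : smooth_on B (fun z => (jac a b z)^-1 * 'D_e1 a z).
  by apply: smoothM => //; apply: sub; exact: smooth_D1.
have Bpsi w : W w -> B ((psi w).1, (psi w).2).
  by move=> /psiP[]; rewrite -surjective_pairing.
have Hk k : Ck k W (fun w => (psi w).1) /\ Ck k W (fun w => (psi w).2).
  elim: k => [|k [IH1 IH2]].
    by split; apply/Ck0P => w /cpsi /continuous_pairP[].
  have comp (g : R * R -> R) : smooth_on B g -> Ck k W (fun w => g (psi w)).
    move=> sg; apply: (Ck_eq oW _ (Ck_comp oW oB Bpsi IH1 IH2 (sg k))) => w _.
    by rewrite -surjective_pairing.
  split; apply/CkSP; split.
  - by move=> w /cpsi /continuous_pairP[].
  - by move=> w Ww; have [d1 _] := der w e1 Ww; have [d2 _] := der w e2 Ww; split; exact: ex_derive.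
  - apply: (Ck_eq oW _ (comp _ s11)) => w; rewrite inE => Ww.
    by have [d1 _] := der w e1 Ww; rewrite derive_val fst_e1 snd_e1 mulr1 mulr0 subr0.
  - apply: (Ck_eq oW _ (comp _ s12)) => w; rewrite inE => Ww.
    by have [d1 _] := der w e2 Ww; rewrite derive_val fst_e2 snd_e2 mulr1 mulr0 sub0r.
  - by move=> w /cpsi /continuous_pairP[].
  - by move=> w Ww; have [_ d1] := der w e1 Ww; have [_ d2] := der w e2 Ww; split; exact: ex_derive.
  - apply: (Ck_eq oW _ (comp _ s21)) => w; rewrite inE => Ww.
    by have [_ d1] := der w e1 Ww; rewrite derive_val fst_e1 snd_e1 mulr1 mulr0 sub0r.
  - apply: (Ck_eq oW _ (comp _ s22)) => w; rewrite inE => Ww.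
    by have [_ d1] := der w e2 Ww; rewrite derive_val fst_e2 snd_e2 mulr1 mulr0 subr0.
exists B, W, psi; split; first by split => //; exact: ballxx.
split.
- move=> z Bz; have Wz : W (a z, b z) by exists z.
  by split => //; have [Bp E] := psiP _ Wz; exact: inj E.
- exact: psiP.
- by move=> k; apply/(Ck_pairP _ _ oW); exact: Hk.
Qed.

End InverseFunctionTheorem.

(** * The Poincare lemma *)

Section Poincare.
Variables (R : realType).

(** The lower end a of both integrals lies to the left of c and x, so that
    integrals over sets can be used; the difference is the oriented integral
    from c to x. *)
Definition prim (f : R -> R) (a c x : R) : R :=
  \int[@lebesgue_measure R]_(t in `[a, x]) f t - \int[@lebesgue_measure R]_(t in `[a, c]) f t.

Lemma prim0 f a c : prim f a c c = 0.
Proof. exact: subrr. Qed.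

Lemma is_derive_prim (f : R -> R) (a b c x : R) :
  (forall t, a <= t <= b -> {for t, continuous f}) -> a < x < b ->
  is_derive x 1 (prim f a c) (f x).
Proof.
move=> fc /andP[ax xb].
have fi : (@lebesgue_measure R).-integrable `[a, b] (EFin \o f).
  apply: continuous_compact_integrable; first exact: segment_compact.
  apply: continuous_in_subspaceT => t /[!inE]; rewrite /= in_itv /=; exact: fc.
have fcx : {for x, continuous f} by apply: fc; rewrite !ltW.
have [dF EF] := continuous_FTC1_closed xb fi ax fcx.
have h : is_derive x 1 (fun x => \int[@lebesgue_measure R]_(t in `[a, x]) f t) (f x).
  by apply: DeriveDef; [exact: dF|rewrite -EF derive1E].
apply: (is_derive_eq (is_deriveB h (is_derive_cst _ x 1))).
by rewrite subr0.
Qed.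

(** The potential is K(u, v) = int_u0^u P(s, v0) ds + int_v0^v Q(u, s) ds. For
    the derivative in u of the second integral B(u, v), consider, for small t,
    d(y) = B(u + t, y) - B(u, y) - t (P(u, y) - P(u, v0)). It vanishes at v0,
    and as P_v = Q_u its derivative is Q(u + t, y) - Q(u, y) - t Q_u(u, y), of
    size at most C t^2 with C a bound for Q_uu. So d(v) = O(t^2), and B has
    the u-derivative P(u, v) - P(u, v0). *)
Lemma poincare (V : set (R * R)) (P Q : R * R -> R) (q0 : R * R) :
  open V -> V q0 -> smooth_on V P -> smooth_on V Q ->
  (forall z, V z -> 'D_e2 P z = 'D_e1 Q z) ->
  exists2 r : R, 0 < r & ball q0 r `<=` V /\ exists K : R * R -> R,
    forall z, ball q0 r z -> is_derive z e1 K (P z) /\ is_derive z e2 K (Q z).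
Proof.
move=> oV Vq sP sQ cl.
pose Q1 := 'D_e1 Q; pose Q11 := 'D_e1 Q1.
have sQ1 : smooth_on V Q1 := smooth_D1 sQ.
have sQ11 : smooth_on V Q11 := smooth_D1 sQ1.
pose C : R := `|Q11 q0| + 1.
have C0 : 0 < C by rewrite ltr_wpDl.
have [r0 r00 rP] : exists2 r0 : R, 0 < r0 & forall z, ball q0 r0 z -> V z /\ `|Q11 z| <= C.
  have nV : nbhs q0 V by exact: open_nbhs_nbhs.
  have n1 := near_close (smooth_continuous sQ11 Vq) ltr01.
  have nI (X Y : set (R * R)) : nbhs q0 X -> nbhs q0 Y -> nbhs q0 (X `&` Y) by exact: filterI.
  have /nbhs_ballP[r0 /= r00 rP] : nbhs q0 _ := nI _ _ nV n1.
  exists r0 => // z /rP[Vz h]; split => //.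
  rewrite -[Q11 z](subKr (Q11 q0)); apply: (le_trans (ler_normB _ _)).
  by rewrite lerD2l ltW.
case: q0 Vq @C C0 rP => u0 v0 Vq C C0 rP.
pose r := r0 / 2; have r_gt0 : 0 < r by rewrite divr_gt0.
have rr0 : r < r0 by rewrite /r; lra.
have inb (x y : R) : `|u0 - x| < r0 -> `|v0 - y| < r0 -> V (x, y) /\ `|Q11 (x, y)| <= C.
  by move=> h1 h2; exact: rP.
have itv (c x : R) : c - r <= x <= c + r -> `|c - x| < r0.
  by move=> /andP[h1 h2]; rewrite ltr_norml; apply/andP; split; lra.
have itv' (c x : R) : `|c - x| < r -> c - r < x < c + r.
  by rewrite ltr_norml => /andP[h1 h2]; apply/andP; split; lra.
have cont1 (f : R * R -> R) x y : {for (x, y), continuous f} -> {for x, continuous (fun s => f (s, y))}.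
  move=> fc; apply: (@continuous_comp _ _ _ (fun s => (s, y)) f); last exact: fc.
  exact: (cvg_pair cvg_id (cvg_cst y)).
have cont2 (f : R * R -> R) x y : {for (x, y), continuous f} -> {for y, continuous (fun s => f (x, s))}.
  move=> fc; apply: (@continuous_comp _ _ _ (fun s => (x, s)) f); last exact: fc.
  exact: (cvg_pair (cvg_cst x) cvg_id).
have v00 : `|v0 - v0| < r0 by rewrite subrr normr0.
pose B x y := prim (fun s => Q (x, s)) (v0 - r) v0 y.
have dB x y : `|u0 - x| < r0 -> `|v0 - y| < r -> is_derive y 1 (B x) (Q (x, y)).
  move=> hx hy; apply: (@is_derive_prim (fun s => Q (x, s)) (v0 - r) (v0 + r)); last exact: itv'.
  by move=> t /itv ht; apply: cont2; have [Vt _] := inb _ _ hx ht; exact: smooth_continuous sQ Vt.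
pose F := prim (fun s => P (s, v0)) (u0 - r) u0.
have dF x : `|u0 - x| < r -> is_derive x 1 F (P (x, v0)).
  move=> hx; apply: (@is_derive_prim (fun s => P (s, v0)) (u0 - r) (u0 + r)); last exact: itv'.
  by move=> t /itv ht; apply: cont1; have [Vt _] := inb _ _ ht v00; exact: smooth_continuous sP Vt.
exists r => //; split.
  by move=> z [z1 z2]; have [] := rP z; [split; [exact: lt_trans rr0|exact: lt_trans rr0]|].
exists (fun z => F z.1 + B z.1 z.2) => -[u v] [/= hu hv]; split; last first.
  apply/is_derive_e2 => /=.
  have hu' : `|u0 - u| < r0 by exact: lt_trans rr0.
  by apply: (is_derive_eq (is_deriveD (is_derive_cst (F u) v 1) (dB u v hu' hv))); rewrite add0r.
apply/is_derive_e1 => /=.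
have hu' : `|u0 - u| < r0 by exact: lt_trans rr0.
have hv' : `|v0 - v| < r0 by exact: lt_trans rr0.
suff dBu : is_derive u 1 (fun s => B s v) (P (u, v) - P (u, v0)).
  by apply: (is_derive_eq (is_deriveD (dF u hu) dBu)); rewrite addrC subrK.
apply/is_deriveP/cvgrPdist_le => e e_gt0.
have est t : `|u0 - (t + u)| < r0 ->
    `|B (t + u) v - B u v - t * (P (u, v) - P (u, v0))| <= C * t ^+ 2 * r.
  move=> ht.
  have bt (y : R) : Num.min v0 v <= y <= Num.max v0 v -> `|v0 - y| < r.
    by apply: between_dist hv; rewrite subrr normr0.
  have btx (x : R) : Num.min u (t + u) <= x <= Num.max u (t + u) ->
      `|u0 - x| < r0 /\ `|x - u| <= `|t|.
    move=> hx; split; first exact: between_dist hu' ht hx.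
    by apply: (le_trans (between_le hx)); rewrite addrK.
  pose d y := B (t + u) y - B u y - t * (P (u, y) - P (u, v0)).
  have dd (y : R) : Num.min v0 v <= y <= Num.max v0 v -> is_derive y 1 d
     (Q (t + u, y) - Q (u, y) - t * Q1 (u, y)).
    move=> /bt hy; apply: is_deriveB.
      by apply: is_deriveB; exact: dB.
    have hy' : `|v0 - y| < r0 by exact: lt_trans rr0.
    have [Vy _] := inb _ _ hu' hy'.
    have dP : is_derive y 1 (fun s => P (u, s)) (Q1 (u, y)).
      by rewrite /Q1 -(cl _ Vy); have /is_derive_e2 := is_derive_D2 sP Vy.
    have dP2 : is_derive y 1 (fun s => P (u, s) - P (u, v0)) (Q1 (u, y)).
      by apply: (is_derive_eq (is_deriveB dP (is_derive_cst _ y 1))); rewrite subr0.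
    exact: is_deriveZ dP2.
  have [y /bt hy] := MVT_between dd.
  have hy' : `|v0 - y| < r0 by exact: lt_trans rr0.
  have dv0 : d v0 = 0 by rewrite /d /B !prim0 !subrr mulr0 subr0.
  rewrite dv0 subr0 -/(d v) => ->; rewrite normrM.
  have dQ (x : R) : Num.min u (t + u) <= x <= Num.max u (t + u) ->
      is_derive x 1 (fun s => Q (s, y)) (Q1 (x, y)).
    move=> /btx[hx _]; have [Vx _] := inb _ _ hx hy'.
    by have /is_derive_e1 := is_derive_D1 sQ Vx.
  have [xi hxi ->] := MVT_between dQ; have [_ xit] := btx _ hxi.
  have dQ1 (x : R) : Num.min u xi <= x <= Num.max u xi ->
      is_derive x 1 (fun s => Q1 (s, y)) (Q11 (x, y)).
    move=> hx; have [hx' _] := btx x (between_trans hxi hx).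
    have [Vx _] := inb _ _ hx' hy'.
    by have /is_derive_e1 := is_derive_D1 sQ1 Vx.
  have [x hx E] := MVT_between dQ1.
  have hx' : `|Q11 (x, y)| <= C.
    have [hx' _] := btx x (between_trans hxi hx).
    by have [] := inb _ _ hx' hy'.
  have -> : Q1 (xi, y) * (t + u - u) - t * Q1 (u, y) = t * (Q1 (xi, y) - Q1 (u, y)).
    by ring.
  rewrite E -real_normK ?num_real // expr2 !normrM.
  have hv2 : `|v - v0| <= r by rewrite distrC ltW.
  have H : `|Q11 (x, y)| * `|xi - u| <= C * `|t| by apply: ler_pM.
  rewrite (_ : C * _ * r = `|t| * (C * `|t|) * r); last by ring.
  apply: ler_pM; [by rewrite !mulr_ge0|exact: normr_ge0| |exact: hv2].
  by apply: ler_wpM2l.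
have CR : 0 < e / (C * r) by rewrite divr_gt0 // mulr_gt0.
have gap : 0 < r0 - `|u0 - u| by rewrite subr_gt0.
have n1 : \forall h \near (0 : R)^', `|h| < e / (C * r) by exact: dnbhs0_lt.
have n2 : \forall h \near (0 : R)^', `|h| < r0 - `|u0 - u| by exact: dnbhs0_lt.
have n0 : \forall h \near (0 : R)^', h != 0 by exact: nbhs_dnbhs_neq.
apply: filterS3 n1 n2 n0 => h h1 h2 h0.
rewrite {1}/GRing.scale /= [h *: _]mulr1.
have ht : `|u0 - (h + u)| < r0.
  rewrite opprD addrCA addrC; apply: (le_lt_trans (ler_normD _ _)).
  by rewrite normrN; lra.
have L := est h ht.
have h00 : 0 < `|h| by rewrite normr_gt0.
rewrite -(ler_pM2l h00) -normrM mulrBr mulrA divff // mul1r distrC.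
apply: (le_trans L); rewrite -real_normK ?num_real // expr2.
have : `|h| * (C * r) <= e by rewrite -ler_pdivlMr ?mulr_gt0 // ltW.
by move=> /(ler_wpM2l (normr_ge0 h)); lra.
Qed.

End Poincare.

(** * Charts defined by closed 1-forms *)

Section NewChart.
Variables (R : realType) (M : topologicalType).

Lemma smooth_primitive (U : set (R * R)) (P Q K : R * R -> R) : open U ->
  smooth_on U P -> smooth_on U Q ->
  (forall z, U z -> is_derive z e1 K (P z) /\ is_derive z e2 K (Q z)) ->
  smooth_on U K.
Proof.
move=> oU sP sQ dK.
have D1 : {in U, P =1 'D_e1 K}.
  by move=> z; rewrite inE => Uz; have [d1 _] := dK z Uz; rewrite derive_val.
have D2 : {in U, Q =1 'D_e2 K}.
  by move=> z; rewrite inE => Uz; have [_ d2] := dK z Uz; rewrite derive_val.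
have dd z : U z -> derivable K z e1 /\ derivable K z e2.
  by move=> Uz; have [[d1 _] [d2 _]] := dK z Uz.
have cK z : U z -> {for z, continuous K}.
  move=> Uz; apply: differentiable_continuous.
  apply: (differentiable_of_partials oU Uz dd).
    exact: continuous_eq_open oU D1 Uz (smooth_continuous sP Uz).
  exact: continuous_eq_open oU D2 Uz (smooth_continuous sQ Uz).
case=> [|k]; first by apply/Ck0P.
apply/CkSP; split; [exact: cK|exact: dd| |].
  exact: Ck_eq oU D1 (sP k).
exact: Ck_eq oU D2 (sQ k).
Qed.

Lemma chart_image_open (c : chart R M) (D : set M) : open D ->
  open (to c @` (dom c `&` D)).
Proof.
move=> oD; rewrite openE => _ [p [cp Dp] <-].
have cq := to_cod cp.
have nc : nbhs (to c p) (cod c) by apply: open_nbhs_nbhs; split => //; exact: cod_open.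
have nD : nbhs (to c p) (from c @^-1` D).
  apply: (from_continuous cq); apply: open_nbhs_nbhs; split => //.
  by rewrite toK.
apply: filterS2 nc nD => w cw Dw; exists (from c w); last exact: fromK.
by split => //; exact: from_dom.
Qed.

Lemma chart_preimage_open (c : chart R M) (U : set (R * R)) : open U ->
  open (dom c `&` to c @^-1` U).
Proof.
move=> oU; rewrite openE => p [cp Up].
have nc : nbhs p (dom c) by apply: open_nbhs_nbhs; split => //; exact: dom_open.
have nU : nbhs p (to c @^-1` U).
  by apply: (to_continuous cp); apply: open_nbhs_nbhs.
by apply: filterS2 nc nU => w.
Qed.

Section Reparametrize.
Variables (c : chart R M) (V W : set (R * R)) (phi psi : R * R -> R * R).
Hypotheses (oV : open V) (oW : open W) (Vc : V `<=` cod c)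
  (sphi : smooth_on V phi) (spsi : smooth_on W psi)
  (phiP : forall z, V z -> W (phi z) /\ psi (phi z) = z)
  (psiP : forall w, W w -> V (psi w) /\ phi (psi w) = w).

Definition reparam : chart R M.
refine (@Chart R M (dom c `&` to c @^-1` V) W (phi \o to c) (from c \o psi)
  (chart_preimage_open c oV) oW _ _ _ _ _ _).
- by move=> p [_ /phiP[]].
- move=> w /psiP[Vw _]; split; first exact: from_dom (Vc Vw).
  by rewrite /= fromK //; exact: Vc.
- by move=> p [cp /phiP[_ /= ->]]; exact: toK.
- by move=> w /psiP[Vw /= E]; rewrite /= fromK //; exact: Vc.
- move=> p [cp Vp]; apply: continuous_comp; first exact: to_continuous.
  exact: smooth_continuous sphi Vp.
- move=> w Ww; apply: continuous_comp; first exact: smooth_continuous spsi Ww.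
  by apply: from_continuous; apply: Vc; have [] := psiP Ww.
Defined.

(** Transition maps of the new chart are those of c composed with phi or psi. *)
Lemma reparam_local_coordinates (A : set (chart R M)) :
  local_coordinates A c -> local_coordinates A reparam.
Proof.
move=> Ac c' /Ac [s1 s2]; split.
  apply: (@smooth_comp_pair _ _ (to c @` (dom c `&` dom c')) (to c' \o from c) psi _ _ _ _ s1).
  - exact: chart_image_open (dom_open c').
  - exact: chart_image_open (dom_open c').
  - move=> w [p [[cp Vp] c'p] <-]; exists p => //.
    by have [_ /= ->] := phiP Vp.
  - by apply: smooth_sub spsi => w [p [[cp Vp] c'p] <-]; have [] := phiP Vp.
have oS : open (to c' @` (dom reparam `&` dom c')).
  by rewrite setIC; apply: chart_image_open; exact: chart_preimage_open.
apply: (@smooth_comp_pair _ _ V phi (to c \o from c') oS oV _ _ sphi).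
  by move=> w [p [[cp Vp] c'p] <-]; rewrite /= toK.
by apply: smooth_sub s2 => w [p [[cp Vp] c'p] <-]; exists p.
Qed.

End Reparametrize.

(** The chart c' covers the part of c over B and has there the coordinates
    (k1, k2) as functions of those of c. The inverse change of coordinates is
    recorded only for its smoothness. *)
Record coordinate_change (c c' : chart R M) (B : set (R * R)) (k1 k2 : R * R -> R) : Prop := {
  cc_open : open B;
  cc_sub : B `<=` cod c;
  cc_s1 : smooth_on B k1;
  cc_s2 : smooth_on B k2;
  cc_cod : forall z, B z -> cod c' (k1 z, k2 z);
  cc_from : forall z, B z -> from c' (k1 z, k2 z) = from c z;
  cc_surj : forall w, cod c' w -> exists2 z, B z & w = (k1 z, k2 z);
  cc_inv : exists psi, [/\ smooth_on (cod c') psi, forall w, cod c' w -> B (psi w) &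
     from c' = from c \o psi]
}.

(** Closed forms P1 du + Q1 dv and P2 du + Q2 dv that are independent at a
    point are the differentials of two functions on a square around it, which
    are coordinates near the point by the inverse function theorem. *)
Lemma coordinates_of_closed_forms (A : set (chart R M)) (c : chart R M) (p : M)
    (V : set (R * R)) (P1 Q1 P2 Q2 : R * R -> R) :
  local_coordinates A c -> dom c p -> open V -> V `<=` cod c -> V (to c p) ->
  smooth_on V P1 -> smooth_on V Q1 -> smooth_on V P2 -> smooth_on V Q2 ->
  (forall z, V z -> 'D_e2 P1 z = 'D_e1 Q1 z) ->
  (forall z, V z -> 'D_e2 P2 z = 'D_e1 Q2 z) ->
  P1 (to c p) * Q2 (to c p) - Q1 (to c p) * P2 (to c p) != 0 ->
  exists (c' : chart R M) (B : set (R * R)) (k1 k2 : R * R -> R),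
    [/\ local_coordinates A c', dom c' p, B `<=` V, B (to c p) /\
        to c' p = (k1 (to c p), k2 (to c p)) & coordinate_change c c' B k1 k2] /\
    (forall z, B z -> [/\ is_derive z e1 k1 (P1 z), is_derive z e2 k1 (Q1 z),
        is_derive z e1 k2 (P2 z) & is_derive z e2 k2 (Q2 z)]).
Proof.
move=> Ac cp oV Vc Vp sP1 sQ1 sP2 sQ2 cl1 cl2 J0.
have [r1 r10 [r1V [k1 dk1]]] := poincare oV Vp sP1 sQ1 cl1.
have [r2 r20 [r2V [k2 dk2]]] := poincare oV Vp sP2 sQ2 cl2.
pose r : R := Num.min r1 r2; have r0 : 0 < r by rewrite lt_min r10.
have m1 : r <= r1 by rewrite ge_min lexx.
have m2 : r <= r2 by rewrite ge_min lexx orbT.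
pose D : set (R * R) := ball (to c p) r.
have oD : open D by exact: ball_open.
have D1 z : D z -> ball (to c p) r1 z by exact: le_ball.
have D2 z : D z -> ball (to c p) r2 z by exact: le_ball.
have DV : D `<=` V by move=> z /D1 /r1V.
have sk1 : smooth_on D k1.
  apply: (smooth_primitive oD (smooth_sub DV sP1) (smooth_sub DV sQ1)).
  by move=> z /D1; exact: dk1.
have sk2 : smooth_on D k2.
  apply: (smooth_primitive oD (smooth_sub DV sP2) (smooth_sub DV sQ2)).
  by move=> z /D2; exact: dk2.
have Dp : D (to c p) by exact: ballxx.
have dd z : D z -> [/\ is_derive z e1 k1 (P1 z), is_derive z e2 k1 (Q1 z),
        is_derive z e1 k2 (P2 z) & is_derive z e2 k2 (Q2 z)].
  move=> Dz; have [a1 a2] := dk1 z (D1 z Dz); have [b1 b2] := dk2 z (D2 z Dz).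
  by split.
have Jn0 : jac k1 k2 (to c p) != 0.
  have [a1 a2 b1 b2] := dd _ Dp.
  by rewrite /jac (derive_val (is_derive := a1)) (derive_val (is_derive := a2))
    (derive_val (is_derive := b1)) (derive_val (is_derive := b2)).
have [B [W [psi [[oB BD Bp oW] [phiP psiP spsi]]]]] := inverse_function oD sk1 sk2 Dp Jn0.
pose phi z := (k1 z, k2 z).
have Bc : B `<=` cod c by move=> z /BD /DV /Vc.
have sphi : smooth_on B phi.
  by apply/(smooth_pairP _ oB); split; apply: (smooth_sub BD).
exists (reparam oB oW Bc sphi spsi phiP psiP), B, k1, k2; split; last first.
  by move=> z /BD; exact: dd.
split => //.
- exact: reparam_local_coordinates.
- by move=> z /BD /DV.
- split => //.
  + exact: smooth_sub BD sk1.
  + exact: smooth_sub BD sk2.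
  + by move=> z /phiP[].
  + by move=> z /phiP[_ /= ->].
  + by move=> w /psiP[Bw E]; exists (psi w).
  + by exists psi; split => // w /psiP[].
Qed.

End NewChart.

(** * Derivatives of the first fundamental form *)

Section MinkCalculus.
Variables (R : realType).
Implicit Types (f g : R * R -> 'rV[R]_4) (a : R * R -> R).

Lemma is_derive_mink f g q v df dg : is_derive q v f df -> is_derive q v g dg ->
  is_derive q v (fun z => mink (f z) (g z)) (mink df (g q) + mink (f q) dg).
Proof.
move=> /is_derive_rV Df /is_derive_rV Dg.
have H i : is_derive q v (fun z => f z 0 i * g z 0 i) (f q 0 i * dg 0 i + g q 0 i * df 0 i).
  exact: is_deriveM (Df i) (Dg i).
have := is_deriveB (is_deriveD (is_deriveD (H 0) (H 1)) (H 2)) (H 3).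
move=> h; apply: (is_derive_eq h); rewrite /mink; ring.
Qed.

Lemma smooth_mink U f g : open U -> smooth_on U f -> smooth_on U g ->
  smooth_on U (fun z => mink (f z) (g z)).
Proof.
move=> oU /(smooth_rVP _ oU) sf /(smooth_rVP _ oU) sg.
have H i := smoothM oU (sf i) (sg i).
exact: (smoothB oU (smoothD oU (smoothD oU (H 0) (H 1)) (H 2)) (H 3)).
Qed.

Lemma is_derive_scale n a (f : R * R -> 'rV[R]_n) q v (da : R) df :
  is_derive q v a da -> is_derive q v f df ->
  is_derive q v (fun z => a z *: f z) (da *: f q + a q *: df).
Proof.
move=> Da /is_derive_rV Df; apply/is_derive_rV => i.
have E : (fun z => (a z *: f z) 0 i) = (fun z => a z * f z 0 i).
  by apply/funext => z; rewrite mxE.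
rewrite E !mxE; apply: (is_derive_eq (is_deriveM Da (Df i))).
by rewrite /GRing.scale /=; ring.
Qed.

Lemma smooth_scale n U a (f : R * R -> 'rV[R]_n) : open U -> smooth_on U a -> smooth_on U f ->
  smooth_on U (fun z => a z *: f z).
Proof.
move=> oU sa /(smooth_rVP _ oU) sf; apply/(smooth_rVP _ oU) => i.
have E : (fun z => (a z *: f z) 0 i) = (fun z => a z * f z 0 i).
  by apply/funext => z; rewrite mxE.
by rewrite E; exact: smoothM.
Qed.

Lemma minkNr (a b : 'rV[R]_4) : mink a (- b) = - mink a b.
Proof. by rewrite minkC minkNl (minkC a). Qed.

Definition minkE := (minkDl, minkDr, minkNl, minkNr, minkZl, minkZr).

(** A tangent vector orthogonal to the tangent plane vanishes, as the first
    fundamental form is nondegenerate. *)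
Lemma span_orth0 (x y w : 'rV[R]_4) (a b : R) :
  mink x x * mink y y - mink x y ^+ 2 != 0 -> w = a *: x + b *: y ->
  mink w x = 0 -> mink w y = 0 -> w = 0.
Proof.
move=> D0 Ew; rewrite Ew !minkE (minkC y x) => H1 H2.
have a0 : a = 0.
  apply: (mulIf D0); rewrite mul0r.
  rewrite (_ : a * _ = mink y y * (a * mink x x + b * mink x y)
     - mink x y * (a * mink x y + b * mink y y)); last by ring.
  by rewrite H1 H2 !mulr0 subrr.
have b0 : b = 0.
  apply: (mulIf D0); rewrite mul0r.
  rewrite (_ : b * _ = mink x x * (a * mink x y + b * mink y y)
     - mink x y * (a * mink x x + b * mink x y)); last by ring.
  by rewrite H1 H2 !mulr0 subrr.
by rewrite a0 b0 !scale0r addr0.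
Qed.

End MinkCalculus.

Section Patch.
Variables (R : realType).
Implicit Types (f g : R * R -> 'rV[R]_4) (U : set (R * R)).

Lemma field_e1 f : field f (cst e1) = xu f.
Proof. by apply/funext => q; rewrite /field /= fst_e1 snd_e1 scale1r scale0r addr0. Qed.
Lemma field_e2 f : field f (cst e2) = xv f.
Proof. by apply/funext => q; rewrite /field /= fst_e2 snd_e2 scale1r scale0r add0r. Qed.

Lemma nproj_comb0 f q (l m n : R) (A B C : 'rV[R]_4) :
  l *: nproj f q A - m *: nproj f q B + n *: nproj f q C = 0 ->
  exists a b, l *: A - m *: B + n *: C = a *: xu f q + b *: xv f q.
Proof.
rewrite /nproj.
have [a1 [a2 ->]] := tproj_tangent f q A.
have [b1 [b2 ->]] := tproj_tangent f q B.
have [c1 [c2 ->]] := tproj_tangent f q C.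
move: (xu f q) (xv f q) => X Y H.
exists (l * a1 - m * b1 + n * c1), (l * a2 - m * b2 + n * c2).
apply/rowP => j; move/rowP/(_ j): H; rewrite !mxE => H.
by apply/eqP; rewrite -subr_eq0 -[X in _ == X]H; apply/eqP; ring.
Qed.

(** The combination on the left is gram f q times g^ij f_ij, and the normal
    part of g^ij f_ij is the trace of sigma. *)
Lemma mean_curvature0_tangent f q : gram f q != 0 -> mean_curvature f q = 0 ->
  exists a b, GG f q *: 'D_e1 (xu f) q - (2 * FF f q) *: 'D_e1 (xv f) q
     + EE f q *: 'D_e2 (xv f) q = a *: xu f q + b *: xv f q.
Proof.
move=> D0; rewrite /mean_curvature /sff /nabla field_e1 field_e2 => /eqP.
rewrite !scaler_eq0 !invr_eq0 pnatr_eq0 (negbTE D0) /= => /eqP.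
exact: nproj_comb0.
Qed.

Lemma smooth_xu U f : smooth_on U f -> smooth_on U (xu f).
Proof. exact: smooth_D1. Qed.
Lemma smooth_xv U f : smooth_on U f -> smooth_on U (xv f).
Proof. exact: smooth_D2. Qed.

Lemma is_derive_xuu U f q : smooth_on U f -> U q -> is_derive q e1 (xu f) ('D_e1 (xu f) q).
Proof. by move=> /smooth_xu sf Uq; apply: derivableP; have [] := smooth_derivable sf Uq. Qed.
Lemma is_derive_xuv U f q : smooth_on U f -> U q -> is_derive q e1 (xv f) ('D_e1 (xv f) q).
Proof. by move=> /smooth_xv sf Uq; apply: derivableP; have [] := smooth_derivable sf Uq. Qed.
Lemma is_derive_xvv U f q : smooth_on U f -> U q -> is_derive q e2 (xv f) ('D_e2 (xv f) q).
Proof. by move=> /smooth_xv sf Uq; apply: derivableP; have [] := smooth_derivable sf Uq. Qed.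
Lemma is_derive_xvu U f q : open U -> smooth_on U f -> U q -> is_derive q e2 (xu f) ('D_e1 (xv f) q).
Proof.
move=> oU sf Uq; rewrite (mixed_partials_eq_rV oU sf Uq).
by apply: derivableP; have [] := smooth_derivable (smooth_xu sf) Uq.
Qed.

Lemma smooth_EE U f : open U -> smooth_on U f -> smooth_on U (EE f).
Proof. by move=> oU sf; apply: smooth_mink => //; exact: smooth_xu. Qed.
Lemma smooth_FF U f : open U -> smooth_on U f -> smooth_on U (FF f).
Proof. by move=> oU sf; apply: smooth_mink => //; [exact: smooth_xu|exact: smooth_xv]. Qed.
Lemma smooth_GG U f : open U -> smooth_on U f -> smooth_on U (GG f).
Proof. by move=> oU sf; apply: smooth_mink => //; exact: smooth_xv. Qed.
Lemma smooth_gram U f : open U -> smooth_on U f -> smooth_on U (gram f).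
Proof.
move=> oU sf; have sE := smooth_EE oU sf; have sF := smooth_FF oU sf.
have sG := smooth_GG oU sf.
exact: (smoothB oU (smoothM oU sE sG) (smoothM oU sF sF)).
Qed.

(** For E, F, G and their derivatives computed from x1 = f_u, x2 = f_v, and w
    with w^2 (E G - F^2) = 1: the difference of the two sides is tangent by
    the hypothesis on the second derivatives, and orthogonal to x1 and x2 by
    direct computation, so [span_orth0] applies. *)
Lemma star_closed_alg (x1 x2 x11 x12 x22 : 'rV[R]_4) (w w1 w2 a b : R) :
  let E := mink x1 x1 in let F := mink x1 x2 in let G := mink x2 x2 in
  let D := E * G - F ^+ 2 in
  let E1 := 2 * mink x11 x1 in let E2 := 2 * mink x12 x1 in
  let F1 := mink x11 x2 + mink x1 x12 in let F2 := mink x12 x2 + mink x1 x22 in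
  let G1 := 2 * mink x12 x2 in let G2 := 2 * mink x22 x2 in
  D != 0 ->
  2 * w1 * D = - w * (E1 * G + E * G1 - 2 * F * F1) ->
  2 * w2 * D = - w * (E2 * G + E * G2 - 2 * F * F2) ->
  G *: x11 - (2 * F) *: x12 + E *: x22 = a *: x1 + b *: x2 ->
  w1 *: (G *: x1 - F *: x2) + w *: ((G1 *: x1 + G *: x11) - (F1 *: x2 + F *: x12)) =
  w2 *: (F *: x1 - E *: x2) + w *: ((F2 *: x1 + F *: x12) - (E2 *: x2 + E *: x22)).
Proof.
move=> E F G D E1 E2 F1 F2 G1 G2 D0 H1 H2 T; apply/eqP; rewrite -subr_eq0; apply/eqP.
set Z := _ - _.
have EZ : Z = (w1 * G + w * G1 - w2 * F - w * F2 + w * a) *: x1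
  + (- w1 * F - w * F1 + w2 * E + w * E2 + w * b) *: x2.
  apply/rowP => j; move/rowP/(_ j): T; rewrite /Z !mxE => T.
  by apply/eqP; rewrite -subr_eq0; apply/eqP;
   transitivity (w * ((G * x11 0 j - 2 * F * x12 0 j + E * x22 0 j) - (a * x1 0 j + b * x2 0 j)));
    [ring | rewrite T subrr mulr0].
apply: (span_orth0 D0 EZ).
  rewrite /Z !minkE  (minkC x2 x1) -/E -/F.
  transitivity (2^-1 * (2 * w1 * D - (- w * (E1 * G + E * G1 - 2 * F * F1)))); last by rewrite H1 subrr mulr0.
  rewrite /D /E1 /E2 /F1 /F2 /G1 -/E -/F -/G (minkC x1 x12) (minkC x1 x22).
  by rewrite /E /F /G; field.
rewrite /Z !minkE -/G -/F.
transitivity (2^-1 * (2 * w2 * D - (- w * (E2 * G + E * G2 - 2 * F * F2)))); last by rewrite H2 subrr mulr0.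
rewrite /D /E1 /E2 /F1 /F2 /G1 /G2 -/E -/F -/G (minkC x1 x12) (minkC x1 x22).
by rewrite /E /F /G; field.
Qed.

End Patch.

(** * Closedness of the conjugate differential on a minimal surface *)

Section Star.
Variables (R : realType).
Implicit Types (f g : R * R -> 'rV[R]_4) (U W : set (R * R)).

(** With [starQ], the coefficients of the form *df = starP du + starQ dv,
    where * is the Hodge operator of the induced metric. *)
Definition starP f q := (Num.sqrt (gram f q))^-1 *: (FF f q *: xu f q - EE f q *: xv f q).
Definition starQ f q := (Num.sqrt (gram f q))^-1 *: (GG f q *: xu f q - FF f q *: xv f q).

Lemma is_derive_eq_open (V : normedModType R) U (F G : R * R -> V) q v dF dG :
  open U -> {in U, F =1 G} -> U q -> is_derive q v F dF -> is_derive q v G dG -> dF = dG.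
Proof.
move=> oU FG Uq HF HG; rewrite -(derive_val (is_derive := HF)) -(derive_val (is_derive := HG)).
by apply: near_eq_derive; exact: near_open oU FG Uq.
Qed.

Lemma is_derive_sub (V : normedModType R) (F G : R * R -> V) q v dF dG :
  is_derive q v F dF -> is_derive q v G dG ->
  is_derive q v (fun z => F z - G z) (dF - dG).
Proof. by move=> HF HG; exact: is_deriveB HF HG. Qed.

Lemma is_derive_EE1 U f q : smooth_on U f -> U q ->
  is_derive q e1 (EE f) (2 * mink ('D_e1 (xu f) q) (xu f q)).
Proof.
move=> sf Uq; have D := is_derive_xuu sf Uq.
by apply: (is_derive_eq (is_derive_mink D D)); rewrite (minkC (xu f q)); ring.
Qed.
Lemma is_derive_EE2 U f q : open U -> smooth_on U f -> U q ->
  is_derive q e2 (EE f) (2 * mink ('D_e1 (xv f) q) (xu f q)).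
Proof.
move=> oU sf Uq; have D := is_derive_xvu oU sf Uq.
by apply: (is_derive_eq (is_derive_mink D D)); rewrite (minkC (xu f q)); ring.
Qed.
Lemma is_derive_FF1 U f q : smooth_on U f -> U q ->
  is_derive q e1 (FF f) (mink ('D_e1 (xu f) q) (xv f q) + mink (xu f q) ('D_e1 (xv f) q)).
Proof.
by move=> sf Uq; exact: (is_derive_mink (is_derive_xuu sf Uq) (is_derive_xuv sf Uq)).
Qed.
Lemma is_derive_FF2 U f q : open U -> smooth_on U f -> U q ->
  is_derive q e2 (FF f) (mink ('D_e1 (xv f) q) (xv f q) + mink (xu f q) ('D_e2 (xv f) q)).
Proof.
by move=> oU sf Uq; exact: (is_derive_mink (is_derive_xvu oU sf Uq) (is_derive_xvv sf Uq)).
Qed.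
Lemma is_derive_GG1 U f q : smooth_on U f -> U q ->
  is_derive q e1 (GG f) (2 * mink ('D_e1 (xv f) q) (xv f q)).
Proof.
move=> sf Uq; have D := is_derive_xuv sf Uq.
by apply: (is_derive_eq (is_derive_mink D D)); rewrite (minkC (xv f q)); ring.
Qed.
Lemma is_derive_GG2 U f q : smooth_on U f -> U q ->
  is_derive q e2 (GG f) (2 * mink ('D_e2 (xv f) q) (xv f q)).
Proof.
move=> sf Uq; have D := is_derive_xvv sf Uq.
by apply: (is_derive_eq (is_derive_mink D D)); rewrite (minkC (xv f q)); ring.
Qed.

Lemma is_derive_gram f q v (dE dF dG : R) :
  is_derive q v (EE f) dE -> is_derive q v (FF f) dF -> is_derive q v (GG f) dG ->
  is_derive q v (gram f) (dE * GG f q + EE f q * dG - 2 * FF f q * dF).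
Proof.
move=> HE HF HG.
have H := is_deriveB (is_deriveM HE HG) (is_deriveX 2 HF).
apply: (is_derive_eq H); rewrite /GRing.scale /= expr1; ring.
Qed.

(** Differentiate w^2 gram f = 1, with w the inverse of the square root. *)
Lemma derive_inv_sqrt_gram f q v (dD dw : R) U :
  open U -> U q -> (forall q, U q -> 0 < gram f q) ->
  is_derive q v (gram f) dD -> is_derive q v (fun z => (Num.sqrt (gram f z))^-1) dw ->
  2 * dw * gram f q = - (Num.sqrt (gram f q))^-1 * dD.
Proof.
move=> oU Uq D0 HD Hw.
have H1 := is_deriveM (is_deriveM Hw Hw) HD.
have H2 := is_derive_cst (1 : R) q v.
have E : {in U, (fun z => (Num.sqrt (gram f z))^-1) * (fun z => (Num.sqrt (gram f z))^-1) * gram f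
   =1 cst 1}.
  move=> z; rewrite inE => Uz /=; rewrite !fctE -invfM -expr2 sqr_sqrtr ?ltW ?D0 //.
  by rewrite mulVf // gt_eqF // D0.
have := is_derive_eq_open oU E Uq H1 H2; rewrite !fctE /GRing.scale /=.
set w := (Num.sqrt _)^-1 => Eq.
have w0 : w != 0 by rewrite invr_eq0 gt_eqF // sqrtr_gt0 D0.
apply: (mulIf w0).
apply/eqP; rewrite -subr_eq0 -[X in _ == X]Eq; apply/eqP; ring.
Qed.

Lemma smooth_inv_sqrt_gram U f : open U -> smooth_on U f -> (forall q, U q -> 0 < gram f q) ->
  smooth_on U (fun z => (Num.sqrt (gram f z))^-1).
Proof.
move=> oU sf D0; apply: smoothV => //.
  by move=> q Uq; rewrite gt_eqF // sqrtr_gt0 D0.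
by apply: smooth_sqrt => //; exact: smooth_gram.
Qed.

Lemma smooth_starP U f : open U -> smooth_on U f -> (forall q, U q -> 0 < gram f q) ->
  smooth_on U (starP f).
Proof.
move=> oU sf D0; apply: smooth_scale => //; first exact: smooth_inv_sqrt_gram.
have := smoothD oU (smooth_scale oU (smooth_FF oU sf) (smooth_xu sf))
  (smooth_scale oU (smoothN oU (smooth_EE oU sf)) (smooth_xv sf)).
apply: smooth_eq => // q _; by rewrite scaleNr.
Qed.

Lemma smooth_starQ U f : open U -> smooth_on U f -> (forall q, U q -> 0 < gram f q) ->
  smooth_on U (starQ f).
Proof.
move=> oU sf D0; apply: smooth_scale => //; first exact: smooth_inv_sqrt_gram.
have := smoothD oU (smooth_scale oU (smooth_GG oU sf) (smooth_xu sf))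
  (smooth_scale oU (smoothN oU (smooth_FF oU sf)) (smooth_xv sf)).
apply: smooth_eq => // q _; by rewrite scaleNr.
Qed.

(** The identity d *df = 2 H dA, where the mean curvature vector H vanishes. *)
Lemma star_closed U f q : open U -> smooth_on U f -> (forall q, U q -> 0 < gram f q) ->
  U q -> (exists a b, GG f q *: 'D_e1 (xu f) q - (2 * FF f q) *: 'D_e1 (xv f) q
     + EE f q *: 'D_e2 (xv f) q = a *: xu f q + b *: xv f q) ->
  'D_e2 (starP f) q = 'D_e1 (starQ f) q.
Proof.
move=> oU sf D0 Uq [a [b T]].
have HE1 := is_derive_EE1 sf Uq; have HE2 := is_derive_EE2 oU sf Uq.
have HF1 := is_derive_FF1 sf Uq; have HF2 := is_derive_FF2 oU sf Uq.
have HG1 := is_derive_GG1 sf Uq; have HG2 := is_derive_GG2 sf Uq.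
have [/derivableP Hw1 /derivableP Hw2] := smooth_derivable (smooth_inv_sqrt_gram oU sf D0) Uq.
have K1 := derive_inv_sqrt_gram oU Uq D0 (is_derive_gram HE1 HF1 HG1) Hw1.
have K2 := derive_inv_sqrt_gram oU Uq D0 (is_derive_gram HE2 HF2 HG2) Hw2.
have Du1 := is_derive_xuu sf Uq; have Dv1 := is_derive_xuv sf Uq.
have Du2 := is_derive_xvu oU sf Uq; have Dv2 := is_derive_xvv sf Uq.
have HP := is_derive_scale Hw2 (is_derive_sub (is_derive_scale HF2 Du2) (is_derive_scale HE2 Dv2)).
have HQ := is_derive_scale Hw1 (is_derive_sub (is_derive_scale HG1 Du1) (is_derive_scale HF1 Dv1)).
have D0q : gram f q != 0 by rewrite gt_eqF // D0.
have EP : 'D_e2 (starP f) q = _ := derive_val (is_derive := HP).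
have EQ : 'D_e1 (starQ f) q = _ := derive_val (is_derive := HQ).
apply: etrans EP _; apply: etrans _ (esym EQ).
have := star_closed_alg D0q K1 K2 T.
move=> S; exact: esym S.
Qed.

(** The derivatives of E = G and F = 0 in u and in v. *)
Lemma iso_relations_alg (x1 x2 x11 x12 x22 : 'rV[R]_4) :
  2 * mink x11 x1 = 2 * mink x12 x2 -> 2 * mink x12 x1 = 2 * mink x22 x2 ->
  mink x11 x2 + mink x1 x12 = 0 -> mink x12 x2 + mink x1 x22 = 0 ->
  [/\ mink x11 x1 = mink x12 x2, mink x11 x2 = - mink x12 x1,
      mink x22 x1 = - mink x12 x2 & mink x22 x2 = mink x12 x1].
Proof.
have n2 : (2 : R) != 0 by rewrite pnatr_eq0.
move=> A B C D; split.
- exact: (mulfI n2 A).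
- by rewrite (minkC x12); apply/eqP; rewrite -addr_eq0 C.
- by rewrite (minkC x22); apply/eqP; rewrite -addr_eq0 addrC D.
- exact/esym/(mulfI n2 B).
Qed.

Lemma iso_relations W g w : open W -> smooth_on W g -> isothermal g W -> W w ->
  [/\ mink ('D_e1 (xu g) w) (xu g w) = mink ('D_e1 (xv g) w) (xv g w),
      mink ('D_e1 (xu g) w) (xv g w) = - mink ('D_e1 (xv g) w) (xu g w),
      mink ('D_e2 (xv g) w) (xu g w) = - mink ('D_e1 (xv g) w) (xv g w) &
      mink ('D_e2 (xv g) w) (xv g w) = mink ('D_e1 (xv g) w) (xu g w)].
Proof.
move=> oW sg iso Ww.
have EG : {in W, EE g =1 GG g} by move=> z; rewrite inE => /iso[].
have F0 : {in W, FF g =1 cst 0} by move=> z; rewrite inE => /iso[].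
have A := is_derive_eq_open oW EG Ww (is_derive_EE1 sg Ww) (is_derive_GG1 sg Ww).
have B := is_derive_eq_open oW EG Ww (is_derive_EE2 oW sg Ww) (is_derive_GG2 sg Ww).
have C := is_derive_eq_open oW F0 Ww (is_derive_FF1 sg Ww) (is_derive_cst (0 : R) w e1).
have D := is_derive_eq_open oW F0 Ww (is_derive_FF2 oW sg Ww) (is_derive_cst (0 : R) w e2).
exact: iso_relations_alg A B C D.
Qed.

End Star.

(** * Second derivatives under a change of coordinates *)

Section ChangeAlgebra.
Variables (R : realType).

(** With old derivatives x_i and new derivatives y_i: the rows (h1, h2) and
    (P, Q) of the Jacobian matrix are dh and *dh, orthogonal and of equal
    length for the metric on forms. Solving for the metric in the new
    coordinates gives the claim. *)
Lemma isothermal_alg (x1 x2 y1 y2 : 'rV[R]_4) (h1 h2 P Q w : R) :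
  let E := mink x1 x1 in let F := mink x1 x2 in let G := mink x2 x2 in
  x1 = h1 *: y1 + P *: y2 -> x2 = h2 *: y1 + Q *: y2 ->
  P = w * (F * h1 - E * h2) -> Q = w * (G * h1 - F * h2) ->
  w ^+ 2 * (E * G - F ^+ 2) = 1 -> h1 * Q - h2 * P != 0 ->
  mink y1 y1 = mink y2 y2 /\ mink y1 y2 = 0.
Proof.
move=> E F G X1 X2 EP EQ w2 J0.
have EE : E = h1 ^+ 2 * mink y1 y1 + 2 * h1 * P * mink y1 y2 + P ^+ 2 * mink y2 y2.
  by rewrite /E X1 !minkE (minkC y2 y1); ring.
have EF : F = h1 * h2 * mink y1 y1 + (h1 * Q + h2 * P) * mink y1 y2 + P * Q * mink y2 y2.
  by rewrite /F X1 X2 !minkE (minkC y2 y1); ring.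
have EG : G = h2 ^+ 2 * mink y1 y1 + 2 * h2 * Q * mink y1 y2 + Q ^+ 2 * mink y2 y2.
  by rewrite /G X2 !minkE (minkC y2 y1); ring.
clearbody E F G; move: (mink y1 y1) (mink y1 y2) (mink y2 y2) EE EF EG => e m n EE EF EG.
have J20 : (h1 * Q - h2 * P) ^+ 2 != 0 by rewrite expf_neq0.
have e1 : (h1 * Q - h2 * P) ^+ 2 * e = Q ^+ 2 * E - 2 * P * Q * F + P ^+ 2 * G.
  by rewrite EE EF EG; ring.
have n1 : (h1 * Q - h2 * P) ^+ 2 * n = h2 ^+ 2 * E - 2 * h1 * h2 * F + h1 ^+ 2 * G.
  by rewrite EE EF EG; ring.
have m1 : (h1 * Q - h2 * P) ^+ 2 * m = - h2 * Q * E + (h1 * Q + h2 * P) * F - h1 * P * G.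
  by rewrite EE EF EG; ring.
split; apply: (mulfI J20).
  rewrite e1 n1; clear - w2 EP EQ.
  transitivity (w ^+ 2 * (E * G - F ^+ 2) * (h2 ^+ 2 * E - 2 * h1 * h2 * F + h1 ^+ 2 * G)).
    by rewrite EP EQ; ring.
  by rewrite w2 mul1r.
by rewrite mulr0 m1 EP EQ; ring.
Qed.

(** The combination G x11 - 2 F x12 + E x22 is invariant, up to a factor and
    tangent vectors. In isothermal coordinates it is a multiple of y11 + y22,
    so y11 + y22 is tangent; the hypotheses on the products make it orthogonal
    to the tangent plane. *)
Lemma harmonic_alg (x1 x2 x11 x12 x22 y1 y2 y11 y12 y22 : 'rV[R]_4)
  (h1 h2 P Q a b s11 t11 s12 t12 s22 t22 : R) :
  let E := mink x1 x1 in let F := mink x1 x2 in let G := mink x2 x2 in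
  x1 = h1 *: y1 + P *: y2 -> x2 = h2 *: y1 + Q *: y2 ->
  h1 * Q - h2 * P != 0 -> 0 < mink y1 y1 ->
  mink y1 y1 = mink y2 y2 -> mink y1 y2 = 0 ->
  x11 = s11 *: y1 + t11 *: y2 + (h1 ^+ 2 *: y11 + (2 * h1 * P) *: y12 + P ^+ 2 *: y22) ->
  x12 = s12 *: y1 + t12 *: y2 + ((h1 * h2) *: y11 + (h1 * Q + h2 * P) *: y12 + (P * Q) *: y22) ->
  x22 = s22 *: y1 + t22 *: y2 + (h2 ^+ 2 *: y11 + (2 * h2 * Q) *: y12 + Q ^+ 2 *: y22) ->
  G *: x11 - (2 * F) *: x12 + E *: x22 = a *: x1 + b *: x2 ->
  mink y11 y1 = mink y12 y2 -> mink y11 y2 = - mink y12 y1 ->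
  mink y22 y1 = - mink y12 y2 -> mink y22 y2 = mink y12 y1 ->
  y11 + y22 = 0.
Proof.
move=> E F G X1 X2 J0 e0 en m0 X11 X12 X22 T I1 I2 I3 I4.
have EE : E = (h1 ^+ 2 + P ^+ 2) * mink y1 y1.
  by rewrite /E X1 !minkE (minkC y2 y1) m0 -en; ring.
have EF : F = (h1 * h2 + P * Q) * mink y1 y1.
  by rewrite /F X1 X2 !minkE (minkC y2 y1) m0 -en; ring.
have EG : G = (h2 ^+ 2 + Q ^+ 2) * mink y1 y1.
  by rewrite /G X2 !minkE (minkC y2 y1) m0 -en; ring.
have D0 : mink y1 y1 * mink y2 y2 - mink y1 y2 ^+ 2 != 0.
  by rewrite m0 -en expr0n subr0 mulf_neq0 // gt_eqF.
clearbody E F G.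
pose J2 := (h1 * Q - h2 * P) ^+ 2 * mink y1 y1.
have J20 : J2 != 0 by rewrite mulf_neq0 ?expf_neq0 // gt_eqF.
have S : y11 + y22 = ((a * h1 + b * h2 - G * s11 + 2 * F * s12 - E * s22) / J2) *: y1 +
   ((a * P + b * Q - G * t11 + 2 * F * t12 - E * t22) / J2) *: y2.
  apply/rowP => j; move/rowP/(_ j): T; rewrite X11 X12 X22 X1 X2 !mxE EE EF EG => T.
  apply: (mulfI J20); apply/eqP; rewrite -subr_eq0; apply/eqP.
  move/eqP: T; rewrite -subr_eq0 => /eqP <-; rewrite /J2.
  by field; rewrite J0 gt_eqF.
apply: (span_orth0 D0 S).
  by rewrite minkDl I1 I3 subrr.
by rewrite minkDl I2 I4 addNr.
Qed.

Lemma change_second_alg (y1 y2 y11 y12 y21 y22 : 'rV[R]_4) (a b da db p1 p2 : R) :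
  y21 = y12 ->
  (da *: y1 + a *: (p1 *: y11 + p2 *: y21)) + (db *: y2 + b *: (p1 *: y12 + p2 *: y22)) =
  da *: y1 + db *: y2 + ((a * p1) *: y11 + (a * p2 + b * p1) *: y12 + (b * p2) *: y22).
Proof. by move=> ->; apply/rowP => j; rewrite !mxE; ring. Qed.

End ChangeAlgebra.

Section Change.
Variables (R : realType).

Variables (f g : R * R -> 'rV[R]_4) (B W : set (R * R)) (k1 k2 : R * R -> R).
Hypotheses (oB : open B) (oW : open W) (sf : smooth_on B f) (sg : smooth_on W g)
  (kW : forall z, B z -> W (k1 z, k2 z)) (fg : forall z, B z -> f z = g (k1 z, k2 z)).

Lemma derive_change z v p1 p2 : B z -> is_derive z v k1 p1 -> is_derive z v k2 p2 ->
  'D_v f z = p1 *: xu g (k1 z, k2 z) + p2 *: xv g (k1 z, k2 z).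
Proof.
move=> Bz d1 d2.
have H := is_derive_comp_rV oW sg (kW Bz) d1 d2.
rewrite -[RHS](derive_val (is_derive := H)).
apply: near_eq_derive; apply: near_open oB _ Bz => w; rewrite inE; exact: fg.
Qed.

(** One formula for all second derivatives of f = g o (k1, k2): the first ones
    are of the form a g_u o k + b g_v o k by [derive_change]. *)
Lemma is_derive_change_second z v p1 p2 (a b : R * R -> R) da db :
  B z -> is_derive z v k1 p1 -> is_derive z v k2 p2 ->
  is_derive z v a da -> is_derive z v b db ->
  let w := (k1 z, k2 z) in
  is_derive z v (fun z => a z *: xu g (k1 z, k2 z) + b z *: xv g (k1 z, k2 z))
    (da *: xu g w + db *: xv g w + ((a z * p1) *: 'D_e1 (xu g) w +
     (a z * p2 + b z * p1) *: 'D_e1 (xv g) w + (b z * p2) *: 'D_e2 (xv g) w)).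
Proof.
move=> Bz d1 d2 Da Db w.
have Hu := is_derive_comp_rV oW (smooth_xu sg) (kW Bz) d1 d2.
have Hv := is_derive_comp_rV oW (smooth_xv sg) (kW Bz) d1 d2.
have H := is_deriveD (is_derive_scale Da Hu) (is_derive_scale Db Hv).
apply: (is_derive_eq H).
exact: change_second_alg (esym (mixed_partials_eq_rV oW sg (kW Bz))).
Qed.

End Change.

(** * Isothermal coordinates from a harmonic function and its conjugate *)

Section IsothermalChange.
Variables (R : realType).

(** Up to a positive factor, the Jacobian determinant of (h, k) with dk = *dh
    is the square of the length of dh; complete the square. *)
Lemma star_jac_gt0 (E F G h1 h2 w : R) : 0 < E -> 0 < E * G - F ^+ 2 -> 0 < w -> h1 != 0 ->
  0 < h1 * (w * (G * h1 - F * h2)) - h2 * (w * (F * h1 - E * h2)).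
Proof.
move=> E0 D0 w0 h0.
have -> : h1 * (w * (G * h1 - F * h2)) - h2 * (w * (F * h1 - E * h2)) =
  w * (((E * h2 - F * h1) ^+ 2 + (E * G - F ^+ 2) * h1 ^+ 2) / E).
  by field; rewrite gt_eqF.
rewrite mulr_gt0 // divr_gt0 // ltr_wpDl ?sqr_ge0 // mulr_gt0 //.
by rewrite lt_neqAle sqr_ge0 eq_sym sqrf_eq0 h0.
Qed.

Lemma star_jac_neq0 (E F G h1 h2 w P Q : R) : 0 < E -> 0 < E * G - F ^+ 2 -> 0 < w -> h1 != 0 ->
  P = w * (F * h1 - E * h2) -> Q = w * (G * h1 - F * h2) -> h1 * Q - h2 * P != 0.
Proof. by move=> E0 D0 w0 h0 -> ->; apply: lt0r_neq0; exact: star_jac_gt0. Qed.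

Lemma scale_sub_coord (w a b : R) (x y : 'rV[R]_4) i :
  (w *: (a *: x - b *: y)) 0 i = w * (a * x 0 i - b * y 0 i).
Proof. by rewrite !mxE. Qed.

Lemma second_coefs_diag (y y11 y12 y22 : 'rV[R]_4) (h P : R) :
  y + ((h * h) *: y11 + (h * P + P * h) *: y12 + (P * P) *: y22) =
  y + (h ^+ 2 *: y11 + (2 * h * P) *: y12 + P ^+ 2 *: y22).
Proof. by congr (_ + (_ *: _ + _ *: _ + _ *: _)); ring. Qed.

Lemma second_coefs_mixed (y y11 y12 y22 : 'rV[R]_4) (h1 h2 P Q : R) :
  y + ((h2 * h1) *: y11 + (h2 * P + Q * h1) *: y12 + (Q * P) *: y22) =
  y + ((h1 * h2) *: y11 + (h1 * Q + h2 * P) *: y12 + (P * Q) *: y22).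
Proof. by congr (_ + (_ *: _ + _ *: _ + _ *: _)); ring. Qed.

Lemma isothermal_pos (x y1 y2 : 'rV[R]_4) (h P : R) : x = h *: y1 + P *: y2 ->
  mink y1 y1 = mink y2 y2 -> mink y1 y2 = 0 -> 0 < mink x x -> 0 < mink y1 y1.
Proof.
move=> -> en m0; rewrite !minkE (minkC y2) m0 -en.
have -> (e : R) : h * (h * e + P * 0) + P * (h * 0 + P * e) = (h ^+ 2 + P ^+ 2) * e.
  by ring.
by apply: contraTT; rewrite -!leNgt => e0; rewrite mulr_ge0_le0 // addr_ge0 ?sqr_ge0.
Qed.

Variables (f g : R * R -> 'rV[R]_4) (B W : set (R * R)) (k1 k2 : R * R -> R) (i : 'I_4).
Hypotheses (oB : open B) (oW : open W) (sf : smooth_on B f) (sg : smooth_on W g)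
  (kW : forall z, B z -> W (k1 z, k2 z)) (fg : forall z, B z -> f z = g (k1 z, k2 z))
  (kB : forall w, W w -> exists2 z, B z & w = (k1 z, k2 z))
  (E0 : forall z, B z -> 0 < EE f z) (D0 : forall z, B z -> 0 < gram f z)
  (T : forall z, B z -> exists a b, GG f z *: 'D_e1 (xu f) z - (2 * FF f z) *: 'D_e1 (xv f) z
     + EE f z *: 'D_e2 (xv f) z = a *: xu f z + b *: xv f z)
  (h0 : forall z, B z -> xu f z 0 i != 0)
  (dk : forall z, B z ->
    [/\ is_derive z e1 k1 (xu f z 0 i), is_derive z e2 k1 (xv f z 0 i),
        is_derive z e1 k2 (starP f z 0 i) & is_derive z e2 k2 (starQ f z 0 i)]).

(** The rows of the Jacobian matrix are dh and *dh, by the choice of k1 and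
    k2, so [isothermal_alg] applies in every point. *)
Lemma star_change z : B z ->
  let w := (k1 z, k2 z) in let h1 := xu f z 0 i in let h2 := xv f z 0 i in
  let P := starP f z 0 i in let Q := starQ f z 0 i in
  [/\ xu f z = h1 *: xu g w + P *: xv g w, xv f z = h2 *: xu g w + Q *: xv g w,
      mink (xu g w) (xu g w) = mink (xv g w) (xv g w) /\ mink (xu g w) (xv g w) = 0,
      0 < mink (xu g w) (xu g w) & h1 * Q - h2 * P != 0].
Proof.
move=> Bz w h1 h2 P Q; have [a1 a2 b1 b2] := dk Bz.
have X1 : xu f z = h1 *: xu g w + P *: xv g w := derive_change oB oW sg kW fg Bz a1 b1.
have X2 : xv f z = h2 *: xu g w + Q *: xv g w := derive_change oB oW sg kW fg Bz a2 b2.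
pose wi := (Num.sqrt (gram f z))^-1.
have EP : P = wi * (FF f z * h1 - EE f z * h2) by exact: scale_sub_coord.
have EQ : Q = wi * (GG f z * h1 - FF f z * h2) by exact: scale_sub_coord.
have wi0 : 0 < wi by rewrite invr_gt0 sqrtr_gt0 D0.
have w2 : wi ^+ 2 * gram f z = 1.
  by rewrite /wi exprVn sqr_sqrtr ?ltW ?D0 // mulVf // gt_eqF // D0.
have J0 : h1 * Q - h2 * P != 0.
  by rewrite gt_eqF // EP EQ; apply: star_jac_gt0 (h0 Bz); [exact: E0|exact: D0|].
have [en m0] := isothermal_alg X1 X2 EP EQ w2 J0.
by split; [exact: X1|exact: X2|split|exact: isothermal_pos X1 en m0 (E0 Bz)|exact: J0].
Qed.

Lemma star_isothermal : isothermal g W.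
Proof. by move=> _ /kB[z Bz ->]; have [_ _ c _ _] := star_change Bz; exact: c. Qed.

Lemma star_EE w : W w -> 0 < EE g w.
Proof. by move=> /kB[z Bz ->]; have [_ _ _ c _] := star_change Bz; exact: c. Qed.

Lemma star_change_second z : B z -> let w := (k1 z, k2 z) in
  let h1 := xu f z 0 i in let h2 := xv f z 0 i in
  let P := starP f z 0 i in let Q := starQ f z 0 i in
  exists s11 t11 s12 t12 s22 t22 : R, [/\
  'D_e1 (xu f) z = s11 *: xu g w + t11 *: xv g w + (h1 ^+ 2 *: 'D_e1 (xu g) w +
     (2 * h1 * P) *: 'D_e1 (xv g) w + P ^+ 2 *: 'D_e2 (xv g) w),
  'D_e1 (xv f) z = s12 *: xu g w + t12 *: xv g w + ((h1 * h2) *: 'D_e1 (xu g) w +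
     (h1 * Q + h2 * P) *: 'D_e1 (xv g) w + (P * Q) *: 'D_e2 (xv g) w) &
  'D_e2 (xv f) z = s22 *: xu g w + t22 *: xv g w + (h2 ^+ 2 *: 'D_e1 (xu g) w +
     (2 * h2 * Q) *: 'D_e1 (xv g) w + Q ^+ 2 *: 'D_e2 (xv g) w)].
Proof.
move=> Bz w h1 h2 P Q; have [a1 a2 b1 b2] := dk Bz.
have coord1 (F : R * R -> 'rV[R]_4) : smooth_on B F ->
   is_derive z e1 (fun z => F z 0 i) ('D_e1 (fun z => F z 0 i) z).
  by move=> /(smooth_rVP _ oB) /(_ i) sF; exact: is_derive_D1 sF Bz.
have coord2 (F : R * R -> 'rV[R]_4) : smooth_on B F ->
   is_derive z e2 (fun z => F z 0 i) ('D_e2 (fun z => F z 0 i) z).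
  by move=> /(smooth_rVP _ oB) /(_ i) sF; exact: is_derive_D2 sF Bz.
have su := smooth_xu sf; have sv := smooth_xv sf.
have sP := smooth_starP oB sf D0; have sQ := smooth_starQ oB sf D0.
have Xu : {in B, (fun z => xu f z 0 i *: xu g (k1 z, k2 z) + starP f z 0 i *: xv g (k1 z, k2 z)) =1 xu f}.
  move=> y; rewrite inE => By; have [X _ _ _ _] := star_change By; exact: esym X.
have Xv : {in B, (fun z => xv f z 0 i *: xu g (k1 z, k2 z) + starQ f z 0 i *: xv g (k1 z, k2 z)) =1 xv f}.
  move=> y; rewrite inE => By; have [_ X _ _ _] := star_change By; exact: esym X.
have H11 := is_derive_change_second oW sg kW Bz a1 b1 (coord1 _ su) (coord1 _ sP).
have H12 := is_derive_change_second oW sg kW Bz a1 b1 (coord1 _ sv) (coord1 _ sQ).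
have H22 := is_derive_change_second oW sg kW Bz a2 b2 (coord2 _ sv) (coord2 _ sQ).
have R11 := is_derive_eq_open oB Xu Bz H11 (is_derive_xuu sf Bz).
have R12 := is_derive_eq_open oB Xv Bz H12 (is_derive_xuv sf Bz).
have R22 := is_derive_eq_open oB Xv Bz H22 (is_derive_xvv sf Bz).
do 6 eexists; split.
- exact: etrans (esym R11) (second_coefs_diag _ _ _ _ _ _).
- exact: etrans (esym R12) (second_coefs_mixed _ _ _ _ _ _ _ _).
- exact: etrans (esym R22) (second_coefs_diag _ _ _ _ _ _).
Qed.

(** Minimality, expressed in the new coordinates by [star_change_second]; the
    relations between products come from [star_isothermal] on a whole
    neighbourhood. *)
Lemma star_harmonic w : W w -> 'D_e1 (xu g) w + 'D_e2 (xv g) w = 0.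
Proof.
move=> /[dup] Ww /kB[z Bz Ew]; rewrite {}Ew in Ww *.
have [X1 X2 [en m0] e0 J0] := star_change Bz.
have [s11 [t11 [s12 [t12 [s22 [t22 [X11 X12 X22]]]]]]] := star_change_second Bz.
have [a [b Tz]] := T Bz.
have [I1 I2 I3 I4] := iso_relations oW sg star_isothermal Ww.
exact: harmonic_alg X1 X2 J0 e0 en m0 X11 X12 X22 Tz I1 I2 I3 I4.
Qed.

End IsothermalChange.

(** * Light-like directions in the normal plane *)

Section NullNormal.
Variables (R : realType).
Implicit Types (a b c r : 'rV[R]_4).

Definition minor3 a b c (i j k : 'I_4) : R :=
  a 0 i * (b 0 j * c 0 k - b 0 k * c 0 j) - a 0 j * (b 0 i * c 0 k - b 0 k * c 0 i)
  + a 0 k * (b 0 i * c 0 j - b 0 j * c 0 i).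

(** The vector whose product with d is the determinant of (a, b, c, d); the
    sign of the last entry accounts for the signature. *)
Definition cross a b c : 'rV[R]_4 :=
  \row_j (if j == 0 then - minor3 a b c 1 2 3 else if j == 1 then minor3 a b c 0 2 3
          else if j == 2 then - minor3 a b c 0 1 3 else - minor3 a b c 0 1 2).

Definition gram3 a b c : R :=
  mink a a * (mink b b * mink c c - mink b c ^+ 2)
  - mink a b * (mink a b * mink c c - mink b c * mink a c)
  + mink a c * (mink a b * mink b c - mink b b * mink a c).

Lemma cross_orth1 a b c : mink (cross a b c) a = 0.
Proof. by rewrite /mink !mxE /= /minor3; ring. Qed.
Lemma cross_orth2 a b c : mink (cross a b c) b = 0.
Proof. by rewrite /mink !mxE /= /minor3; ring. Qed.
Lemma cross_orth3 a b c : mink (cross a b c) c = 0.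
Proof. by rewrite /mink !mxE /= /minor3; ring. Qed.

Lemma cross_sq a b c : mink (cross a b c) (cross a b c) = - gram3 a b c.
Proof. by rewrite /gram3 /mink !mxE /= /minor3; ring. Qed.

Lemma ord4_ind (P : 'I_4 -> Prop) : P 0 -> P 1 -> P 2 -> P 3 -> forall i, P i.
Proof.
move=> P0 P1 P2 P3 [[|[|[|[|//]]]] lt].
- by rewrite (_ : Ordinal lt = 0) //; exact: val_inj.
- by rewrite (_ : Ordinal lt = 1) //; exact: val_inj.
- by rewrite (_ : Ordinal lt = 2) //; exact: val_inj.
- by rewrite (_ : Ordinal lt = 3) //; exact: val_inj.
Qed.

(** The expansion of r in the frame a, b, c, cross a b c, by Cramer's rule:
    the coefficients are the cofactors of the Gram matrix of a, b, c. *)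
Lemma cross_decomposition a b c r :
  gram3 a b c *: r =
   (mink a r * (mink b b * mink c c - mink b c ^+ 2)
    + mink b r * (mink a c * mink b c - mink a b * mink c c)
    + mink c r * (mink a b * mink b c - mink b b * mink a c)) *: a
   + (mink a r * (mink a c * mink b c - mink a b * mink c c)
    + mink b r * (mink a a * mink c c - mink a c ^+ 2)
    + mink c r * (mink a b * mink a c - mink a a * mink b c)) *: b
   + (mink a r * (mink a b * mink b c - mink b b * mink a c)
    + mink b r * (mink a b * mink a c - mink a a * mink b c)
    + mink c r * (mink a a * mink b b - mink a b ^+ 2)) *: c
   - mink (cross a b c) r *: cross a b c.
Proof.
by apply/rowP; apply: ord4_ind; rewrite !mxE /gram3 /mink !mxE /= /minor3; ring.
Qed.

(** For real pairs (a, b) and (c, d), the complex vector with components a - i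
    c and b - i d is null in signature (1, 1), so the product of the complex
    numbers (a + b) - i (c + d) and (a - b) - i (c - d) is 0, and one of them
    vanishes. *)
Lemma null_pair (a b c d : R) : a ^+ 2 - b ^+ 2 = c ^+ 2 - d ^+ 2 -> a * c - b * d = 0 ->
  (a = b /\ c = d) \/ (a = - b /\ c = - d).
Proof.
move=> H1 H2; have [/andP[/eqP ab /eqP cd]|/nandP nBD] := boolP ((a - b == 0) && (c - d == 0)).
  by left; split; apply/eqP; rewrite -subr_eq0 ?ab ?cd.
have H3 : (a + b) * ((a - b) ^+ 2 + (c - d) ^+ 2) = 0.
  transitivity ((a ^+ 2 - b ^+ 2 - (c ^+ 2 - d ^+ 2)) * (a - b) + 2 * (c - d) * (a * c - b * d)).
    by ring.
  by rewrite H1 H2 subrr mul0r mulr0 addr0.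
have S : 0 < (a - b) ^+ 2 + (c - d) ^+ 2.
  rewrite lt_neqAle addr_ge0 ?sqr_ge0 // andbT eq_sym paddr_eq0 ?sqr_ge0 //.
  by rewrite !sqrf_eq0; apply/nandP.
have A0 : a + b = 0.
  by move/eqP: H3; rewrite mulf_eq0 (gt_eqF S) orbF => /eqP.
right; have Ea : a = - b by apply/eqP; rewrite -addr_eq0 A0.
split=> //; have K1 : (c + d) * (c - d) = 0.
  transitivity (c ^+ 2 - d ^+ 2); first by ring.
  by rewrite -H1 Ea sqrrN subrr.
have K2 : (c + d) * (a - b) = 0.
  transitivity (2 * (a * c - b * d)); last by rewrite H2 mulr0.
  by rewrite Ea; ring.
apply/eqP; rewrite -addr_eq0; move/eqP: K1; rewrite mulf_eq0 => /orP[//|D0].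
move/eqP: K2; rewrite mulf_eq0 => /orP[//|B0].
by case: nBD; rewrite ?D0 ?B0.
Qed.

(** The projection n of the time axis to the normal plane is time-like,
    because the tangent plane is space-like; the cross product m of the
    tangent vectors with n completes the frame. *)
Lemma normal_frame (y1 y2 : 'rV[R]_4) : 0 < mink y1 y1 -> mink y1 y1 = mink y2 y2 ->
  mink y1 y2 = 0 ->
  exists (m n : 'rV[R]_4) (N : R), [/\ 0 < N, mink m m = N, mink n n = - N, mink m n = 0 &
    [/\ mink m y1 = 0, mink m y2 = 0, mink n y1 = 0, mink n y2 = 0 &
    forall r, mink r y1 = 0 -> mink r y2 = 0 -> exists l k : R, r = l *: m + k *: n]].
Proof.
move=> e0 en m0; set e := mink y1 y1 in e0 en.
have e_neq0 : e != 0 by rewrite gt_eqF.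
pose t : 'rV[R]_4 := delta_mx 0 3.
have tE y : mink t y = - y 0 3 by rewrite /mink !mxE /=; ring.
pose n := t + ((y1 0 3 / e) *: y1 + (y2 0 3 / e) *: y2).
pose N := 1 + (y1 0 3 ^+ 2 + y2 0 3 ^+ 2) / e.
have S0 : 0 <= y1 0 3 ^+ 2 + y2 0 3 ^+ 2 by rewrite addr_ge0 ?sqr_ge0.
have N0 : 0 < N by rewrite ltr_pwDl // divr_ge0 // ltW.
have n1 : mink n y1 = 0.
  by rewrite /n !minkE tE (minkC y2) m0 -/e; field.
have n2 : mink n y2 = 0.
  by rewrite /n !minkE tE m0 -en; field.
have nn : mink n n = - N.
  rewrite {2}/n minkDr minkDr !minkZr n1 n2 !mulr0 !addr0 /n !minkE tE !mxE /=.
  rewrite !(minkC _ t) !tE /N; field => //.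
pose M := cross y1 y2 n.
have g3 : gram3 y1 y2 n = - (e ^+ 2 * N).
  by rewrite /gram3 -/e -en m0 (minkC y2) (minkC y1 n) n1 n2 nn; ring.
have MM : mink M M = e ^+ 2 * N by rewrite cross_sq g3 opprK.
exists (e^-1 *: M), n, N; split => //.
- by rewrite minkZl minkZr MM; field.
- by rewrite minkZl cross_orth3 mulr0.
split => //.
- by rewrite minkZl cross_orth1 mulr0.
- by rewrite minkZl cross_orth2 mulr0.
move=> r r1 r2; exists (mink M r / (e * N)), (- (mink n r) / N).
have g0 : gram3 y1 y2 n != 0 by rewrite g3 oppr_eq0 mulf_neq0 ?expf_neq0 // gt_eqF.
apply: (scalerI g0); rewrite cross_decomposition -/M g3.
rewrite (minkC y1 r) (minkC y2 r) r1 r2 -/e -en m0 (minkC y1 n) (minkC y2 n) n1 n2.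
apply/rowP => j; rewrite !mxE -/M; field.
by rewrite e_neq0 gt_eqF.
Qed.

(** The normal parts s of y11 and t of y12 satisfy s.s = t.t and s.t = 0,
    since the relations between the products make the tangential parts
    contribute equally; by [null_pair] they lie on one of the two light-like
    lines. If s = t = 0 either line will do. *)
Lemma null_normal (y1 y2 y11 y12 : 'rV[R]_4) : 0 < mink y1 y1 -> mink y1 y1 = mink y2 y2 ->
  mink y1 y2 = 0 -> mink y11 y1 = mink y12 y2 -> mink y11 y2 = - mink y12 y1 ->
  mink y11 y11 = mink y12 y12 -> mink y11 y12 = 0 ->
  exists n, [/\ n != 0 /\ mink n n = 0, mink n y1 = 0, mink n y2 = 0,
    exists k a b : R, y11 = k *: n + a *: y1 + b *: y2 &
    exists k a b : R, y12 = k *: n + a *: y1 + b *: y2].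
Proof.
move=> e0 en m0 I1 I2 S1 S2.
have [m [n [N [N0 mm nn mn [m1 m2 n1 n2 span]]]]] := normal_frame e0 en m0.
set e := mink y1 y1 in e0 en; have e_neq0 : e != 0 by rewrite gt_eqF.
pose p := mink y12 y2; pose q := mink y12 y1.
pose s := y11 - (p / e) *: y1 + (q / e) *: y2.
pose t := y12 - (q / e) *: y1 - (p / e) *: y2.
have [||a [b Es]] := span s.
- by rewrite /s !minkE I1 (minkC y2) m0 -/e -/p; field.
- by rewrite /s !minkE I2 m0 -en -/q; field.
have [||c [d Et]] := span t.
- by rewrite /t !minkE (minkC y2) m0 -/e -/q; field.
- by rewrite /t !minkE m0 -en -/p; field.
have ss : mink s s = mink t t.
  rewrite /s /t !minkE !(minkC y1 y11) !(minkC y2 y11) !(minkC y1 y12) !(minkC y2 y12).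
  by rewrite I1 I2 S1 -/p -/q -/e -en (minkC y2 y1) m0; field.
have st : mink s t = 0.
  rewrite /s /t !minkE !(minkC y1 y12) !(minkC y2 y12).
  by rewrite I1 I2 S2 -/p -/q -/e -en (minkC y2 y1) m0; field.
have E1 : a ^+ 2 - b ^+ 2 = c ^+ 2 - d ^+ 2.
  have N_neq0 : N != 0 by rewrite gt_eqF.
  apply: (mulfI N_neq0); move: ss; rewrite Es Et !minkE (minkC n m) mn mm nn => ss.
  transitivity (a * (a * N + b * 0) + b * (a * 0 + b * - N)); first by ring.
  by rewrite ss; ring.
have E2 : a * c - b * d = 0.
  have N_neq0 : N != 0 by rewrite gt_eqF.
  apply: (mulfI N_neq0); move: st; rewrite Es Et !minkE (minkC n m) mn mm nn => st.
  by rewrite mulr0 -st; ring.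
have Ey11 : y11 = s + (p / e) *: y1 + (- (q / e)) *: y2.
  by apply/rowP => j; rewrite /s !mxE; ring.
have Ey12 : y12 = t + (q / e) *: y1 + (p / e) *: y2.
  by apply/rowP => j; rewrite /t !mxE; ring.
have [[Ea Ec]|[Ea Ec]] := null_pair E1 E2.
  exists (m + n); split.
  - split; last by rewrite !minkE (minkC n m) mn mm nn; ring.
    apply/eqP => mn0; have : mink (m + n) m = 0 by rewrite mn0 -(scale0r 0) minkZl mul0r.
    by rewrite !minkE (minkC n m) mn mm addr0 => N00; rewrite N00 ltxx in N0.
  - by rewrite minkDl m1 n1 addr0.
  - by rewrite minkDl m2 n2 addr0.
  - by exists b, (p / e), (- (q / e)); rewrite {1}Ey11 Es Ea scalerDr.
  - by exists d, (q / e), (p / e); rewrite {1}Ey12 Et Ec scalerDr.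
exists (n - m); split.
- split; last by rewrite !minkE (minkC n m) mn mm nn; ring.
  apply/eqP => mn0; have : mink (n - m) m = 0 by rewrite mn0 -(scale0r 0) minkZl mul0r.
  rewrite !minkE (minkC n m) mn mm add0r => /eqP; rewrite oppr_eq0 => /eqP N00.
  by rewrite N00 ltxx in N0.
- by rewrite minkDl minkNl m1 n1 subrr.
- by rewrite minkDl minkNl m2 n2 subrr.
- by exists b, (p / e), (- (q / e)); rewrite {1}Ey11 Es Ea; apply/rowP => j; rewrite !mxE; ring.
- by exists d, (q / e), (p / e); rewrite {1}Ey12 Et Ec; apply/rowP => j; rewrite !mxE; ring.
Qed.

End NullNormal.

(** * Second fundamental form on vector fields and degenerate points *)

Section Degenerate.
Variables (R : realType).
Implicit Types (f g : R * R -> 'rV[R]_4) (U : set (R * R)).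

Lemma derive_along U (f : R * R -> R) q v : open U -> smooth_on U f -> U q ->
  is_derive q v f (v.1 * 'D_e1 f q + v.2 * 'D_e2 f q).
Proof.
move=> oU sf Uq; have df := Ck1_differentiable oU (sf 1%N) Uq.
apply: DeriveDef; first exact: diff_derivable.
rewrite (deriveE _ df) (deriveE _ df) (deriveE _ df).
rewrite {1}(basis_decomposition v).
by rewrite linearD !linearZ.
Qed.

Lemma orth_span (n x y w : 'rV[R]_4) (a b : R) : mink n x = 0 -> mink n y = 0 ->
  w = a *: x + b *: y -> mink n w = 0.
Proof. by move=> n1 n2 ->; rewrite minkDr !minkZr n1 n2 !mulr0 addr0. Qed.

Lemma derive_along_rV n U (f : R * R -> 'rV[R]_n) q v : open U -> smooth_on U f -> U q ->
  'D_v f q = v.1 *: 'D_e1 f q + v.2 *: 'D_e2 f q.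
Proof.
move=> oU sf Uq.
suff H : is_derive q v f (v.1 *: 'D_e1 f q + v.2 *: 'D_e2 f q) by exact: (derive_val (is_derive := H)).
apply/is_derive_rV => i.
have [d1 d2] := smooth_derivable sf Uq.
have H := derive_along v oU ((smooth_rVP f oU).1 sf i) Uq.
exact: is_derive_eq H (comb_coord _ _ (derive_coord i d1) (derive_coord i d2)).
Qed.

Lemma nproj_span f q (n : 'rV[R]_4) (k a b : R) : gram f q != 0 ->
  mink n (xu f q) = 0 -> mink n (xv f q) = 0 ->
  nproj f q (k *: n + a *: xu f q + b *: xv f q) = k *: n.
Proof.
rewrite /nproj /tproj /gram /EE /FF /GG.
move: (xu f q) (xv f q) => x y D0 n1 n2.
rewrite !minkE n1 n2 (minkC y x).
apply/rowP => j; rewrite !mxE; field => //.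
Qed.

(** Leibniz' rule: modulo tangent vectors the derivative of a tangent field
    along another one is bilinear in the two fields. *)
Lemma field_derivative_alg (n x y : 'rV[R]_4) (X1 X2 Y1 Y2 Y11 Y12 Y21 Y22 : R)
   (z11 z12 z22 : 'rV[R]_4) (k1 a1 b1 k2 a2 b2 k3 a3 b3 : R) :
  z11 = k1 *: n + a1 *: x + b1 *: y -> z12 = k2 *: n + a2 *: x + b2 *: y ->
  z22 = k3 *: n + a3 *: x + b3 *: y ->
  exists k a b : R,
  X1 *: ((Y11 *: x + Y1 *: z11) + (Y21 *: y + Y2 *: z12)) +
  X2 *: ((Y12 *: x + Y1 *: z12) + (Y22 *: y + Y2 *: z22)) = k *: n + a *: x + b *: y.
Proof.
move=> -> -> ->.
exists (X1 * (Y1 * k1 + Y2 * k2) + X2 * (Y1 * k2 + Y2 * k3)),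
  (X1 * (Y11 + Y1 * a1 + Y2 * a2) + X2 * (Y12 + Y1 * a2 + Y2 * a3)),
  (X1 * (Y21 + Y1 * b1 + Y2 * b2) + X2 * (Y22 + Y1 * b2 + Y2 * b3)).
apply/rowP => j; rewrite !mxE; ring.
Qed.

(** If all second derivatives of f lie in the span of n and the tangent plane,
    so does every nabla X Y, whose normal part is then a multiple of n. *)
Lemma degenerate_of_normal_form f U q (n : 'rV[R]_4) : open U -> smooth_on U f -> U q ->
  gram f q != 0 -> n != 0 -> mink n n = 0 -> mink n (xu f q) = 0 -> mink n (xv f q) = 0 ->
  (exists k a b : R, 'D_e1 (xu f) q = k *: n + a *: xu f q + b *: xv f q) ->
  (exists k a b : R, 'D_e1 (xv f) q = k *: n + a *: xu f q + b *: xv f q) ->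
  (exists k a b : R, 'D_e2 (xv f) q = k *: n + a *: xu f q + b *: xv f q) ->
  degenerate_at f U q.
Proof.
move=> oU sf Uq D0 n0 nn n1 n2 [a1 [b1 [c1 E1]]] [a2 [b2 [c2 E2]]] [a3 [b3 [c3 E3]]].
exists n; split; [|by split|].
  by move=> w [a [b wE]]; exact: orth_span n1 n2 wE.
move=> X Y _ sY.
have /(smooth_pairP _ oU)[sY1 sY2] := sY.
have [/derivableP Y11 /derivableP Y12] := smooth_derivable sY1 Uq.
have [/derivableP Y21 /derivableP Y22] := smooth_derivable sY2 Uq.
have H1 := is_deriveD (is_derive_scale Y11 (is_derive_xuu sf Uq)) (is_derive_scale Y21 (is_derive_xuv sf Uq)).
have H2 := is_deriveD (is_derive_scale Y12 (is_derive_xvu oU sf Uq)) (is_derive_scale Y22 (is_derive_xvv sf Uq)).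
have sF : smooth_on U (field f Y).
  exact: (smoothD oU (smooth_scale oU sY1 (smooth_xu sf)) (smooth_scale oU sY2 (smooth_xv sf))).
have F1 : 'D_e1 (field f Y) q = _ := derive_val (is_derive := H1).
have F2 : 'D_e2 (field f Y) q = _ := derive_val (is_derive := H2).
have DF := derive_along_rV (X q) oU sF Uq.
have DF' := etrans DF (congr2 (fun a b => (X q).1 *: a + (X q).2 *: b) F1 F2).
have [k [a [b E]]] := field_derivative_alg (X q).1 (X q).2 (Y q).1 (Y q).2
  ('D_e1 (fun q => (Y q).1) q) ('D_e2 (fun q => (Y q).1) q)
  ('D_e1 (fun q => (Y q).2) q) ('D_e2 (fun q => (Y q).2) q) E1 E2 E3.
exists k; rewrite /sff /nabla (etrans DF' E).
exact: nproj_span D0 n1 n2.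
Qed.

End Degenerate.

(** * Holomorphic fourth roots *)

Section FourthRoot.
Variables (R : realType).

Lemma complex_sqrt (p r : R) : exists x y : R, x ^+ 2 - y ^+ 2 = p /\ 2 * (x * y) = r.
Proof.
pose m : R := Num.sqrt (p ^+ 2 + r ^+ 2).
have S0 : 0 <= p ^+ 2 + r ^+ 2 by rewrite addr_ge0 ?sqr_ge0.
have m2 : m ^+ 2 = p ^+ 2 + r ^+ 2 by rewrite sqr_sqrtr.
have pm : `|p| <= m.
  by rewrite -sqrtr_sqr; apply: ler_wsqrtr; rewrite lerDl sqr_ge0.
have [pm1 pm2] : - m <= p /\ p <= m by move: pm; rewrite ler_norml => /andP[].
have a0 : 0 <= (m + p) / 2 by lra.
have b0 : 0 <= (m - p) / 2 by lra.
pose x : R := Num.sqrt ((m + p) / 2); pose y : R := Num.sqrt ((m - p) / 2).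
have x2 : x ^+ 2 = (m + p) / 2 by rewrite sqr_sqrtr.
have y2 : y ^+ 2 = (m - p) / 2 by rewrite sqr_sqrtr.
have xy : 2 * (x * y) = `|r|.
  have -> : `|r| = Num.sqrt (r ^+ 2) by rewrite sqrtr_sqr.
  have -> : r ^+ 2 = (2 * (x * y)) ^+ 2.
    rewrite !exprMn x2 y2; apply: (@mulfI _ 4); first by rewrite pnatr_eq0.
    transitivity (4 * (m ^+ 2 - p ^+ 2)); first by rewrite m2; ring.
    by field.
  by rewrite sqrtr_sqr ger0_norm // !mulr_ge0 ?sqrtr_ge0.
have [r0|r0] := leP 0 r.
  exists x, y; split; first by rewrite x2 y2; field.
  by rewrite xy ger0_norm.
exists x, (- y); split; first by rewrite sqrrN x2 y2; field.
by rewrite mulrN mulrN xy ltr0_norm // opprK.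
Qed.

(** With [csqI], the square of the complex function a + i b. *)
Definition csqR (a b : R * R -> R) z := a z ^+ 2 - b z ^+ 2.
Definition csqI (a b : R * R -> R) z := 2 * (a z * b z).

Lemma is_derive_csqR a b q v (da db : R) : is_derive q v a da -> is_derive q v b db ->
  is_derive q v (csqR a b) (2 * (a q * da - b q * db)).
Proof.
move=> Da Db; have H := is_derive_sub (is_deriveX 2 Da) (is_deriveX 2 Db).
by apply: (is_derive_eq H); rewrite /GRing.scale /= !expr1; ring.
Qed.

Lemma is_derive_csqI a b q v (da db : R) : is_derive q v a da -> is_derive q v b db ->
  is_derive q v (csqI a b) (2 * (a q * db + b q * da)).
Proof.
move=> Da Db; have H := is_deriveM (is_derive_cst (2 : R) q v) (is_deriveM Da Db).
by apply: (is_derive_eq H); rewrite /GRing.scale /= mulr0 addr0.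
Qed.

Lemma smooth_csqR U a b : open U -> smooth_on U a -> smooth_on U b -> smooth_on U (csqR a b).
Proof. by move=> oU sa sb; exact: (smoothB oU (smoothM oU sa sa) (smoothM oU sb sb)). Qed.

Lemma smooth_csqI U a b : open U -> smooth_on U a -> smooth_on U b -> smooth_on U (csqI a b).
Proof. by move=> oU sa sb; exact: (smoothM oU (smooth_cst U 2) (smoothM oU sa sb)). Qed.

Lemma sum_sqr_neq0 (a b x y : R) : a ^+ 2 + b ^+ 2 != 0 ->
  a * x - b * y = 0 -> b * x + a * y = 0 -> x = 0 /\ y = 0.
Proof.
move=> S0 H1 H2; split; apply: (mulfI S0); rewrite mulr0.
  transitivity (a * (a * x - b * y) + b * (b * x + a * y)); first by ring.
  by rewrite H1 H2 !mulr0 addr0.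
transitivity (a * (b * x + a * y) - b * (a * x - b * y)); first by ring.
by rewrite H1 H2 !mulr0 subrr.
Qed.

(** A continuous square root of a holomorphic function is holomorphic where it
    does not vanish; here a_j and b_j are the partial derivatives of its real
    and imaginary part. *)
Lemma cauchy_riemann_sqrt (a b a1 a2 b1 b2 : R) : a ^+ 2 + b ^+ 2 != 0 ->
  2 * (a * a1 - b * b1) = 2 * (a * b2 + b * a2) ->
  2 * (a * a2 - b * b2) = - (2 * (a * b1 + b * a1)) ->
  a1 = b2 /\ a2 = - b1.
Proof.
move=> S0 H1 H2; have n2 : (2 : R) != 0 by rewrite pnatr_eq0.
have [|| X Y] := @sum_sqr_neq0 a b (a1 - b2) (a2 + b1) S0.
- apply: (mulfI n2); rewrite mulr0.
  by transitivity (2 * (a * a1 - b * b1) - 2 * (a * b2 + b * a2)); [ring|rewrite H1 subrr].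
- apply: (mulfI n2); rewrite mulr0.
  by transitivity (2 * (a * a2 - b * b2) + 2 * (a * b1 + b * a1)); [ring|rewrite H2 addNr].
by split; apply/eqP; [rewrite -subr_eq0 X|rewrite -addr_eq0 Y].
Qed.

Lemma open_preimage (U W : set (R * R)) (F : R * R -> R * R) : open U -> open W ->
  (forall z, U z -> {for z, continuous F}) -> open (U `&` F @^-1` W).
Proof.
move=> oU oW cF; rewrite openE => z [Uz Wz].
have nU : nbhs z U by exact: open_nbhs_nbhs.
have nW : nbhs z (F @^-1` W) by apply: (cF z Uz); exact: open_nbhs_nbhs.
by apply: filterS2 nU nW => w.
Qed.

Lemma open_neq0 (U : set (R * R)) (h : R * R -> R) : open U ->
  (forall z, U z -> {for z, continuous h}) -> open (U `&` [set z | h z != 0]).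
Proof.
move=> oU ch; rewrite openE => z [Uz hz].
have nU : nbhs z U by exact: open_nbhs_nbhs.
have oN : open [set~ (0 : R)] by apply: closed_openC; exact: closed_eq.
have nW : nbhs z (h @^-1` [set~ 0]).
  by apply: (ch z Uz); apply: open_nbhs_nbhs; split => //; apply/eqP.
by apply: filterS2 nU nW => w Uw hw; split => //; apply/eqP.
Qed.

(** A smooth root is the composite with a local inverse of z |-> z^4 near one
    fourth root of the value at q0; it is holomorphic by
    [cauchy_riemann_sqrt], applied to z^2 and then to z. *)
Lemma holomorphic_fourth_root (U : set (R * R)) (A B : R * R -> R) (q0 : R * R) :
  open U -> U q0 -> smooth_on U A -> smooth_on U B ->
  (forall z, U z -> 'D_e1 A z = 'D_e2 B z /\ 'D_e2 A z = - 'D_e1 B z) ->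
  A q0 ^+ 2 + B q0 ^+ 2 != 0 ->
  exists (V : set (R * R)) (al be : R * R -> R),
   [/\ open V, V `<=` U, V q0, smooth_on V al & smooth_on V be] /\
   forall z, V z -> [/\ csqR al be z ^+ 2 - csqI al be z ^+ 2 = A z,
     2 * (csqR al be z * csqI al be z) = B z,
     al z ^+ 2 + be z ^+ 2 != 0, 'D_e1 al z = 'D_e2 be z & 'D_e2 al z = - 'D_e1 be z].
Proof.
move=> oU Uq sA sB CR AB0.
have [p [r [Ep Er]]] := complex_sqrt (A q0) (B q0).
have [x [y [Ex Ey]]] := complex_sqrt p r.
pose c := csqR fst snd; pose d := csqI fst snd.
pose a4 := csqR c d; pose b4 := csqI c d.
have oT : open [set: R * R] by exact: openT.
have sf := @smooth_fst R setT; have ss := @smooth_snd R setT.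
have sc : smooth_on setT c by exact: smooth_csqR.
have sd : smooth_on setT d by exact: smooth_csqI.
have sa4 : smooth_on setT a4 by exact: smooth_csqR.
have sb4 : smooth_on setT b4 by exact: smooth_csqI.
have Ea4 : a4 (x, y) = A q0 by rewrite /a4 /csqR /c /d /csqR /csqI /= Ex Ey.
have Eb4 : b4 (x, y) = B q0 by rewrite /b4 /csqI /c /d /csqR /csqI /= Ex Ey.
have J0 : jac a4 b4 (x, y) != 0.
  have dc1 := is_derive_csqR (is_derive_fst_e1 (x, y)) (is_derive_snd_e1 (x, y)).
  have dc2 := is_derive_csqR (is_derive_fst_e2 (x, y)) (is_derive_snd_e2 (x, y)).
  have dd1 := is_derive_csqI (is_derive_fst_e1 (x, y)) (is_derive_snd_e1 (x, y)).
  have dd2 := is_derive_csqI (is_derive_fst_e2 (x, y)) (is_derive_snd_e2 (x, y)).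
  have da1 : is_derive (x, y) e1 a4 _ := is_derive_csqR dc1 dd1.
  have da2 : is_derive (x, y) e2 a4 _ := is_derive_csqR dc2 dd2.
  have db1 : is_derive (x, y) e1 b4 _ := is_derive_csqI dc1 dd1.
  have db2 : is_derive (x, y) e2 b4 _ := is_derive_csqI dc2 dd2.
  have -> : jac a4 b4 (x, y) = 16 * (x ^+ 2 + y ^+ 2) ^+ 3.
    rewrite /jac (derive_val (is_derive := da1)) (derive_val (is_derive := da2))
      (derive_val (is_derive := db1)) (derive_val (is_derive := db2)).
    by rewrite /csqR /csqI /=; ring.
  rewrite mulf_neq0 ?pnatr_eq0 // expf_neq0 //.
  apply: contra AB0 => /eqP S; rewrite -Ep -Er -Ex -Ey.
  rewrite (_ : _ + _ = (x ^+ 2 + y ^+ 2) ^+ 4); last by ring.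
  by rewrite S expr0n.
have [V' [W [psi [[oV' _ Vxy oW] [phiP psiP spsi]]]]] := inverse_function oT sa4 sb4 I J0.
pose F z := (A z, B z).
have sF : smooth_on U F by apply/(smooth_pairP _ oU).
have cF z : U z -> {for z, continuous F} by exact: smooth_continuous sF.
have oU1 := open_preimage oU oW cF.
pose N z := A z ^+ 2 + B z ^+ 2.
have sN : smooth_on U N by exact: (smoothD oU (smoothM oU sA sA) (smoothM oU sB sB)).
have cN z : (U `&` F @^-1` W) z -> {for z, continuous N}.
  by move=> [Uz _]; exact: smooth_continuous sN Uz.
pose V := (U `&` F @^-1` W) `&` [set z | N z != 0].
have oV : open V := open_neq0 oU1 cN.
have VU : V `<=` U by move=> z [[]].
have VW z : V z -> W (F z) by move=> [[]].
have sFV := smooth_sub VU sF.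
pose al z := (psi (F z)).1; pose be z := (psi (F z)).2.
have [sal sbe] : smooth_on V al /\ smooth_on V be.
  by apply/(smooth_pairP _ oV); exact: smooth_comp_pair oV oW VW sFV spsi.
have root z : V z -> csqR (csqR al be) (csqI al be) z = A z /\ csqI (csqR al be) (csqI al be) z = B z.
  move=> Vz; have [_ E] := psiP _ (VW z Vz).
  by split; [exact: (congr1 fst E)|exact: (congr1 snd E)].
exists V, al, be; split.
  split => //; split; last exact: AB0.
  split=> //; have [+ _] := phiP _ Vxy; by rewrite /F /= -Ea4 -Eb4.
move=> z Vz; have [RA RB] := root z Vz.
have ABz : A z ^+ 2 + B z ^+ 2 != 0 by case: Vz.
have n0 : al z ^+ 2 + be z ^+ 2 != 0.
  apply: contra ABz => /eqP S; rewrite -RA -RB /csqR /csqI.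
  rewrite (_ : _ + _ = (al z ^+ 2 + be z ^+ 2) ^+ 4); last by ring.
  by rewrite S expr0n.
have n0' : csqR al be z ^+ 2 + csqI al be z ^+ 2 != 0.
  rewrite (_ : _ + _ = (al z ^+ 2 + be z ^+ 2) ^+ 2); last by rewrite /csqR /csqI; ring.
  by rewrite expf_neq0.
have Da1 := is_derive_D1 sal Vz; have Da2 := is_derive_D2 sal Vz.
have Db1 := is_derive_D1 sbe Vz; have Db2 := is_derive_D2 sbe Vz.
have Dc1 := is_derive_csqR Da1 Db1; have Dc2 := is_derive_csqR Da2 Db2.
have Dd1 := is_derive_csqI Da1 Db1; have Dd2 := is_derive_csqI Da2 Db2.
have inA : {in V, csqR (csqR al be) (csqI al be) =1 A} by move=> w; rewrite inE => /root[].
have inB : {in V, csqI (csqR al be) (csqI al be) =1 B} by move=> w; rewrite inE => /root[].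
have Uz := VU z Vz; have [CR1 CR2] := CR z Uz.
have EA1 := is_derive_eq_open oV inA Vz (is_derive_csqR Dc1 Dd1) (is_derive_D1 sA Uz).
have EA2 := is_derive_eq_open oV inA Vz (is_derive_csqR Dc2 Dd2) (is_derive_D2 sA Uz).
have EB1 := is_derive_eq_open oV inB Vz (is_derive_csqI Dc1 Dd1) (is_derive_D1 sB Uz).
have EB2 := is_derive_eq_open oV inB Vz (is_derive_csqI Dc2 Dd2) (is_derive_D2 sB Uz).
have [C1 C2] := cauchy_riemann_sqrt n0' (etrans EA1 (etrans CR1 (esym EB2)))
  (etrans EA2 (etrans CR2 (congr1 -%R (esym EB1)))).
have [C3 C4] := cauchy_riemann_sqrt n0 C1 C2.
by split.
Qed.

End FourthRoot.

(** * Conformal changes of isothermal coordinates *)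

Section FinalAlgebra.
Variables (R : realType).

(** The span of n and the tangent plane does not depend on the coordinates. *)
Lemma normal_form_change (x1 x2 y1 y2 y11 y12 y22 z n : 'rV[R]_4) (h1 h2 P Q s t al be ga : R) :
  x1 = h1 *: y1 + P *: y2 -> x2 = h2 *: y1 + Q *: y2 -> h1 * Q - h2 * P != 0 ->
  y11 + y22 = 0 ->
  (exists k a b : R, y11 = k *: n + a *: y1 + b *: y2) ->
  (exists k a b : R, y12 = k *: n + a *: y1 + b *: y2) ->
  z = s *: y1 + t *: y2 + (al *: y11 + be *: y12 + ga *: y22) ->
  exists k a b : R, z = k *: n + a *: x1 + b *: x2.
Proof.
move=> -> -> J0 /eqP; rewrite addrC addr_eq0 => /eqP -> [k [a [b ->]]] [k' [a' [b' ->]]] ->.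
pose S := s + (al - ga) * a + be * a'; pose T := t + (al - ga) * b + be * b'.
exists ((al - ga) * k + be * k'), ((Q * S - h2 * T) / (h1 * Q - h2 * P)),
  ((h1 * T - P * S) / (h1 * Q - h2 * P)).
by apply/rowP => j; rewrite !mxE /S /T; field.
Qed.

(** The hypotheses read x1 - i x2 = (al + i be) (y1 - i y2), so the complex
    number (y1 - i y2).(y1 - i y2) is that for x divided by (al + i be)^2. *)
Lemma conformal_isothermal_alg (x1 x2 y1 y2 : 'rV[R]_4) (al be : R) :
  x1 = al *: y1 + be *: y2 -> x2 = (- be) *: y1 + al *: y2 -> al ^+ 2 + be ^+ 2 != 0 ->
  0 < mink x1 x1 -> mink x1 x1 = mink x2 x2 -> mink x1 x2 = 0 ->
  [/\ 0 < mink y1 y1, mink y1 y1 = mink y2 y2 & mink y1 y2 = 0].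
Proof.
move=> X1 X2 S0; rewrite X1 X2 !minkE (minkC y2 y1).
move: (mink y1 y1) (mink y1 y2) (mink y2 y2) => e m n H0 H1 H2.
have n2 : (2 : R) != 0 by rewrite pnatr_eq0.
have [||| D0 M0] := @sum_sqr_neq0 R (al ^+ 2 - be ^+ 2) (2 * al * be) (e - n) (- (2 * m)).
- rewrite (_ : _ + _ = (al ^+ 2 + be ^+ 2) ^+ 2); last by ring.
  by rewrite expf_neq0.
- by move/eqP: H1; rewrite -subr_eq0 => /eqP H1; rewrite -[RHS]H1; ring.
- by rewrite -[RHS](mulr0 (- 2)) -H2; ring.
have m0 : m = 0.
  by move/eqP: M0; rewrite oppr_eq0 mulf_eq0 (negbTE n2) => /eqP.
have en : e = n by apply/eqP; rewrite -subr_eq0 D0.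
split=> //; move: H0; rewrite m0 -en.
rewrite (_ : _ + _ = (al ^+ 2 + be ^+ 2) * e); last by ring.
by apply: contraTT; rewrite -!leNgt => e0; rewrite mulr_ge0_le0 // addr_ge0 ?sqr_ge0.
Qed.

Lemma conformal_harmonic_alg (y1 y2 y11 y12 y22 x11 x22 : 'rV[R]_4) (al be a1 a2 b1 b2 : R) :
  x11 = a1 *: y1 + b1 *: y2 +
    ((al * al) *: y11 + (al * be + be * al) *: y12 + (be * be) *: y22) ->
  x22 = (- b2) *: y1 + a2 *: y2 +
    ((- be * - be) *: y11 + (- be * al + al * - be) *: y12 + (al * al) *: y22) ->
  a1 = b2 -> a2 = - b1 -> al ^+ 2 + be ^+ 2 != 0 -> x11 + x22 = 0 -> y11 + y22 = 0.
Proof.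
move=> -> -> -> -> S0 H; apply: (scalerI S0); rewrite scaler0 -[RHS]H.
by apply/rowP => j; rewrite !mxE; ring.
Qed.

(** Write w = al + i be. Modulo y1 - i y2, which is orthogonal to itself and
    to y11 - i y12, one has x11 - i x12 = w^2 (y11 - i y12). Hence the complex
    squares satisfy A + i B = w^4 (A' + i B'), and w^4 = eps (A + i B) with
    eps = 1 or eps = -1 leaves A' + i B' = eps. *)
Lemma canonical_alg (y1 y2 y11 y12 y22 x11 x12 : 'rV[R]_4) (al be a b A B eps : R) :
  x11 = a *: y1 + b *: y2 +
    ((al * al) *: y11 + (al * be + be * al) *: y12 + (be * be) *: y22) ->
  x12 = (- b) *: y1 + a *: y2 +
    ((- be * al) *: y11 + (- be * be + al * al) *: y12 + (al * be) *: y22) ->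
  y11 + y22 = 0 -> mink y1 y1 = mink y2 y2 -> mink y1 y2 = 0 ->
  mink y11 y1 = mink y12 y2 -> mink y11 y2 = - mink y12 y1 ->
  mink x11 x11 - mink x12 x12 = A -> - 2 * mink x11 x12 = B ->
  (al ^+ 2 - be ^+ 2) ^+ 2 - (2 * (al * be)) ^+ 2 = eps * A ->
  2 * ((al ^+ 2 - be ^+ 2) * (2 * (al * be))) = eps * B ->
  al ^+ 2 + be ^+ 2 != 0 -> eps ^+ 2 = 1 ->
  mink y11 y11 - mink y12 y12 = eps /\ mink y11 y12 = 0.
Proof.
move=> X11 X12 /eqP; rewrite addrC addr_eq0 => /eqP Y22 en m0 I1 I2 EA EB RA RB S0 e2.
pose c := al ^+ 2 - be ^+ 2; pose d := 2 * (al * be).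
pose P := c ^+ 2 - d ^+ 2; pose Q := 2 * (c * d).
pose A' := mink y11 y11 - mink y12 y12; pose B' := - 2 * mink y11 y12.
have Z11 : x11 = a *: y1 + b *: y2 + c *: y11 + d *: y12.
  by rewrite X11 Y22; apply/rowP => j; rewrite !mxE /c /d; ring.
have Z12 : x12 = (- b) *: y1 + a *: y2 - d *: y11 + c *: y12.
  by rewrite X12 Y22; apply/rowP => j; rewrite !mxE /c /d; ring.
have MA : A = P * A' - Q * B'.
  rewrite -EA Z11 Z12 !minkE (minkC y2 y1) !(minkC y1 y11) !(minkC y1 y12).
  rewrite !(minkC y2 y11) !(minkC y2 y12) (minkC y12 y11) m0 I1 I2 -en /P /Q /A' /B'.
  ring.
have MB : B = P * B' + Q * A'.
  rewrite -EB Z11 Z12 !minkE (minkC y2 y1) !(minkC y1 y11) !(minkC y1 y12).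
  rewrite !(minkC y2 y11) !(minkC y2 y12) (minkC y12 y11) m0 I1 I2 -en /P /Q /A' /B'.
  ring.
have PA : P = eps * A by [].
have QB : Q = eps * B by [].
have PQ0 : P ^+ 2 + Q ^+ 2 != 0.
  rewrite (_ : _ + _ = (al ^+ 2 + be ^+ 2) ^+ 4); last by rewrite /P /Q /c /d; ring.
  by rewrite expf_neq0.
clearbody P Q.
have eA : A = eps * P by rewrite PA mulrA -expr2 e2 mul1r.
have eB : B = eps * Q by rewrite QB mulrA -expr2 e2 mul1r.
have [|| X Y] := @sum_sqr_neq0 R P Q (A' - eps) B' PQ0.
- transitivity ((P * A' - Q * B') - eps * P); first by ring.
  by rewrite -MA eA subrr.
- transitivity ((P * B' + Q * A') - eps * Q); first by ring.
  by rewrite -MB eB subrr.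
split; first by apply/eqP; rewrite -subr_eq0 -/A' X.
have n2 : (- 2 : R) != 0 by rewrite oppr_eq0 pnatr_eq0.
by apply: (mulfI n2); rewrite mulr0 -/B' Y.
Qed.

End FinalAlgebra.

(** * The Hopf differential and canonical coordinates *)

Section Hopf.
Variables (R : realType).
Implicit Types (f g : R * R -> 'rV[R]_4) (U W : set (R * R)).

(** With [hopfI], the real and imaginary part of Phi'.Phi' for Phi = g_u - i
    g_v. *)
Definition hopfR g z := mink ('D_e1 (xu g) z) ('D_e1 (xu g) z)
                      - mink ('D_e1 (xv g) z) ('D_e1 (xv g) z).
Definition hopfI g z := - 2 * mink ('D_e1 (xu g) z) ('D_e1 (xv g) z).

Lemma smooth_hopf U g : open U -> smooth_on U g ->
  smooth_on U (hopfR g) /\ smooth_on U (hopfI g).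
Proof.
move=> oU sg; have s1 := smooth_D1 (smooth_xu sg); have s2 := smooth_D1 (smooth_xv sg).
split; first exact: (smoothB oU (smooth_mink oU s1 s1) (smooth_mink oU s2 s2)).
exact: (smoothM oU (smooth_cst U (- 2)) (smooth_mink oU s1 s2)).
Qed.

Lemma hopfR_alg (x y a b : 'rV[R]_4) :
  mink a x + mink x a - (mink b y + mink y b) = 2 * (mink a x - mink b y).
Proof. by rewrite (minkC x a) (minkC y b); ring. Qed.

Lemma hopfI_alg (x y a b : 'rV[R]_4) :
  - 2 * (mink a y + mink x b) = - 2 * (mink a y + mink b x).
Proof. by rewrite (minkC x b). Qed.

Lemma is_derive_mulc (c : R) (h : R * R -> R) q v (d : R) : is_derive q v h d ->
  is_derive q v (fun z => c * h z) (c * d).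
Proof.
move=> Hd; apply: (is_derive_eq (is_deriveM (is_derive_cst c q v) Hd)).
by rewrite /GRing.scale /= mulr0 addr0.
Qed.

Lemma is_derive_hopfR g z v (a b : 'rV[R]_4) :
  is_derive z v ('D_e1 (xu g)) a -> is_derive z v ('D_e1 (xv g)) b ->
  is_derive z v (hopfR g) (2 * (mink a ('D_e1 (xu g) z) - mink b ('D_e1 (xv g) z))).
Proof.
move=> Ha Hb; have H := is_derive_sub (is_derive_mink Ha Ha) (is_derive_mink Hb Hb).
exact: is_derive_eq H (hopfR_alg _ _ _ _).
Qed.

Lemma is_derive_hopfI g z v (a b : 'rV[R]_4) :
  is_derive z v ('D_e1 (xu g)) a -> is_derive z v ('D_e1 (xv g)) b ->
  is_derive z v (hopfI g) (- 2 * (mink a ('D_e1 (xv g) z) + mink b ('D_e1 (xu g) z))).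
Proof.
move=> Ha Hb; exact: is_derive_eq (is_derive_mulc (- 2) (is_derive_mink Ha Hb)) (hopfI_alg _ _ _ _).
Qed.

Lemma sum_sqr_eq0 (a b c : R) : (a - b) ^+ 2 + (- 2 * c) ^+ 2 = 0 -> a = b /\ c = 0.
Proof.
move=> /eqP; rewrite paddr_eq0 ?sqr_ge0 // !sqrf_eq0 subr_eq0 mulf_eq0 oppr_eq0 pnatr_eq0 /=.
by move=> /andP[/eqP -> /eqP ->].
Qed.

Lemma sum_sqr_unit (eps a b : R) : eps ^+ 2 = 1 ->
  (eps * a) ^+ 2 + (eps * b) ^+ 2 = a ^+ 2 + b ^+ 2.
Proof. by move=> e2; rewrite !exprMn e2 !mul1r. Qed.

Lemma hopf_alg (x y a b c d : 'rV[R]_4) : d = - a -> c = b ->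
  2 * (mink a x - mink b y) = - 2 * (mink c y + mink d x) /\
  2 * (mink c x - mink d y) = - (- 2 * (mink a y + mink b x)).
Proof. by move=> -> ->; rewrite !minkNl; split; ring. Qed.

(** For harmonic g the second derivatives a = g_uu and b = g_uv satisfy b_u =
    a_v and b_v = - a_u: a - i b is holomorphic, and so is its square. *)
Lemma hopf_cauchy_riemann U g z (eps : R) : open U -> smooth_on U g ->
  (forall w, U w -> 'D_e1 (xu g) w + 'D_e2 (xv g) w = 0) -> U z ->
  'D_e1 (fun z => eps * hopfR g z) z = 'D_e2 (fun z => eps * hopfI g z) z /\
  'D_e2 (fun z => eps * hopfR g z) z = - 'D_e1 (fun z => eps * hopfI g z) z.
Proof.
move=> oU sg harm Uz.
have su := smooth_xu sg; have sv := smooth_xv sg.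
have [/derivableP A1 /derivableP A2] := smooth_derivable (smooth_D1 su) Uz.
have [/derivableP B1 /derivableP B2] := smooth_derivable (smooth_D1 sv) Uz.
have EA2 : 'D_e2 ('D_e1 (xu g)) z = 'D_e1 ('D_e1 (xv g)) z.
  apply: etrans (esym (mixed_partials_eq_rV oU su Uz)) _.
  apply: near_eq_derive; apply: (near_open oU _ Uz) => w; rewrite inE => Uw.
  exact: esym (mixed_partials_eq_rV oU sg Uw).
have EB2 : 'D_e2 ('D_e1 (xv g)) z = - 'D_e1 ('D_e1 (xu g)) z.
  apply: etrans (esym (mixed_partials_eq_rV oU sv Uz)) _.
  have H : {in U, 'D_e2 (xv g) =1 (fun w => - 'D_e1 (xu g) w)}.
    move=> w; rewrite inE => Uw; apply/eqP; rewrite -addr_eq0 addrC; apply/eqP; exact: harm.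
  have [/derivableP D _] := smooth_derivable (smooth_D2 sv) Uz.
  exact: is_derive_eq_open oU H Uz D (is_deriveN A1).
have [C1 C2] := hopf_alg ('D_e1 (xu g) z) ('D_e1 (xv g) z) EB2 EA2.
have R1 := is_derive_mulc eps (is_derive_hopfR A1 B1); have R2 := is_derive_mulc eps (is_derive_hopfR A2 B2).
have I1 := is_derive_mulc eps (is_derive_hopfI A1 B1); have I2 := is_derive_mulc eps (is_derive_hopfI A2 B2).
split.
  apply: etrans (derive_val (is_derive := R1)) (etrans _ (esym (derive_val (is_derive := I2)))).
  exact: congr1 C1.
apply: etrans (derive_val (is_derive := R2)) (etrans _ (congr1 -%R (esym (derive_val (is_derive := I1))))).
by rewrite -mulrN; exact: congr1 C2.
Qed.

End Hopf.

Section Canonical.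
Variables (R : realType).

Lemma nproj_scale_u (f : R * R -> 'rV[R]_4) q (a b : R) (w : 'rV[R]_4) : gram f q != 0 ->
  nproj f q (a *: xu f q + b *: w) = b *: nproj f q w.
Proof.
rewrite /nproj /tproj /gram /EE /FF /GG; move: (xu f q) (xv f q) => x y D0.
rewrite !minkE; apply/rowP => j; rewrite !mxE; field => //.
Qed.

Lemma nproj_scale_v (f : R * R -> 'rV[R]_4) q (a b : R) (w : 'rV[R]_4) : gram f q != 0 ->
  nproj f q (a *: xv f q + b *: w) = b *: nproj f q w.
Proof.
rewrite /nproj /tproj /gram /EE /FF /GG; move: (xu f q) (xv f q) => x y D0.
rewrite !minkE (minkC y x); apply/rowP => j; rewrite !mxE; field => //.
Qed.

Lemma mink_nproj_alg (x y a b : 'rV[R]_4) (E F G : R) :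
  E = mink x x -> F = mink x y -> G = mink y y -> E != 0 -> E = G -> F = 0 ->
  mink (a - (((G * mink a x - F * mink a y) / (E * G - F ^+ 2)) *: x +
             ((E * mink a y - F * mink a x) / (E * G - F ^+ 2)) *: y))
       (b - (((G * mink b x - F * mink b y) / (E * G - F ^+ 2)) *: x +
             ((E * mink b y - F * mink b x) / (E * G - F ^+ 2)) *: y)) =
  mink a b - (mink a x * mink b x + mink a y * mink b y) / E.
Proof.
move=> Ex Fx Gx E0 EG F0; rewrite !minkE -Ex -Gx (minkC y x) -Fx.
rewrite (minkC x b) (minkC y b) -EG F0.
by field.
Qed.

(** In isothermal coordinates g_u and g_v are orthogonal vectors of square E,
    which gives the product of the tangential parts. *)
Lemma mink_nproj_iso (f : R * R -> 'rV[R]_4) q (a b : 'rV[R]_4) : EE f q != 0 ->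
  EE f q = GG f q -> FF f q = 0 ->
  mink (nproj f q a) (nproj f q b) = mink a b -
   (mink a (xu f q) * mink b (xu f q) + mink a (xv f q) * mink b (xv f q)) / EE f q.
Proof. by move=> E0 EG F0; exact: mink_nproj_alg erefl erefl erefl E0 EG F0. Qed.

Lemma gram_iso_neq0 (E F G : R) : 0 < E -> E = G -> F = 0 -> E * G - F ^+ 2 != 0.
Proof. by move=> E0 <- ->; rewrite expr0n subr0 mulf_neq0 // gt_eqF. Qed.

Lemma sqrt_neq0 (E : R) : 0 < E -> Num.sqrt E != 0.
Proof. by move=> E0; rewrite gt_eqF // sqrtr_gt0. Qed.

Lemma inv_sqrtM (E : R) : 0 < E -> (Num.sqrt E)^-1 * (Num.sqrt E)^-1 = E^-1.
Proof. by move=> E0; rewrite -invfM -expr2 sqr_sqrtr // ltW. Qed.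

(** The relations between the products make the corrections for the tangential
    parts cancel, so that normal parts may be replaced by full second
    derivatives. *)
Lemma canonical_final_alg (a b n1 n2 x1 x2 : 'rV[R]_4) (E eps : R) : E != 0 ->
  mink n1 n1 = mink a a - (mink a x1 * mink a x1 + mink a x2 * mink a x2) / E ->
  mink n1 n2 = mink a b - (mink a x1 * mink b x1 + mink a x2 * mink b x2) / E ->
  mink n2 n2 = mink b b - (mink b x1 * mink b x1 + mink b x2 * mink b x2) / E ->
  mink a x1 = mink b x2 -> mink a x2 = - mink b x1 ->
  mink a a - mink b b = eps -> mink a b = 0 ->
  mink (E^-1 *: n1) (E^-1 *: n2) = 0 /\
  E ^+ 2 * (mink (E^-1 *: n1) (E^-1 *: n1) - mink (E^-1 *: n2) (E^-1 *: n2)) = eps.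
Proof.
move=> E0 N11 N12 N22 I1 I2 <- H; rewrite !minkE N11 N12 N22 I1 I2 H.
by split; field.
Qed.

Variables (U : set (R * R)) (f : R * R -> 'rV[R]_4).
Hypotheses (oU : open U) (sf : smooth_on U f) (iso : isothermal f U)
  (E0 : forall q, U q -> 0 < EE f q).

(** Differentiating the factor of the unit fields gives tangent vectors only. *)
Lemma sff_unit_fields q : U q -> sff f (X1 f) (X1 f) q = (EE f q)^-1 *: nproj f q ('D_e1 (xu f) q) /\
  sff f (X1 f) (X2 f) q = (EE f q)^-1 *: nproj f q ('D_e1 (xv f) q).
Proof.
move=> Uq; have [EG F0] := iso Uq; have Eq := E0 Uq.
have D0 : gram f q != 0 := gram_iso_neq0 Eq EG F0.
pose e z := (Num.sqrt (EE f z))^-1.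
have se : smooth_on U e.
  apply: (smoothV oU _ (smooth_sqrt oU E0 (smooth_EE oU sf))) => z /E0 Ez.
  exact: sqrt_neq0 Ez.
have ee : e q * e q = (EE f q)^-1 by exact: inv_sqrtM Eq.
have F1 : field f (X1 f) = fun z => e z *: xu f z.
  by apply/funext => z; rewrite /field /X1 /= scale0r addr0.
have F2 : field f (X2 f) = fun z => e z *: xv f z.
  by apply/funext => z; rewrite /field /X2 /= scale0r add0r.
have [/derivableP de _] := smooth_derivable se Uq.
have H1 := is_derive_scale de (is_derive_xuu sf Uq).
have H2 := is_derive_scale de (is_derive_xuv sf Uq).
have s1 := smooth_scale oU se (smooth_xu sf); have s2 := smooth_scale oU se (smooth_xv sf).
have A (F : R * R -> 'rV[R]_4) dF : smooth_on U F -> is_derive q e1 F dF ->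
    'D_(X1 f q) F q = e q *: dF.
  move=> sF HF; apply: etrans (derive_along_rV _ oU sF Uq) _.
  rewrite /X1 /= scale0r addr0; congr (_ *: _); exact: (derive_val (is_derive := HF)).
have P (F : R * R -> 'rV[R]_4) Y dF : field f Y = F -> smooth_on U F -> is_derive q e1 F dF ->
    sff f (X1 f) Y q = e q *: nproj f q dF.
  move=> EF sF HF; rewrite /sff /nabla EF (A _ _ sF HF).
  by rewrite -(nproj_scale_u 0 (e q) dF D0) scale0r add0r.
split.
  apply: etrans (P _ _ _ F1 s1 H1) _.
  by rewrite (nproj_scale_u _ _ _ D0) scalerA ee.
apply: etrans (P _ _ _ F2 s2 H2) _.
by rewrite (nproj_scale_v _ _ _ D0) scalerA ee.
Qed.

Lemma canonical_of_hopf (eps : R) :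
  (forall q, U q -> mink ('D_e1 (xu f) q) ('D_e1 (xu f) q) -
     mink ('D_e1 (xv f) q) ('D_e1 (xv f) q) = eps /\
     mink ('D_e1 (xu f) q) ('D_e1 (xv f) q) = 0) ->
  canonical_eps f eps U.
Proof.
move=> H; split; first exact: iso.
move=> q Uq; have [EG F0] := iso Uq; have Eq := E0 Uq; have [Hr Hi] := H q Uq.
have E_neq0 : EE f q != 0 by rewrite gt_eqF.
have [S1 S2] := sff_unit_fields Uq.
have [I1 I2 _ _] := iso_relations oU sf iso Uq.
rewrite S1 S2.
exact: canonical_final_alg E_neq0 (mink_nproj_iso _ _ E_neq0 EG F0)
  (mink_nproj_iso _ _ E_neq0 EG F0) (mink_nproj_iso _ _ E_neq0 EG F0) I1 I2 Hr Hi.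
Qed.

End Canonical.

(** * Existence of canonical coordinates *)

Section ConformalChange.
Variables (R : realType).
Variables (g h : R * R -> 'rV[R]_4) (B W : set (R * R)) (k1 k2 al be : R * R -> R) (eps : R).
Hypotheses (oB : open B) (oW : open W) (sg : smooth_on B g) (sh : smooth_on W h)
  (kW : forall z, B z -> W (k1 z, k2 z)) (gh : forall z, B z -> g z = h (k1 z, k2 z))
  (kB : forall w, W w -> exists2 z, B z & w = (k1 z, k2 z))
  (sal : smooth_on B al) (sbe : smooth_on B be)
  (iso : isothermal g B) (E0 : forall z, B z -> 0 < EE g z)
  (harm : forall z, B z -> 'D_e1 (xu g) z + 'D_e2 (xv g) z = 0)
  (root : forall z, B z -> [/\ csqR al be z ^+ 2 - csqI al be z ^+ 2 = eps * hopfR g z,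
     2 * (csqR al be z * csqI al be z) = eps * hopfI g z,
     al z ^+ 2 + be z ^+ 2 != 0, 'D_e1 al z = 'D_e2 be z & 'D_e2 al z = - 'D_e1 be z])
  (eps2 : eps ^+ 2 = 1)
  (dk : forall z, B z ->
    [/\ is_derive z e1 k1 (al z), is_derive z e2 k1 (- be z),
        is_derive z e1 k2 (be z) & is_derive z e2 k2 (al z)]).

Lemma conformal_first z : B z -> let w := (k1 z, k2 z) in
  [/\ xu g z = al z *: xu h w + be z *: xv h w, xv g z = (- be z) *: xu h w + al z *: xv h w &
   [/\ 0 < EE h w, EE h w = GG h w & FF h w = 0]].
Proof.
move=> Bz w; have [a1 a2 b1 b2] := dk Bz; have [_ _ S0 _ _] := root Bz.
have X1 : xu g z = al z *: xu h w + be z *: xv h w := derive_change oB oW sh kW gh Bz a1 b1.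
have X2 : xv g z = (- be z) *: xu h w + al z *: xv h w := derive_change oB oW sh kW gh Bz a2 b2.
have [EG F0] := iso Bz.
split; [exact: X1|exact: X2|].
exact: conformal_isothermal_alg X1 X2 S0 (E0 Bz) EG F0.
Qed.

Lemma conformal_isothermal : isothermal h W.
Proof. by move=> _ /kB[z Bz ->]; have [_ _ [_ c d]] := conformal_first Bz; split; [exact: c|exact: d]. Qed.

Lemma conformal_EE w : W w -> 0 < EE h w.
Proof. by move=> /kB[z Bz ->]; have [_ _ [c _ _]] := conformal_first Bz; exact: c. Qed.

(** Second derivatives of g in terms of those of h give first that h is
    harmonic, then, by [canonical_alg], the value of its Hopf differential. *)
Lemma conformal_canonical : canonical_eps h eps W.
Proof.
apply: (canonical_of_hopf oW sh conformal_isothermal conformal_EE) => w Ww.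
have [z Bz Ew] := kB Ww; rewrite {}Ew in Ww *.
have [a1 a2 b1 b2] := dk Bz; have [RA RB S0 CR1 CR2] := root Bz.
have [X1 X2 [e0 en m0]] := conformal_first Bz.
have Xu : {in B, (fun z => al z *: xu h (k1 z, k2 z) + be z *: xv h (k1 z, k2 z)) =1 xu g}.
  by move=> y; rewrite inE => By; have [X _ _] := conformal_first By; exact: esym X.
have Xv : {in B, (fun z => (- be z) *: xu h (k1 z, k2 z) + al z *: xv h (k1 z, k2 z)) =1 xv g}.
  by move=> y; rewrite inE => By; have [_ X _] := conformal_first By; exact: esym X.
have Da1 := is_derive_D1 sal Bz; have Da2 := is_derive_D2 sal Bz.
have Db1 := is_derive_D1 sbe Bz; have Db2 := is_derive_D2 sbe Bz.
have H11 := is_derive_change_second oW sh kW Bz a1 b1 Da1 Db1.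
have H12 := is_derive_change_second oW sh kW Bz a1 b1 (is_deriveN Db1) Da1.
have H22 := is_derive_change_second oW sh kW Bz a2 b2 (is_deriveN Db2) Da2.
have X11 := esym (is_derive_eq_open oB Xu Bz H11 (is_derive_xuu sg Bz)).
have X12 := esym (is_derive_eq_open oB Xv Bz H12 (is_derive_xuv sg Bz)).
have X22 := esym (is_derive_eq_open oB Xv Bz H22 (is_derive_xvv sg Bz)).
have Y := conformal_harmonic_alg X11 X22 CR1 CR2 S0 (harm Bz).
have [I1 I2 _ _] := iso_relations oW sh conformal_isothermal Ww.
exact: canonical_alg X11 X12 Y en m0 I1 I2 erefl erefl RA RB S0 eps2.
Qed.

End ConformalChange.

Section Main.
Variables (R : realType) (M : topologicalType) (A : set (chart R M)) (x : M -> 'rV[R]_4).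

Lemma coordinate_change_smooth (c c' : chart R M) B k1 k2 : coordinate_change c c' B k1 k2 ->
  smooth_on (cod c) (x \o from c) -> smooth_on (cod c') (x \o from c').
Proof.
move=> [oB Bc _ _ _ _ _ [psi [spsi psiB ->]]] sf.
have cU w : cod c' w -> cod c (psi w) by move=> /psiB; exact: Bc.
have H := smooth_comp_rV (@cod_open _ _ c') (@cod_open _ _ c) cU spsi sf.
exact: H.
Qed.

(** The Gram determinant is read off from the length of the component of xv f
    q orthogonal to xu f q. *)
Lemma spacelike_pos (f : R * R -> 'rV[R]_4) q :
  (forall a b : R, a *: xu f q + b *: xv f q = 0 -> a = 0 /\ b = 0) ->
  (forall w, tangent f q w -> w != 0 -> 0 < mink w w) ->
  0 < EE f q /\ 0 < gram f q.
Proof.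
rewrite /EE /gram /EE /FF /GG /tangent; move: (xu f q) (xv f q) => y1 y2 ind pos.
have E0 : 0 < mink y1 y1.
  apply: pos; first by exists 1, 0; rewrite scale1r scale0r addr0.
  apply/eqP => y10; have [] := ind 1 0; first by rewrite y10 scaler0 scale0r addr0.
  by move/eqP; rewrite oner_eq0.
split=> //; pose w := (- mink y1 y2) *: y1 + mink y1 y1 *: y2.
have w0 : w != 0.
  by apply/eqP => /ind[_ E]; move: E0; rewrite E ltxx.
have : 0 < mink w w by apply: pos => //; exists (- mink y1 y2), (mink y1 y1).
have -> : mink w w = mink y1 y1 * (mink y1 y1 * mink y2 y2 - mink y1 y2 ^+ 2).
  by rewrite /w !minkE (minkC y2 y1); ring.
by rewrite pmulr_rgt0.
Qed.

Lemma xu_coord_neq0 (f : R * R -> 'rV[R]_4) q : 0 < EE f q -> exists i, xu f q 0 i != 0.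
Proof.
move=> E0; apply: contrapT => H.
have H0 i : xu f q 0 i = 0 by apply: contrapT => /eqP Hi; apply: H; exists i.
by move: E0; rewrite /EE /mink !H0 !mulr0 !addr0 subrr ltxx.
Qed.

Hypotheses (hA : smooth_atlas A) (hx : immersion A x)
  (hspace : space_like A x) (hmin : minimal A x)
  (hdeg : forall p : M, ~ degenerate_point A x p).

(** The coordinate function h = f_i is chosen with h_u <> 0 at p, and the new
    coordinates are h and a primitive of *dh. If the Hopf differential
    vanished at p, [null_normal] would provide a light-like vector that makes
    p degenerate already in the original chart. *)
Lemma exists_isothermal_chart (p : M) : exists c1 : chart R M,
  let g := x \o from c1 in let W := cod c1 in
  [/\ local_coordinates A c1, dom c1 p, smooth_on W g, isothermal g W &
   [/\ forall w, W w -> 0 < EE g w,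
       forall w, W w -> 'D_e1 (xu g) w + 'D_e2 (xv g) w = 0 &
       hopfR g (to c1 p) ^+ 2 + hopfI g (to c1 p) ^+ 2 != 0]].
Proof.
have [c0 Ac0 c0p] := hA.1 p.
have Lc0 : local_coordinates A c0 by move=> c' Ac'; exact: hA.2.
pose f := x \o from c0; pose U := cod c0; have oU : open U := @cod_open _ _ c0.
have [sf ind] := hx Ac0.
have pos q : U q -> 0 < EE f q /\ 0 < gram f q.
  move=> Uq; apply: spacelike_pos; first exact: ind Uq.
  have := hspace Ac0 (from_dom Uq); rewrite (fromK Uq); exact.
have T z : U z -> exists a b, GG f z *: 'D_e1 (xu f) z - (2 * FF f z) *: 'D_e1 (xv f) z
     + EE f z *: 'D_e2 (xv f) z = a *: xu f z + b *: xv f z.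
  move=> Uz; apply: mean_curvature0_tangent; first exact: lt0r_neq0 (pos z Uz).2.
  by have := hmin Ac0 (from_dom Uz); rewrite (fromK Uz).
have Uq0 : U (to c0 p) := to_cod c0p.
have [i hi] := xu_coord_neq0 (pos _ Uq0).1.
have sxu : smooth_on U (fun z => xu f z 0 i) := (smooth_rVP _ oU).1 (smooth_xu sf) i.
have sxv : smooth_on U (fun z => xv f z 0 i) := (smooth_rVP _ oU).1 (smooth_xv sf) i.
have D0 z : U z -> 0 < gram f z by move=> /pos[].
have sP : smooth_on U (fun z => starP f z 0 i) := (smooth_rVP _ oU).1 (smooth_starP oU sf D0) i.
have sQ : smooth_on U (fun z => starQ f z 0 i) := (smooth_rVP _ oU).1 (smooth_starQ oU sf D0) i.
pose V := U `&` [set z | xu f z 0 i != 0].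
have oV : open V by apply: open_neq0 oU _ => z Uz; exact: smooth_continuous sxu Uz.
have VU : V `<=` U by move=> z [].
have cl1 z : V z -> 'D_e2 (fun z => xu f z 0 i) z = 'D_e1 (fun z => xv f z 0 i) z.
  move=> /VU Uz.
  have [_ d2] := smooth_derivable (smooth_xu sf) Uz.
  have [d1 _] := smooth_derivable (smooth_xv sf) Uz.
  apply: etrans (derive_coord i d2) (etrans _ (esym (derive_coord i d1))).
  have E : 'D_e2 (xu f) z = 'D_e1 (xv f) z := esym (mixed_partials_eq_rV oU sf Uz).
  exact: coord_eq E.
have cl2 z : V z -> 'D_e2 (fun z => starP f z 0 i) z = 'D_e1 (fun z => starQ f z 0 i) z.
  move=> /VU Uz.
  have [_ d2] := smooth_derivable (smooth_starP oU sf D0) Uz.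
  have [d1 _] := smooth_derivable (smooth_starQ oU sf D0) Uz.
  apply: etrans (derive_coord i d2) (etrans _ (esym (derive_coord i d1))).
  exact: coord_eq (star_closed oU sf D0 Uz (T _ Uz)).
have J0 : xu f (to c0 p) 0 i * starQ f (to c0 p) 0 i
   - xv f (to c0 p) 0 i * starP f (to c0 p) 0 i != 0.
  have w0 : 0 < (Num.sqrt (gram f (to c0 p)))^-1 by rewrite invr_gt0 sqrtr_gt0 D0.
  exact: star_jac_neq0 (pos _ Uq0).1 (pos _ Uq0).2 w0 hi
    (scale_sub_coord _ _ _ _ _ _) (scale_sub_coord _ _ _ _ _ _).
have [c1 [B [k1 [k2 [[Lc1 c1p BV [Bp kp] cc] dk]]]]] :=
  coordinates_of_closed_forms Lc0 c0p oV VU (conj Uq0 hi) (smooth_sub VU sxu)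
   (smooth_sub VU sxv) (smooth_sub VU sP) (smooth_sub VU sQ) cl1 cl2 J0.
have sg := coordinate_change_smooth cc sf.
have [oB BU _ _ kW kf kB _] := cc.
have fg z : B z -> f z = (x \o from c1) (k1 z, k2 z) by move=> Bz; rewrite /= kf.
have BU' z : B z -> U z by move=> /BU.
have sfB := smooth_sub BU sf.
have E0B z : B z -> 0 < EE f z by move=> /BU /pos[].
have D0B z : B z -> 0 < gram f z by move=> /BU /pos[].
have TB z (Bz : B z) := T z (BU z Bz).
have hB z : B z -> xu f z 0 i != 0 by move=> /BV[].
have oW := @cod_open _ _ c1.
have isog := star_isothermal oB oW sg kW fg kB E0B D0B hB dk.
have Eg := star_EE oB oW sg kW fg kB E0B D0B hB dk.
have harm := star_harmonic oB oW sfB sg kW fg kB E0B D0B TB hB dk.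
exists c1; split; [exact: Lc1|exact: c1p|exact: sg|exact: isog|].
split; [exact: Eg|exact: harm|].
rewrite kp; apply/negP => /eqP H0; apply: (hdeg (p := p)); exists c0; split; [exact: Ac0|exact: c0p|].
set w := (k1 (to c0 p), k2 (to c0 p)) in H0.
have Ww : cod c1 w := kW _ Bp.
have [X1 X2 [en m0] e0 J] := star_change oB oW sg kW fg E0B D0B hB dk Bp.
have [s11 [t11 [s12 [t12 [s22 [t22 [X11 X12 X22]]]]]]] :=
  star_change_second oB oW sfB sg kW fg E0B D0B hB dk Bp.
have [I1 I2 _ _] := iso_relations oW sg isog Ww.
have [HR HI] := sum_sqr_eq0 H0.
have [n [[n0 nn] n1 n2 F11 F12]] := null_normal e0 en m0 I1 I2 HR HI.
have Y := harm w Ww.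
apply: (degenerate_of_normal_form oU sf Uq0 _ n0 nn).
- exact: lt0r_neq0 (D0 _ Uq0).
- exact: orth_span n1 n2 X1.
- exact: orth_span n1 n2 X2.
- exact: normal_form_change X1 X2 J Y F11 F12 X11.
- exact: normal_form_change X1 X2 J Y F11 F12 X12.
- exact: normal_form_change X1 X2 J Y F11 F12 X22.
Qed.

(** With t = u + i v the old isothermal coordinate, the new one is a primitive
    of (al + i be) dt, where (al + i be)^4 is eps times the Hopf differential. *)
Lemma exists_canonical_chart (eps : R) (p : M) : eps ^+ 2 = 1 ->
  exists c : chart R M, [/\ local_coordinates A c, dom c p &
    canonical_eps (x \o from c) eps (cod c)].
Proof.
move=> eps2; have [c1 [Lc1 c1p sg iso [E0 harm hopf0]]] := exists_isothermal_chart p.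
set g := x \o from c1 in sg iso E0 harm hopf0; set U := cod c1 in sg iso E0 harm.
have oU : open U := @cod_open _ _ c1; have Up : U (to c1 p) := to_cod c1p.
have [sR sI] := smooth_hopf oU sg.
have sA : smooth_on U (fun z => eps * hopfR g z) by exact: smoothM oU (smooth_cst U eps) sR.
have sB : smooth_on U (fun z => eps * hopfI g z) by exact: smoothM oU (smooth_cst U eps) sI.
have CR z (Uz : U z) := hopf_cauchy_riemann eps oU sg harm Uz.
have AB0 : (eps * hopfR g (to c1 p)) ^+ 2 + (eps * hopfI g (to c1 p)) ^+ 2 != 0.
  by rewrite (sum_sqr_unit _ _ eps2); exact: hopf0.
have [V [al [be [[oV VU Vp sal sbe] root]]]] := holomorphic_fourth_root oU Up sA sB CR AB0.
have sNbe := smoothN oV sbe.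
have cl1 z : V z -> 'D_e2 al z = 'D_e1 (fun z => - be z) z.
  move=> Vz; have [_ _ _ _ ->] := root z Vz.
  exact: esym (derive_val (is_derive := is_deriveN (is_derive_D1 sbe Vz))).
have cl2 z : V z -> 'D_e2 be z = 'D_e1 al z.
  by move=> Vz; have [_ _ _ E _] := root z Vz; exact: esym E.
have J0 : al (to c1 p) * al (to c1 p) - - be (to c1 p) * be (to c1 p) != 0.
  by rewrite mulNr opprK -!expr2; have [_ _ S0 _ _] := root _ Vp; exact: S0.
have [c2 [B [k1 [k2 [[Lc2 c2p BV _ cc] dk]]]]] :=
  coordinates_of_closed_forms Lc1 c1p oV VU Vp sal sNbe sbe sal cl1 cl2 J0.
exists c2; split; [exact: Lc2|exact: c2p|].
have sh := coordinate_change_smooth cc sg.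
have [oB BU _ _ kW kf kB _] := cc.
have gh z : B z -> g z = (x \o from c2) (k1 z, k2 z) by move=> Bz; rewrite /= kf.
apply: (conformal_canonical oB (@cod_open _ _ c2) (smooth_sub BU sg) sh kW gh kB
  (smooth_sub BV sal) (smooth_sub BV sbe) _ _ _ _ eps2 dk).
- by move=> z /BU; exact: iso.
- by move=> z /BU; exact: E0.
- by move=> z /BU; exact: harm.
- by move=> z /BV; exact: root.
Qed.

End Main.

Theorem theorem6p6 (R : realType) (M : topologicalType)
    (A : set (chart R M)) (x : M -> 'rV[R]_4)
    (hM : smooth_manifold2 A) (hx : immersion A x)
    (hspace : space_like A x) (hmin : minimal A x)
    (hdeg : forall p : M, ~ degenerate_point A x p) :
  (forall p : M, exists c : chart R M,
     [/\ local_coordinates A c, dom c p &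
         canonical_first (x \o from c) (cod c)]) /\
  (forall p : M, exists c : chart R M,
     [/\ local_coordinates A c, dom c p &
         canonical_second (x \o from c) (cod c)]).
Proof.
have [_ _ hA] := hM.
split=> p; first by apply: exists_canonical_chart => //; rewrite expr1n.
by apply: exists_canonical_chart => //; rewrite sqrrN expr1n.
Qed.
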